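(* For $w\in S_\mathbb{Z}$, $$\Delta({\overleftarrow{\mathfrak{G}}}_w)=\sum_{u*v=w}(-1)^{\ell(u)+\ell(v)-\ell(w)}G_u\otimes{\overleftarrow{\mathfrak{G}}}_v,\qquad {\overleftarrow{\mathfrak{G}}}_w=\sum_{\substack{u*v=w\\ v\in S_{\ne0}}}(-1)^{\ell(u)+\ell(v)-\ell(w)}G_u\,\mathfrak{G}_v .$$
   Context: $S_\mathbb{Z}$ is the group of permutations of $\mathbb{Z}$ fixing all but finitely many integers, generated by the $s_i$ ($i\in\mathbb Z$) exchanging $i,i+1$; $\ell$ is length; the Hecke product $*$ is the associative product with identity and $s_i*w=s_iw$ if $\ell(s_iw)>\ell(w)$, $s_i*w=w$ otherwise. $S_+=\langle s_i:i>0\rangle$, $S_-=\langle s_i:i<0\rangle$, $S_{\ne0}=S_-\times S_+$, $S_n\subset S_+$ the permutations of $\{1,\dots,n\}$; $\gamma,\omega$ are the automorphisms of $S_\mathbb Z$ with $\gamma(s_i)=s_{i+1}$, $\omega(s_i)=s_{-i}$. Write $\ominus b=-b/(1-b)$. Let $\tilde\pi_i f=\frac{(1-x_{i+1})f-(1-x_i)s_i(f)}{x_i-x_{i+1}}$ where $s_i$ swaps $x_i,x_{i+1}$. For $w\in S_n$, the Grothendieck polynomial $\mathfrak{G}_w$ is defined by $\mathfrak{G}_{w_0}=x_1^{n-1}x_2^{n-2}\cdots x_{n-1}$ ($w_0$ longest in $S_n$) and $\mathfrak{G}_w=\tilde\pi_i\mathfrak{G}_{ws_i}$ when $\ell(ws_i)>\ell(w)$;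 it is independent of $n$. For $w\in S_-$, $\mathfrak{G}_w$ is $\mathfrak{G}_{\omega(w)}$ with $x_i\mapsto\ominus x_{1-i}$ for all $i$; for $w=uv\in S_{\ne0}$ ($u\in S_-,v\in S_+$), $\mathfrak{G}_w=\mathfrak{G}_u\mathfrak{G}_v$. The back stable Grothendieck polynomial ${\overleftarrow{\mathfrak{G}}}_w$ ($w\in S_\mathbb Z$) is the coefficientwise limit as $p\to-\infty$ of $\mathfrak{G}_{\gamma^{1-p}(w)}$ with each $x_i$ replaced by $x_{i+p-1}$ (defined once $\gamma^{1-p}(w)\in S_+$). The $K$-Stanley function is $G_u=\sum(-1)^{p-\ell(u)}x_{i_1}\cdots x_{i_p}$, over $p\ge0$, sequences $(a_1,\dots,a_p)$ with $s_{a_1}*\cdots*s_{a_p}=u$, and integers $i_1\le\cdots\le i_p\le0$ with $a_k\le a_{k+1}\Rightarrow i_k<i_{k+1}$. All these are formal power series in the $x_i$ ($1/(1-x_i)$ expanded geometrically). Let $\hat\Lambda$ be the completed ring of symmetric functions in $x_{\le0}=(x_0,x_{-1},\dots)$, $R=\mathbb{Z}[(1-x_i)^{\pm1}:i\in\mathbb Z]$, and $\overleftarrow R=\hat\Lambda\otimes_\mathbb{Z}R$, regarded as a ring of power series via $f\otimes r\mapsto f(x_{\le0})\,r$; each ${\overleftarrow{\mathfrak{G}}}_w$ lies in $\overleftarrow R$. The coproduct $\Delta:\overleftarrow R\to\hat\Lambda\hat\otimes\overleftarrow R$ is the ring homomorphism that acts on the $\hat\Lambda$ factor by the usual coproduct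 of symmetric functions ($\Delta(p_k)=p_k\otimes1+1\otimes p_k$) and sends each $x_i$ from the $R$ factor to $1\otimes x_i$. *)

(* Defs.v *)
From HB Require Import structures.
From mathcomp Require Import all_boot all_order all_algebra.
From mathcomp Require Import finmap multiset.
From mathcomp Require Import all_classical zify.

Set Implicit Arguments.
Unset Strict Implicit.
Unset Printing Implicit Defensive.

Import Order.TTheory GRing.Theory Num.Theory.
Local Open Scope classical_set_scope.
Local Open Scope ring_scope.

(** * The group of finitary permutations of the integers *)

Record SZ := MkSZ {
  SZfun :> int -> int;
  SZ_bij : bijective SZfun;
  SZ_fin : finite_set [set i | SZfun i <> i] }.

Lemma SZP (u v : SZ) : SZfun u =1 SZfun v -> u = v.
Proof.
case: u v => [f fb ff] [g gb gf] /= /funext fg; subst g.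
by rewrite (Prop_irrelevance fb gb) (Prop_irrelevance ff gf).
Qed.

HB.instance Definition _ := gen_eqMixin SZ.
HB.instance Definition _ := gen_choiceMixin SZ.

Definition SZ_one : SZ.
Proof.
apply: (@MkSZ id); first by exists id.
by rewrite (_ : [set _ | _] = set0)// -subset0 => i /=; apply.
Defined.

(* Permutations are composed as functions: (u v)(i) = u(v(i)). *)
Definition SZ_mul (u v : SZ) : SZ.
Proof.
apply: (@MkSZ (u \o v)); first exact: bij_comp (SZ_bij u) (SZ_bij v).
apply: sub_finite_set (_ : _ `<=` [set i | u i <> i] `|` [set i | v i <> i]) _.
  by move=> i /= uvi; have [vi|] := pselect (v i = i); [left; rewrite -{1}vi|right].
by rewrite finite_setU; split; exact: SZ_fin.
Defined.

Definition SZ_inv_fun (u : SZ) (i : int) : int := xget 0 [set j | u j = i].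

Lemma SZ_inv_funK (u : SZ) : cancel (SZ_inv_fun u) u.
Proof.
move=> i; rewrite /SZ_inv_fun; case: xgetP => // /= noj.
by have [g _ gK] := SZ_bij u; case: (noj (g i)).
Qed.

Lemma SZ_funK (u : SZ) : cancel u (SZ_inv_fun u).
Proof. by move=> i; apply: (bij_inj (SZ_bij u)); rewrite SZ_inv_funK. Qed.

Definition SZ_inv (u : SZ) : SZ.
Proof.
apply: (@MkSZ (SZ_inv_fun u)).
  by exists u; [exact: SZ_inv_funK|exact: SZ_funK].
apply: sub_finite_set (SZ_fin u) => i /= ui ui'.
by apply: ui; rewrite -{1}ui' SZ_funK.
Defined.

Lemma SZ_mulA : associative SZ_mul.
Proof. by move=> u v w; exact: SZP. Qed.

Lemma SZ_mul1 : left_id SZ_one SZ_mul.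
Proof. by move=> u; exact: SZP. Qed.

Lemma SZ_mulr1 : right_id SZ_one SZ_mul.
Proof. by move=> u; exact: SZP. Qed.

Lemma SZ_mulV : left_inverse SZ_one SZ_inv SZ_mul.
Proof. by move=> u; apply: SZP; exact: SZ_funK. Qed.

Lemma SZ_mulrV : right_inverse SZ_one SZ_inv SZ_mul.
Proof. by move=> u; apply: SZP; exact: SZ_inv_funK. Qed.

HB.instance Definition _ := isGroup.Build SZ
  SZ_mulA SZ_mul1 SZ_mulr1 SZ_mulV SZ_mulrV.

Definition sfun (i j : int) : int :=
  if j == i then i + 1 else if j == i + 1 then i else j.

Lemma sfunK i : involutive (sfun i).
Proof.
move=> j; rewrite /sfun.
have i1 : (i + 1 == i) = false by rewrite -subr_eq0 addrAC subrr add0r.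
have [->|ji] := eqVneq j i; first by rewrite i1 eqxx.
have [->|ji1] := eqVneq j (i + 1); first by rewrite eqxx.
by rewrite (negbTE ji) (negbTE ji1).
Qed.

Definition s (i : int) : SZ.
Proof.
apply: (@MkSZ (sfun i)); first by exists (sfun i); exact: sfunK.
apply: sub_finite_set (_ : _ `<=` [set i] `|` [set i + 1]) _.
  move=> j /=; rewrite /sfun.
  by have [->|] := eqVneq j i; [left|have [->|] := eqVneq j (i + 1); [right|]].
by rewrite finite_setU; split; exact: finite_set1.
Defined.

Definition gamma (w : SZ) : SZ.
Proof.
apply: (@MkSZ (fun i => w (i - 1) + 1)).
  exists (fun i => SZ_inv_fun w (i - 1) + 1) => i.
    by rewrite addrK SZ_funK subrK.
  by rewrite addrK SZ_inv_funK subrK.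
apply: sub_finite_set (_ : _ `<=` (fun i => i + 1) @` [set i | w i <> i]) _.
  by move=> i /= wi; exists (i - 1); rewrite ?subrK// => wi'; apply: wi; rewrite wi' subrK.
by apply: finite_image; exact: SZ_fin.
Defined.

Definition omega (w : SZ) : SZ.
Proof.
apply: (@MkSZ (fun i => 1 - w (1 - i))).
  exists (fun i => 1 - SZ_inv_fun w (1 - i)) => i.
    by rewrite !subKr SZ_funK subKr.
  by rewrite !subKr SZ_inv_funK subKr.
apply: sub_finite_set (_ : _ `<=` (fun i => 1 - i) @` [set i | w i <> i]) _.
  by move=> i /= wi; exists (1 - i); rewrite ?subKr// => wi'; apply: wi; rewrite wi' subKr.
by apply: finite_image; exact: SZ_fin.
Defined.

Lemma gammaM : {morph gamma : u v / (u * v)%g}.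
Proof. by move=> u v; apply: SZP => i /=; rewrite addrK. Qed.

Lemma gamma_s i : gamma (s i) = s (i + 1).
Proof.
apply: SZP => j /=; rewrite /sfun !subr_eq.
by case: eqP => // _; case: eqP => // _; rewrite subrK.
Qed.

Lemma omegaM : {morph omega : u v / (u * v)%g}.
Proof. move=> u v; apply: SZP => i; rewrite -[LHS]/(1 - u (v (1 - i))).
rewrite -[RHS]/(1 - u (1 - (1 - v (1 - i)))).
by rewrite subKr. Qed.

Lemma omega_s i : omega (s i) = s (- i).
Proof.
apply: SZP => j /=; rewrite /sfun.
by repeat (case: eqP => ?); lia.
Qed.

(** * Length and Hecke product *)

Definition wprod (a : seq int) : SZ := (\prod_(i <- a) s i)%g.

Definition is_reduced_word (w : SZ) (a : seq int) :=
  wprod a = w /\ forall b, wprod b = w -> (size a <= size b)%N.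

Definition reduced_word (w : SZ) : seq int := xget [::] (is_reduced_word w).

Definition len (w : SZ) : nat := size (reduced_word w).

Definition hecke_s (i : int) (w : SZ) : SZ :=
  if (len w < len (s i * w)%g)%N then (s i * w)%g else w.

(* For a reduced word a_1 ... a_n of u the rule for s_i * w gives
   u = s_{a_1} * ... * s_{a_n}, so by associativity
   u * v = s_{a_1} * (s_{a_2} * ( ... * (s_{a_n} * v))). *)
Definition hecke (u v : SZ) : SZ := foldr hecke_s v (reduced_word u).

(* s_i is its own inverse, so words in the s_i give the generated subgroup. *)
Definition Sgen (A : set int) : set SZ :=
  [set w | exists2 a : seq int, {in a, forall i, A i} & w = wprod a].

Definition Splus : set SZ := Sgen [set i | 0 < i].
Definition Sminus : set SZ := Sgen [set i | i < 0].

Definition Sne0 : set SZ :=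
  [set w | exists u v, [/\ Sminus u, Splus v & w = (u * v)%g]].

Definition Sn (n : nat) : set SZ :=
  [set w | forall i : int, ~~ (1 <= i <= n%:Z) -> w i = i].

(** * Formal power series with integer coefficients *)

(* A monomial in variables indexed by K is a finite multiset on K, and F m is
   the coefficient of the monomial m in F. *)
Definition series (K : choiceType) : Type := {mset K}%mset -> int.

HB.instance Definition _ (K : choiceType) := GRing.Zmodule.on (series K).

Section SeriesRing.
Variable K : choiceType.
Implicit Types (m : {mset K}%mset) (F G H : series K).

Definition decomp m : set ({mset K}%mset * {mset K}%mset) :=
  [set p | (p.1 `+` p.2)%mset = m].

Definition series_mul F G : series K :=
  fun m => \sum_(p \in decomp m) F p.1 * G p.2.

Definition series_one : series K := fun m => (m == mset0)%:R.

Lemma finite_decomp m : finite_set (decomp m).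
Proof.
rewrite -(seq_mset_id m); elim: (m : seq K) => [|a t IH].
  apply: sub_finite_set (finite_set1 (mset0, mset0)) => -[p q] /= /esym pq0.
  have {}pq0 x : (p x + q x = 0)%N.
    move: (congr1 (fun z : {mset K}%mset => z x) pq0).
    by rewrite mset_seqE msetE2 /= => <-.
  by congr (_, _); apply/msetP => x; rewrite mset0E; have := pq0 x; lia.
rewrite mset_cons.
pose f (p : {mset K}%mset * {mset K}%mset) := ((a +` p.1)%mset, p.2).
pose g (p : {mset K}%mset * {mset K}%mset) := (p.1, (a +` p.2)%mset).
apply: sub_finite_set
  (_ : _ `<=` f @` decomp (seq_mset t) `|` g @` decomp (seq_mset t)) _; last first.
  by rewrite finite_setU; split; exact: finite_image.
move=> [p q]; rewrite /decomp /= => pq.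
have : a \in (p `+` q)%mset by rewrite pq mset1D1.
rewrite in_msetD => /orP[ap|aq]; [left; exists ((p `\ a)%mset, q)|right; exists (p, (q `\ a)%mset)].
- by rewrite /= -(msetD1K a (seq_mset t)) -pq -{2}(msetB1K ap) -msetDA msetD1K.
- by rewrite /f /= msetB1K.
- by rewrite /= -(msetD1K a (seq_mset t)) -pq -{2}(msetB1K aq) msetDCA msetD1K.
- by rewrite /g /= msetB1K.
Qed.

Let D m : seq _ := fset_set (decomp m).

Let D_uniq m : uniq (D m). Proof. exact: fset_uniq. Qed.

Let mem_D m p : (p \in D m) = ((p.1 `+` p.2)%mset == m).
Proof.
rewrite /D in_fset_set; last exact: finite_decomp.
by apply/idP/eqP; rewrite inE.
Qed.

Lemma series_mulE F G m :
  series_mul F G m = \sum_(p <- fset_set (decomp m)) F p.1 * G p.2.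
Proof. by rewrite /series_mul fsbig_finite//; exact: finite_decomp. Qed.

Lemma series_mulC : commutative series_mul.
Proof.
move=> F G; apply/funext => m; rewrite !series_mulE -/(D m).
pose h (p : {mset K}%mset * {mset K}%mset) := (p.2, p.1).
have hK : involutive h by case.
rewrite (_ : \sum_(p <- D m) F p.1 * G p.2 = \sum_(p <- map h (D m)) G p.1 * F p.2).
  apply: perm_big; apply: uniq_perm => //.
    by rewrite map_inj_uniq//; exact: inv_inj.
  move=> p; rewrite -{1}(hK p) mem_map; last exact: inv_inj.
  by rewrite !mem_D /= msetDC.
by rewrite big_map; apply: eq_bigr => p _; rewrite mulrC.
Qed.

Lemma series_mulA : associative series_mul.
Proof.
move=> F G H; apply/funext => m; rewrite !series_mulE -!/(D m).
pose f (t : {mset K}%mset * ({mset K}%mset * {mset K}%mset)) :=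
  F t.1 * (G t.2.1 * H t.2.2).
transitivity (\sum_(t <- [seq (p.1, (q.1, q.2)) | p <- D m, q <- D p.2]) f t).
  rewrite big_allpairs_dep; apply: eq_bigr => p _.
  by rewrite series_mulE mulr_sumr.
transitivity (\sum_(t <- [seq (q.1, (q.2, p.2)) | p <- D m, q <- D p.1]) f t); last first.
  rewrite big_allpairs_dep; apply: eq_bigr => p _.
  by rewrite series_mulE mulr_suml; apply: eq_bigr => q _; rewrite /f mulrA.
apply: perm_big; apply: uniq_perm.
- apply: allpairs_uniq_dep => //.
  move=> x y /allpairsPdep[[a b] [[c d] [_ + ->]]].
  rewrite mem_D /= => /eqP <- /allpairsPdep[[a' b'] [[c' d'] [_ + ->]]].
  by rewrite mem_D /= => /eqP <- [-> -> ->].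
- apply: allpairs_uniq_dep => //.
  move=> x y /allpairsPdep[[a b] [[c d] [_ + ->]]].
  rewrite mem_D /= => /eqP <- /allpairsPdep[[a' b'] [[c' d'] [_ + ->]]].
  by rewrite mem_D /= => /eqP <- [-> -> ->].
move=> [a [b c]]; apply/allpairsPdep/allpairsPdep => /=.
  move=> [[p q] [[p' q'] []]]; rewrite !mem_D /= => /eqP<- /eqP<- [-> -> ->].
  by exists ((p `+` p')%mset, q'), (p, p'); rewrite !mem_D /= msetDA !eqxx.
move=> [[p q] [[p' q'] []]]; rewrite !mem_D /= => /eqP<- /eqP<- [-> -> ->].
by exists (p', (q' `+` q)%mset), (q', q); rewrite !mem_D /= msetDA !eqxx.
Qed.

Lemma series_mul1 : left_id series_one series_mul.
Proof.
move=> F; apply/funext => m; rewrite series_mulE -/(D m).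
rewrite (bigD1_seq (mset0, m)) //=; last by rewrite mem_D /= mset0D.
rewrite /series_one eqxx mul1r big_seq_cond big1 ?addr0// => -[a b].
rewrite mem_D /= => /andP[/eqP <- ab]; have [a0|] := eqVneq a mset0; last by rewrite mul0r.
by move: ab; rewrite a0 mset0D eqxx.
Qed.

Lemma series_mulD : left_distributive series_mul +%R.
Proof.
move=> F G H; apply/funext => m.
rewrite -[RHS]/(series_mul F H m + series_mul G H m) !series_mulE -big_split.
by apply: eq_bigr => p _; exact: mulrDl.
Qed.

Lemma series_oner_neq0 : series_one != 0.
Proof.
by apply/eqP => /(congr1 (fun F : series K => F mset0)); rewrite /series_one eqxx.
Qed.

HB.instance Definition _ := GRing.Zmodule_isComNzRing.Build (series K)
  series_mulA series_mulC series_mul1 series_mulD series_oner_neq0.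

End SeriesRing.

Definition X (K : choiceType) (i : K) : series K := fun m => (m == [mset i]%mset)%:R.

(* The sum of a family of power series, taken coefficientwise: it is the formal
   sum of the family when every monomial occurs in finitely many of its members. *)
Definition ssum (K T : choiceType) (A : set T) (F : T -> series K) : series K :=
  fun m => \sum_(t \in A) F t m.

(* f(x_i := b_i); meant for families b such that each monomial of the result
   receives contributions from finitely many monomials of f. *)
Definition subst (K L : choiceType) (b : K -> series L) (f : series K) : series L :=
  ssum [set: {mset K}%mset] (fun m => (\prod_(i <- finsupp m) b i ^+ m i) *~ f m).

Definition geom (K : choiceType) (b : series K) : series K :=
  ssum [set: nat] (fun k => b ^+ k).

Definition ominus (K : choiceType) (b : series K) : series K := - b * geom b.

(** * Grothendieck polynomials *)

Definition swap (i : int) (f : series int) : series int :=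
  subst (fun j => X (s i j)) f.

(* The quotient is unique when it exists, x_i - x_{i+1} not being a zero divisor. *)
Definition tpi (i : int) (f : series int) : series int :=
  xget 0 [set g : series int | (X i - X (i + 1)) * g =
                               (1 - X (i + 1)) * f - (1 - X i) * swap i f].

Inductive groth_rel (n : nat) : SZ -> series int -> Prop :=
| groth_longest w : Sn n w -> (forall v, Sn n v -> (len v <= len w)%N) ->
    groth_rel n w (\prod_(1 <= i < n) X i%:Z ^+ (n - i))
| groth_step w i f : 0 < i < n%:Z -> (len w < len (w * s i)%g)%N ->
    groth_rel n (w * s i)%g f -> groth_rel n w (tpi i f).

Definition grothP (w : SZ) : series int :=
  xget 0 [set f | exists n, groth_rel n w f].

Definition grothM (w : SZ) : series int :=
  subst (fun i => ominus (X (1 - i))) (grothP (omega w)).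

Definition groth (w : SZ) : series int :=
  let uv := xget (1, 1)%g
    [set uv : SZ * SZ | [/\ Sminus uv.1, Splus uv.2 & w = (uv.1 * uv.2)%g]] in
  grothM uv.1 * grothP uv.2.

(* With k = 1 - p: the limit is k -> oo, and x_i is replaced by
   x_{i+p-1} = x_{i-k}. *)
Definition bsgroth_approx (w : SZ) (k : nat) : series int :=
  subst (fun i => X (i - k%:Z)) (grothP (iter k gamma w)).

Definition bsgroth (w : SZ) : series int :=
  fun m => xget 0 [set c : int |
    exists N : nat, forall k : nat, (N <= k)%N -> bsgroth_approx w k m = c].

(** * K-Stanley functions *)

Definition compatible (a i : seq int) : Prop :=
  [/\ size a = size i,
      forall k, (k < size i)%N -> i`_k <= 0,
      forall k, (k.+1 < size i)%N -> i`_k <= i`_k.+1 &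
      forall k, (k.+1 < size i)%N -> a`_k <= a`_k.+1 -> i`_k < i`_k.+1].

(* The exponents of -1 below, and in the theorem, are nonnegative: a Hecke word
   for u has at least len u letters, and len (u * v) <= len u + len v. *)
Definition kstanley (u : SZ) : series int :=
  ssum [set ai : seq int * seq int |
          foldr hecke 1%g (map s ai.1) = u /\ compatible ai.1 ai.2]
    (fun ai => (-1) ^+ (size ai.1 - len u) * \prod_(i <- ai.2) X i).

(** * The coproduct *)

(* The degree completion of the ring of symmetric functions in x_0, x_{-1}, ... *)
Definition hatLambda : set (series int) :=
  [set f | (forall m, f m != 0 -> forall i, i \in m -> i <= 0) /\
           (forall w, Sminus w -> subst (fun i => X (w i)) f = f)].

Inductive Rring : series int -> Prop :=
| Rring_1 : Rring 1
| Rring_gen i : Rring (1 - X i)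
| Rring_geninv i : Rring (geom (X i))
| Rring_sub f g : Rring f -> Rring g -> Rring (f - g)
| Rring_mul f g : Rring f -> Rring g -> Rring (f * g).

(* An element sum_k f_k (x) r_k of hatLambda (x) R, as the list of (f_k, r_k). *)
Definition is_tensor (t : seq (series int * series int)) : Prop :=
  {in t, forall fr, hatLambda fr.1 /\ Rring fr.2}.

Definition backR : set (series int) :=
  [set F | exists2 t, is_tensor t & F = \sum_(fr <- t) fr.1 * fr.2].

(* The completed tensor product of hatLambda and backR is realized inside the
   power series in two alphabets: inl i for the variables (of nonpositive index)
   of the left factor, inr i for those of the right factor. *)
Definition tens (f g : series int) : series (int + int)%type :=
  subst (fun i => X (inl i)) f * subst (fun i => X (inr i)) g.

(* f |-> f(y_0, x_0, y_{-1}, x_{-1}, ...), where y = inl and x = inr. *)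
Definition interleave (i : int) : (int + int)%type :=
  let n := `|i|%N in
  if odd n then inr (- (n./2)%:Z) else inl (- (n./2)%:Z).

Definition coprodL (f : series int) : series (int + int)%type :=
  subst (fun i => X (interleave i)) f.

(* Well defined on backR: for M large, the coefficient of y^a x^b in the sum is
   that of x^b times (y^a with y_i := x_{i-M}) in F, for any decomposition t. *)
Definition Delta (F : series int) : series (int + int)%type :=
  xget 0 [set H | exists t, [/\ is_tensor t, F = \sum_(fr <- t) fr.1 * fr.2 &
                                H = \sum_(fr <- t) coprodL fr.1 * tens 1 fr.2]].

(* Main.v *)
Require Import Defs.
From HB Require Import structures.
From mathcomp Require Import all_boot all_order all_algebra.
From mathcomp Require Import finmap multiset.
From mathcomp Require Import all_classical zify.

Set Implicit Arguments.
Unset Strict Implicit.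
Unset Printing Implicit Defensive.

Import Order.TTheory GRing.Theory Num.Theory.
Local Open Scope classical_set_scope.
Local Open Scope ring_scope.

(** Rescaling T_w by (-1)^(len w) turns the 0-Hecke algebra into the monoid algebra of
the Hecke product. In its completion the series G_u, the back stable and the ordinary
Grothendieck polynomials are, up to this sign, the coefficients of products of factors
h_a(x) = 1 - x T_a (Fomin and Kirillov). For i in Z let A_i(x) be the product of the
h_a(x) over a >= i in decreasing order, and C(x) the one over all a. The Yang-Baxter
equation shows that C(x) and C(y) commute and that the coefficients of A_1(x_1) A_2(x_2) ...
satisfy the recursion of the operators tpi. The back stable polynomials are the coefficients
of the product of all A_i(x_i), the series G_u those of F = ... C(x_(-1)) C(x_0). Writing
A_i = C D_i^-1 for i <= 0 and moving the D_i^-1, which commute with A_j for j > i, to the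
right gives the second formula; by commutativity of the C(x), the coproduct of F is
F(y) F(x), and this gives the first one. *)

(** * Length and descents *)

(** The sign (-1)^(len u + len v - len w) splits into one factor for each of u, v and w, so both
    formulas become identities between products in the completed algebra: B = F N for the second,
    and F(y) F(x) N(x) = F(y) B(x) for the first. The second comes first because it also writes the
    back stable polynomial explicitly as an element of hatLambda (x) R, the form in which Delta can
    be evaluated. Two obstacles shape the rest. The noncommutative products are infinite; each
    identity is therefore proved exactly for finite truncations and carried to the limit coefficient
    by coefficient. This works because letters never cancel in a Hecke product: the coefficient of a
    monomial m at w involves only factors 1 - x_i T_a with a a letter of w and x_i dividing m. And
    Delta depends a priori on a decomposition. Moving the variables y_i to x_(i-M) with M large, out
    of reach of the R factors, shows that it does not, since the hatLambda factors are symmetric.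
    The inverses D_i^-1 exist because T_a is idempotent, whence h_a(x) h_a(ominus x) = 1; this is
    how ominus enters the polynomials indexed by S_-. *)

Lemma SZmulE (u v : SZ) i : (u * v)%g i = u (v i). Proof. by []. Qed.

Lemma SZ1E i : (1%g : SZ) i = i. Proof. by []. Qed.

Lemma SZ_inj (w : SZ) : injective w. Proof. exact: bij_inj (SZ_bij w). Qed.

Lemma SZVK (w : SZ) : cancel w (w^-1)%g. Proof. exact: SZ_funK. Qed.

Lemma SZKV (w : SZ) : cancel (w^-1)%g w. Proof. exact: SZ_inv_funK. Qed.

Lemma ss (a : int) : (s a * s a = 1)%g.
Proof. by apply: SZP => i; rewrite SZmulE /= sfunK. Qed.

Lemma sV (a : int) : ((s a)^-1 = s a)%g.
Proof. by apply: (mulgI (s a)); rewrite mulgV ss. Qed.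

Lemma SZ_bound (w : SZ) : exists N : nat, forall i, (N < `|i|)%N -> w i = i.
Proof.
have /finite_fsetP[A EA] := SZ_fin w.
exists (\max_(i <- A) `|i|%N) => i hi.
apply: contrapT => wi; have iA : i \in A by have : [set` A] i by rewrite -EA.
move: hi; rewrite ltnNge => /negP; apply.
by rewrite (big_rem i iA) /= leq_maxl.
Qed.

Lemma SZ_bound_stable (w : SZ) (N : nat) : (forall i, (N < `|i|)%N -> w i = i) ->
  forall i, (`|i| <= N)%N -> (`|w i| <= N)%N.
Proof.
move=> wN i iN; rewrite leqNgt; apply/negP => h.
by have /SZ_inj wii := wN _ h; lia.
Qed.

Definition invs (w : SZ) : set (int * int) :=
  [set p | p.1 < p.2 /\ w p.2 < w p.1].

Definition zint (a : int) (k : nat) : seq int := [seq a + j%:Z | j <- iota 0 k].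

Lemma mem_zint a k i : (i \in zint a k) = (a <= i < a + k%:Z).
Proof.
apply/mapP/idP => [[j]|ai]; first by rewrite mem_iota => ? ->; lia.
by exists (absz (i - a)); rewrite ?mem_iota; lia.
Qed.

Lemma zint_finite (a b : int) : finite_set [set i : int | a <= i <= b].
Proof.
apply: (sub_finite_set _ (finite_seq (zint a (absz (b - a + 1))))) => i /= ab.
by rewrite mem_zint; lia.
Qed.

Lemma invs_bound (w : SZ) (N : nat) : (forall i, (N < `|i|)%N -> w i = i) ->
  forall p, invs w p -> (`|p.1| <= N)%N /\ (`|p.2| <= N)%N.
Proof.
move=> wN [i j] [/= ij wij]; have wS := SZ_bound_stable wN.
have := wN i; have := wN j; have := wS i; have := wS j.
by move=> h1 h2 h3 h4; lia.
Qed.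

Lemma invs_finite w : finite_set (invs w).
Proof.
have [N wN] := SZ_bound w.
apply: (sub_finite_set _
  (finite_setX (zint_finite (- N%:Z) N%:Z) (zint_finite (- N%:Z) N%:Z))).
by move=> p /(invs_bound wN) /=; lia.
Qed.

Definition ninv (w : SZ) : nat := #|` fset_set (invs w) |.

Lemma sfun_ltE (a i j : int) : i != j -> ~~ ((i == a) && (j == a + 1)) ->
  ~~ ((j == a) && (i == a + 1)) -> (sfun a i < sfun a j) = (i < j).
Proof. by rewrite /sfun; repeat (case: eqP => ?); lia. Qed.

(** The map [sfun a] preserves the order of every pair except {a, a + 1}, so this pair alone can be
    gained. *)
Lemma invs_mulr (w : SZ) (a : int) : w a < w (a + 1) ->
  invs (w * s a)%g = (a, a + 1) |` [set (sfun a p.1, sfun a p.2) | p in invs w].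
Proof.
move=> wa; apply/seteqP; split => [[i j]|[i j]].
  rewrite /invs /= => -[ij wij].
  have [/andP[/eqP-> /eqP->]|n1] := boolP ((i == a) && (j == a + 1)); first by left.
  right; exists (sfun a i, sfun a j); last by rewrite /= !sfunK.
  by rewrite /= sfun_ltE //; lia.
rewrite /invs /= => -[[-> ->]|[[k l] /= [kl wkl] [<- <-]]].
  by rewrite /sfun !eqxx (_ : (a + 1 == a) = false); lia.
rewrite !sfunK sfun_ltE //; try by lia.
by apply/negP => /andP[/eqP ka /eqP la]; subst k l; lia.
Qed.

Lemma ninv_mulr (w : SZ) a : w a < w (a + 1) -> ninv (w * s a)%g = (ninv w).+1.
Proof.
move=> wa; rewrite /ninv invs_mulr //.
have fi := invs_finite w.
rewrite fset_setU1; last exact: finite_image.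
rewrite cardfsU1 fset_set_image //.
rewrite (_ : (_, _) \in _ = false) /=; last first.
  apply/negbTE/imfsetP => -[[i j]] /=.
  rewrite in_fset_set // inE /invs /= => -[ij wij] [].
  by move: ij wij; rewrite /sfun; repeat (case: eqP => [->|?]); lia.
rewrite card_imfset ?add1n //=.
by move=> [i j] [k l] [/(can_inj (sfunK a)) -> /(can_inj (sfunK a)) ->].
Qed.

Lemma s_neq (w : SZ) a : w a != w (a + 1).
Proof. by apply/eqP => /SZ_inj; lia. Qed.

Lemma ninv_mulr_desc (w : SZ) (a : int) : w (a + 1) < w a -> ninv w = (ninv (w * s a)%g).+1.
Proof.
move=> wa; have : (w * s a)%g a < (w * s a)%g (a + 1).
  by rewrite !SZmulE /= /sfun !eqxx (_ : (a + 1 == a) = false); lia.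
by move/ninv_mulr; rewrite -mulgA ss mulg1.
Qed.

(** [w] is the identity far out on both sides. Being increasing, it stays on or above the diagonal
    when followed from the far left, and on or below it when followed from the far right. *)
Lemma no_descent_id (w : SZ) : (forall a, w a < w (a + 1)) -> w = 1%g.
Proof.
move=> wa; have [N wN] := SZ_bound w; apply: SZP => i; rewrite SZ1E.
have up (k : nat) : - N%:Z - 1 + k%:Z <= w (- N%:Z - 1 + k%:Z).
  elim: k => [|k IH]; first by rewrite wN; lia.
  rewrite (_ : - N%:Z - 1 + k.+1%:Z = - N%:Z - 1 + k%:Z + 1); last by lia.
  move: IH (wa (- N%:Z - 1 + k%:Z)); set x := - N%:Z - 1 + k%:Z.
  by move: (w x) (w (x + 1)) => p q; lia.
have dn (k : nat) : w (N%:Z + 1 - k%:Z) <= N%:Z + 1 - k%:Z.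
  elim: k => [|k IH]; first by rewrite wN; lia.
  have := wa (N%:Z + 1 - k.+1%:Z).
  rewrite (_ : N%:Z + 1 - k.+1%:Z + 1 = N%:Z + 1 - k%:Z); last by lia.
  move: IH; set x := N%:Z + 1 - k%:Z; set y := N%:Z + 1 - _.
  by move: (w x) (w y) => p q; lia.
have [/wN//|iN] := ltnP N `|i|.
have := up (absz (i + N%:Z + 1)%R); have := dn (absz (N%:Z + 1 - i)%R).
rewrite (_ : - N%:Z - 1 + (absz (i + N%:Z + 1)%R)%:Z = i); last by lia.
by rewrite (_ : N%:Z + 1 - (absz (N%:Z + 1 - i)%R)%:Z = i); lia.
Qed.

(* The letters occurring in the reduced words of [w]. *)
Definition letter (w : SZ) (a : int) : Prop := exists2 i : int, i <= a & a < w i.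

(* An injection of the finite set [-N, a] into itself is onto. *)
Lemma SZ_stable (w : SZ) (a : int) : (forall i : int, i <= a -> w i <= a) ->
  forall i, w i <= a -> i <= a.
Proof.
move=> wa i wia; have [N wN] := SZ_bound w.
have wS := SZ_bound_stable wN.
rewrite leNgt; apply/negP => ai.
pose A := [fset j in zint (- N%:Z)%R (absz (a + N%:Z + 1)%R)]%fset.
have [aN|aN] := ltP a (- N%:Z).
  have : (`|i| <= N)%N by rewrite leqNgt; apply/negP => /wN; lia.
  by move/wS; lia.
have wA : (w @` A `<=` A)%fset.
  apply/fsubsetP => _ /imfsetP[j /= + ->]; rewrite !in_fset /= !mem_zint => jA.
  by have := wa j; have := wS j; have := wN j; lia.
have cA : #|` (w @` A)%fset| = #|` A| by rewrite card_imfset //; exact: SZ_inj.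
have EA : (w @` A)%fset = A by apply/eqP; rewrite eqEfcard wA cA /=.
have iN : (`|i| <= N)%N by rewrite leqNgt; apply/negP => /wN; lia.
have : w i \in (w @` A)%fset by rewrite EA in_fset /= mem_zint; have := wS i; lia.
by case/imfsetP => j /= + /SZ_inj ij; rewrite in_fset /= mem_zint; lia.
Qed.

Lemma letterN (w : SZ) (a : int) : ~ letter w a -> forall i, (w i <= a) = (i <= a).
Proof.
move=> na i; have wa j : j <= a -> w j <= a.
  by move=> ja; rewrite leNgt; apply/negP => aw; apply: na; exists j.
by apply/idP/idP; [exact: SZ_stable|exact: wa].
Qed.

Lemma letter_cross (w : SZ) (a i : int) : a < i -> w i <= a -> letter w a.
Proof.
move=> ai wi; apply: contrapT => /letterN/(_ i); lia.
Qed.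

Lemma letter_desc (w : SZ) a : w (a + 1) < w a -> letter w a.
Proof.
move=> wa; apply: contrapT => /letterN wl.
have := wl a; have := wl (a + 1); lia.
Qed.

Lemma sfun_le (a b i : int) : a != b -> (sfun a i <= b) = (i <= b).
Proof. by rewrite /sfun; repeat (case: eqP => ?); lia. Qed.

Lemma letter_mulr (w : SZ) a b : a != b -> letter (w * s a)%g b <-> letter w b.
Proof.
move=> ab; split => -[i ib wi].
  by exists (sfun a i) => //; rewrite sfun_le.
by exists (sfun a i); rewrite ?sfun_le // SZmulE /= sfunK.
Qed.

Lemma wprod_cons a b : wprod (a :: b) = (s a * wprod b)%g.
Proof. by rewrite /wprod big_cons. Qed.

Lemma wprod_cat a b : wprod (a ++ b) = (wprod a * wprod b)%g.
Proof. by rewrite /wprod big_cat. Qed.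

Lemma wprod_rcons a b : wprod (rcons b a) = (wprod b * s a)%g.
Proof. by rewrite /wprod -cats1 big_cat big_seq1. Qed.

Lemma ninv1 : ninv 1%g = 0%N.
Proof.
apply/eqP; rewrite cardfs_eq0 /=.
by rewrite (_ : invs _ = set0) ?fset_set0 // -subset0 => p [/=]; lia.
Qed.

Lemma ninv_wprod b : (ninv (wprod b) <= size b)%N.
Proof.
elim/last_ind: b => [|b a IH]; first by rewrite /wprod big_nil ninv1.
rewrite wprod_rcons size_rcons.
have := s_neq (wprod b) a; rewrite neq_lt => /orP[/ninv_mulr->//|/ninv_mulr_desc].
by lia.
Qed.

(** Each right descent that is peeled off lowers [ninv] by one and is itself a [letter]; the process
    stops at the identity by [no_descent_id]. With [ninv_wprod] this identifies length and number of
    inversions. *)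
Lemma reduced_word_exists (w : SZ) :
  exists b, [/\ wprod b = w, size b = ninv w & {in b, forall a, letter w a}].
Proof.
elim: {w}(ninv w) {-2}w (erefl (ninv w)) => [|n IH] w wn.
all: have [/no_descent_id w1|] := pselect (forall a, w a < w (a + 1)).
- by exists [::]; rewrite w1 ninv1 /wprod big_nil.
- move=> /existsNP[a]; have := s_neq w a; rewrite neq_lt => /orP[//|wa] _.
  by have := ninv_mulr_desc wa; lia.
- by move: wn; rewrite w1 ninv1.
move=> /existsNP[a]; have := s_neq w a; rewrite neq_lt => /orP[//|wa] _.
have wn' : ninv (w * s a)%g = n by have := ninv_mulr_desc wa; lia.
have [b [bw bs bl]] := IH _ wn'.
exists (rcons b a); rewrite wprod_rcons bw -mulgA ss mulg1 size_rcons bs wn' wn.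
split => // c; rewrite mem_rcons inE; have [-> _|ca /=] := eqVneq c a.
  exact: letter_desc.
by move/bl/letter_mulr; apply; rewrite eq_sym.
Qed.

Lemma reduced_wordP (w : SZ) : is_reduced_word w (reduced_word w).
Proof.
apply: xgetPex; have [b [bw bs _]] := reduced_word_exists w.
by exists b; split => // c cw; rewrite bs -cw ninv_wprod.
Qed.

Lemma lenE w : len w = ninv w.
Proof.
have [rw rmin] := reduced_wordP w; apply/eqP; rewrite eqn_leq.
have [b [bw bs _]] := reduced_word_exists w.
by rewrite -{1}bs rmin //= -{1}rw ninv_wprod.
Qed.

Lemma len_mulr (w : SZ) a : len (w * s a)%g =
  if w a < w (a + 1) then (len w).+1 else (len w).-1.
Proof.
rewrite !lenE; have := s_neq w a; rewrite neq_lt => /orP[wa|wa].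
  by rewrite wa ninv_mulr.
by rewrite lt_gtF // (ninv_mulr_desc wa).
Qed.

Lemma len_mulr_lt (w : SZ) a : (len w < len (w * s a)%g)%N = (w a < w (a + 1)).
Proof. by rewrite len_mulr; case: ifP; lia. Qed.

Lemma wprod_rev b : wprod (rev b) = ((wprod b)^-1)%g.
Proof.
elim: b => [|a b IH]; first by rewrite /wprod !big_nil invg1.
by rewrite rev_cons wprod_rcons wprod_cons invgM sV IH.
Qed.

Lemma len_inv w : len (w^-1)%g = len w.
Proof.
have le u : (len (u^-1)%g <= len u)%N.
  have [rw _] := reduced_wordP u; rewrite -{1}rw -wprod_rev.
  by rewrite lenE (leq_trans (ninv_wprod _)) // size_rev.
by apply/eqP; rewrite eqn_leq le -{1}(invgK w) le.
Qed.

Lemma len_mull_lt (w : SZ) a :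
  (len w < len (s a * w)%g)%N = ((w^-1)%g a < (w^-1)%g (a + 1)).
Proof. by rewrite -len_inv -[len (_ * _)%g]len_inv invgM sV len_mulr_lt. Qed.

Lemma letter_mull (w : SZ) a b : a != b -> letter (s a * w)%g b <-> letter w b.
Proof.
move=> ab; have E i : (b < (s a * w)%g i) = (b < w i).
  by rewrite !ltNge SZmulE /= sfun_le.
by split => -[i ib wi]; exists i => //; rewrite ?E // -E.
Qed.

(** * The Hecke product *)

Definition hecke_r (w : SZ) (a : int) : SZ :=
  if w a < w (a + 1) then (w * s a)%g else w.

Definition hword (a : seq int) : SZ := foldr hecke_s 1%g a.

Lemma hecke_sE (a : int) (w : SZ) : hecke_s a w =
  if (w^-1)%g a < (w^-1)%g (a + 1) then (s a * w)%g else w.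
Proof. by rewrite /hecke_s len_mull_lt. Qed.

Lemma sfun_mv (a : int) : (sfun a a = a + 1) * (sfun a (a + 1) = a).
Proof. by rewrite /sfun !eqxx; case: eqP => // ?; lia. Qed.

(** Associativity of the Hecke product rests on this commutation of the left and right actions.
    Either s_a w = w s_b, and then both actions raise w or both fix it; or multiplication on one
    side does not change whether the generator on the other side is an ascent. *)
Lemma hecke_sr (a : int) (w : SZ) (b : int) :
  hecke_s a (hecke_r w b) = hecke_r (hecke_s a w) b.
Proof.
have [E|E] := pselect ((s a * w)%g = (w * s b)%g).
  (* Here [w] maps {b, b + 1} onto {a, a + 1}, and the order in which it does so decides both ascent
     conditions. *)
  have c1 : (w b == a) && (w (b + 1) == a + 1) || (w b == a + 1) && (w (b + 1) == a).
    have := congr1 (fun u : SZ => u b) E; have := congr1 (fun u : SZ => u (b + 1)) E.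
    have := s_neq w b.
    by rewrite !SZmulE /= !sfun_mv /sfun; repeat (case: eqP => ?); lia.
  case/orP: c1 => /andP[/eqP h1 /eqP h2].
    have i1 : (w^-1)%g a = b by rewrite -h1 SZVK.
    have i2 : (w^-1)%g (a + 1) = b + 1 by rewrite -h2 SZVK.
    rewrite {1}/hecke_r h1 h2 (_ : a < a + 1 = true); last by lia.
    rewrite [in RHS]hecke_sE i1 i2 (_ : b < b + 1 = true); last by lia.
    rewrite E /hecke_r -{2 3}E !SZmulE h1 h2 /= !sfun_mv.
    rewrite (_ : a + 1 < a = false); last by lia.
    rewrite hecke_sE invgM sV !SZmulE i1 i2 /= !sfun_mv.
    by rewrite (_ : b + 1 < b = false); last by lia.
  have i1 : (w^-1)%g (a + 1) = b by rewrite -h1 SZVK.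
  have i2 : (w^-1)%g a = b + 1 by rewrite -h2 SZVK.
  have hl : hecke_s a w = w by rewrite hecke_sE i1 i2 ifF //; lia.
  have hr : hecke_r w b = w by rewrite /hecke_r h1 h2 ifF //; lia.
  by rewrite hr hl hr.
have n1 : ~~ (((w b == a) && (w (b + 1) == a + 1)) || ((w (b + 1) == a) && (w b == a + 1))).
  apply/negP => h; apply: E; apply: SZP => i; rewrite !SZmulE /=.
  have [->|ib] := eqVneq i b; first by rewrite sfun_mv /sfun; move: h; repeat (case: eqP => ?); lia.
  have [->|ib1] := eqVneq i (b + 1); first by rewrite sfun_mv /sfun; move: h; repeat (case: eqP => ?); lia.
  have e1 : w i <> w b by move/SZ_inj/eqP; rewrite (negbTE ib).
  have e2 : w i <> w (b + 1) by move/SZ_inj/eqP; rewrite (negbTE ib1).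
  rewrite [in RHS]/sfun (negbTE ib) (negbTE ib1) /sfun.
  by move: h; repeat (case: eqP => ?); lia.
have n2 : ~~ (((w^-1)%g a == b) && ((w^-1)%g (a + 1) == b + 1)) &&
          ~~ (((w^-1)%g (a + 1) == b) && ((w^-1)%g a == b + 1)).
  rewrite -negb_or; apply: contra n1.
  by case/orP => /andP[/eqP <- /eqP <-]; rewrite !SZKV !eqxx ?orbT.
have L : (((w * s b)^-1)%g a < ((w * s b)^-1)%g (a + 1)) = ((w^-1)%g a < (w^-1)%g (a + 1)).
  rewrite invgM sV !SZmulE /=; case/andP: n2 => n2 n2'.
  by rewrite sfun_ltE //; exact: (s_neq (w^-1)%g).
have R : ((s a * w)%g b < (s a * w)%g (b + 1)) = (w b < w (b + 1)).
  rewrite !SZmulE /=; move: n1; rewrite negb_or => /andP[n1 n1'].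
  by rewrite sfun_ltE //; exact: s_neq.
rewrite /hecke_r !hecke_sE.
case rw : (w b < w (b + 1)); rewrite ?L.
  by case lw : ((w^-1)%g a < _); rewrite ?R rw ?mulgA.
by case lw : ((w^-1)%g a < _); rewrite ?R rw.
Qed.

Lemma foldr_hecke_r a w b : foldr hecke_s (hecke_r w b) a = hecke_r (foldr hecke_s w a) b.
Proof. by elim: a => //= c a ->; rewrite hecke_sr. Qed.

Lemma foldr_foldl a w b :
  foldr hecke_s (foldl hecke_r w b) a = foldl hecke_r (foldr hecke_s w a) b.
Proof. by elim: b w => //= c b IH w; rewrite IH foldr_hecke_r. Qed.

Lemma hecke_reduced_l b : size b = len (wprod b) -> hword b = wprod b.
Proof.
elim: b => [|a b IH]; first by rewrite /wprod big_nil.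
rewrite wprod_cons /= => bs.
have le1 : (len (wprod b) <= size b)%N by rewrite lenE ninv_wprod.
have le2 : (len (s a * wprod b)%g <= (len (wprod b)).+1)%N.
  by rewrite -len_inv invgM sV len_mulr len_inv; case: ifP; lia.
have eb : size b = len (wprod b) by lia.
by rewrite IH // /hecke_s ifT //; lia.
Qed.

Lemma hecke_reduced_r b : size b = len (wprod b) -> foldl hecke_r 1%g b = wprod b.
Proof.
elim/last_ind: b => [|b a IH]; first by rewrite /wprod big_nil.
rewrite wprod_rcons size_rcons foldl_rcons => bs.
have le1 : (len (wprod b) <= size b)%N by rewrite lenE ninv_wprod.
have := len_mulr (wprod b) a; case: ifP => [h _|_]; last by lia.
have eb : size b = len (wprod b) by move: bs; rewrite len_mulr h; lia.
by rewrite IH // /hecke_r h.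
Qed.

Lemma reduced_size w : size (reduced_word w) = len (wprod (reduced_word w)).
Proof. by have [-> _] := reduced_wordP w. Qed.

Lemma hword_reduced w : hword (reduced_word w) = w.
Proof. by rewrite hecke_reduced_l ?reduced_size //; case: (reduced_wordP w). Qed.

Lemma foldl_reduced w : foldl hecke_r 1%g (reduced_word w) = w.
Proof. by rewrite hecke_reduced_r ?reduced_size //; case: (reduced_wordP w). Qed.

(* [v] is a right Hecke word, so the left action of a word [a] on [v] only
   depends on the element [hword a]. *)
Lemma hecke_word a v : foldr hecke_s v a = hecke (hword a) v.
Proof.
rewrite /hecke -{1 2}(foldl_reduced v) !foldr_foldl.
by rewrite -/(hword _) -/(hword _) hword_reduced.
Qed.

Lemma hecke_r_word u b : foldl hecke_r u b = hecke u (foldl hecke_r 1%g b).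
Proof. by rewrite /hecke foldr_foldl -/(hword _) hword_reduced. Qed.

Lemma hword1 a : hword [:: a] = s a.
Proof. by rewrite /= hecke_sE invg1 !SZ1E mulg1 ifT //; lia. Qed.

Lemma heckes a v : hecke (s a) v = hecke_s a v.
Proof. by rewrite -hword1 -hecke_word. Qed.

Lemma hecke_rs v a : hecke v (s a) = hecke_r v a.
Proof.
have -> : s a = foldl hecke_r 1%g [:: a] by rewrite /= /hecke_r !SZ1E mul1g ifT //; lia.
by rewrite -hecke_r_word.
Qed.

Lemma hecke1 : left_id 1%g hecke.
Proof. by move=> v; rewrite -(hecke_word [::]). Qed.

Lemma hecker1 : right_id 1%g hecke.
Proof. by move=> v; rewrite -(hecke_r_word v [::]). Qed.

Lemma hword_cat a b : hword (a ++ b) = hecke (hword a) (hword b).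
Proof. by rewrite -hecke_word /hword foldr_cat. Qed.

Lemma heckeA : associative hecke.
Proof.
move=> u v w; rewrite -[in RHS](hword_reduced u) -[in RHS](hword_reduced v).
by rewrite -hword_cat -hecke_word foldr_cat !hecke_word !hword_reduced.
Qed.

Lemma foldr_heckeE a : foldr hecke 1%g (map s a) = hword a.
Proof. by elim: a => //= b a ->; rewrite heckes. Qed.

(** * Length and letters of Hecke products *)

Lemma len_hecke_s a v : (len v <= len (hecke_s a v))%N.
Proof. by rewrite /hecke_s; case: ifP => //; lia. Qed.

Lemma len_hecke_r v a : (len v <= len (hecke_r v a))%N.
Proof. by rewrite /hecke_r -len_mulr_lt; case: ifP => //; lia. Qed.

Lemma len_hecke_ger u v : (len v <= len (hecke u v))%N.
Proof.
by rewrite /hecke; elim: (reduced_word u) => //= a b /leq_trans; apply; exact: len_hecke_s.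
Qed.

Lemma len_hecke_gel u v : (len u <= len (hecke u v))%N.
Proof.
rewrite -(foldl_reduced v) -hecke_r_word.
elim/last_ind: (reduced_word v) => //= b a IH.
by rewrite foldl_rcons (leq_trans IH) // len_hecke_r.
Qed.

Lemma len_hword a : (len (hword a) <= size a)%N.
Proof.
elim: a => [|a b IH] /=; first by rewrite lenE ninv1.
rewrite /hecke_s; case: ifP => _; last by lia.
by rewrite -len_inv invgM sV len_mulr len_inv; case: ifP; lia.
Qed.

Lemma len_hecke u v : (len (hecke u v) <= len u + len v)%N.
Proof.
rewrite -{1}(hword_reduced u) -{1}(hword_reduced v) -hword_cat.
by rewrite (leq_trans (len_hword _)) // size_cat.
Qed.

(** Unlike in the group, letters never cancel. If s_b is not a left ascent, then w^-1(b + 1) <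
    w^-1(b), so b + 1 stands at a position at most b, or b stands at a position beyond b; in both
    cases b is already a letter of w. *)
Lemma letter_hecke_s (a : int) w b : letter (hecke_s a w) b <-> b = a \/ letter w b.
Proof.
have [<-|ab] := eqVneq b a; last first.
  rewrite /hecke_s; case: ifP => _; rewrite ?letter_mull 1?eq_sym //.
    by split; [right|case => // ?; subst b; rewrite eqxx in ab].
  by split; [right|case => // ?; subst b; rewrite eqxx in ab].
split; [by left|move=> _]; rewrite hecke_sE; case: ifP => [h|/negbT h].
  have [hb|hb] := leP ((w^-1)%g b) b.
    by exists ((w^-1)%g b) => //; rewrite SZmulE SZKV /= sfun_mv; lia.
  have [i ib wi] : letter w b by apply: (letter_cross hb); rewrite SZKV.
  exists i => //; rewrite SZmulE /= /sfun; case: eqP => [|_]; first by lia.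
  by case: eqP => // wb; move: h hb ib; rewrite -wb SZVK; lia.
have := s_neq (w^-1)%g b; rewrite neq_lt (negbTE h) /= => {}h.
have [hb|hb] := leP ((w^-1)%g (b + 1)) b.
  by exists ((w^-1)%g (b + 1)) => //; rewrite SZKV; lia.
by apply: (@letter_cross _ _ ((w^-1)%g b)); rewrite ?SZKV //; exact: lt_trans hb h.
Qed.

Lemma letter1 a : ~ letter 1%g a.
Proof. by case => i; rewrite SZ1E; lia. Qed.

Lemma letter_hword a b : letter (hword a) b <-> b \in a.
Proof.
elim: a => [|c a IH] /=; first by split => // /letter1.
rewrite letter_hecke_s inE IH; split => [[->|->]|/orP[/eqP|]]; rewrite ?eqxx ?orbT //.
  by left.
by right.
Qed.

Lemma letter_hecke u v b : letter (hecke u v) b <-> letter u b \/ letter v b.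
Proof.
rewrite -{1}(hword_reduced u) -{1}(hword_reduced v) -hword_cat letter_hword mem_cat.
rewrite -{2}(hword_reduced u) -{2}(hword_reduced v) !letter_hword.
by split => [/orP|] // /orP.
Qed.

Lemma letter_reduced w b : letter w b <-> b \in reduced_word w.
Proof. by rewrite -{1}(hword_reduced w) letter_hword. Qed.

Lemma letter_bound (w : SZ) (N : nat) : (forall i, (N < `|i|)%N -> w i = i) ->
  forall a, letter w a -> - N%:Z <= a <= N%:Z.
Proof.
move=> wN a [i ia ai]; have wS := SZ_bound_stable wN.
by have := wN i; have := wS i; lia.
Qed.

Lemma finite_words (r : seq int) n :
  finite_set [set b : seq int | (size b <= n)%N /\ {subset b <= r}].
Proof.
elim: n => [|n IH].
  by apply: (sub_finite_set _ (finite_set1 [::])) => -[|? ?] [].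
apply: (sub_finite_set _ (_ : finite_set ([set [::]] `|`
   (fun p : int * seq int => p.1 :: p.2) @`
     ([set` r] `*` [set b : seq int | (size b <= n)%N /\ {subset b <= r}])))).
  move=> [|a b] [/= sb br]; first by left.
  right; exists (a, b) => //=; split => /=; first by rewrite br ?inE ?eqxx.
  by split => // c cb; rewrite br // inE cb orbT.
rewrite finite_setU; split; first exact: finite_set1.
by apply: finite_image; apply: finite_setX => //; exact: finite_seq.
Qed.

Lemma finite_bounded (r : seq int) n :
  finite_set [set u : SZ | (len u <= n)%N /\ forall a, letter u a -> a \in r].
Proof.
apply: (sub_finite_set _ (finite_image wprod (finite_words r n))) => u [un ur].
exists (reduced_word u); last by case: (reduced_wordP u).
by split => // a /letter_reduced /ur.
Qed.

Definition hdec (w : SZ) : set (SZ * SZ) := [set p | hecke p.1 p.2 = w].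

(** Both factors have length at most [len w] and letters among those of [w], hence are given by
    bounded words in a finite alphabet. *)
Lemma hdec_finite w : finite_set (hdec w).
Proof.
pose B := [set u : SZ | (len u <= len w)%N /\ forall a, letter u a -> a \in reduced_word w].
have fB : finite_set B := finite_bounded _ _.
apply: (sub_finite_set _ (finite_setX fB fB)) => -[u v] /= h.
split; split => /= [|a].
- by rewrite -h len_hecke_gel.
- by move=> la; apply/letter_reduced; rewrite -h letter_hecke; left.
- by rewrite -h len_hecke_ger.
- by move=> la; apply/letter_reduced; rewrite -h letter_hecke; right.
Qed.

(** * Relations between the generators, and relabelling of generators *)

Lemma ss_hecke (a : int) : hecke (s a) (s a) = s a.
Proof. by rewrite heckes hecke_sE sV /= !sfun_mv ifF //; lia. Qed.

Lemma sfunP (a i : int) : [\/ i = a /\ sfun a i = a + 1, i = a + 1 /\ sfun a i = a |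
  [/\ i <> a, i <> a + 1 & sfun a i = i]].
Proof.
rewrite /sfun; case: eqP => [->|ia]; first by constructor 1.
by case: eqP => [->|ia1]; [constructor 2|constructor 3].
Qed.

Lemma sfun_id (a i : int) : i != a -> i != a + 1 -> sfun a i = i.
Proof. by rewrite /sfun => /negbTE-> /negbTE->. Qed.

Lemma s_comm (a b : int) : (a + 1 < b) || (b + 1 < a) -> (s a * s b = s b * s a)%g.
Proof.
move=> ab; apply: SZP => i; rewrite !SZmulE /=.
by case: (sfunP a i) (sfunP b i) (sfunP a (sfun b i)) (sfunP b (sfun a i)) =>
  [[h1 h2]|[h1 h2]|[h1 h2 h3]] [[k1 k2]|[k1 k2]|[k1 k2 k3]]
  [[l1 l2]|[l1 l2]|[l1 l2 l3]] [[m1 m2]|[m1 m2]|[m1 m2 m3]]; lia.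
Qed.

Lemma hecke_comm (a b : int) : (a + 1 < b) || (b + 1 < a) ->
  hecke (s a) (s b) = hecke (s b) (s a).
Proof.
move=> ab; rewrite !heckes !hecke_sE !sV /= /sfun (s_comm ab).
by repeat (case: eqP => ?; try lia); rewrite !ifT //; lia.
Qed.

Lemma hecke_braid (a : int) :
  hecke (s a) (hecke (s (a + 1)) (s a)) = hecke (s (a + 1)) (hecke (s a) (s (a + 1))).
Proof.
have B1 : sfun (a + 1) a = a by rewrite sfun_id //; lia.
have B2 : sfun a (a + 1 + 1) = a + 1 + 1 by rewrite sfun_id //; lia.
have E : (s a * (s (a + 1) * s a) = s (a + 1) * (s a * s (a + 1)))%g.
  apply: SZP => i; rewrite !SZmulE /=.
  have [->|h1] := eqVneq i a; first by rewrite !(sfun_mv, B1, B2).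
  have [->|h2] := eqVneq i (a + 1); first by rewrite !(sfun_mv, B1, B2).
  have [->|h3] := eqVneq i (a + 1 + 1); first by rewrite !(sfun_mv, B1, B2).
  by rewrite !sfun_id.
have l1 : hecke_s (a + 1) (s a) = (s (a + 1) * s a)%g.
  by rewrite hecke_sE sV /= !(sfun_mv, B1, B2) ifT //; lia.
have l2 : hecke_s a (s (a + 1)) = (s a * s (a + 1))%g.
  by rewrite hecke_sE sV /= !(sfun_mv, B1, B2) ifT //; lia.
rewrite !heckes l1 l2 !hecke_sE !invgM !sV !SZmulE /= !(sfun_mv, B1, B2).
by rewrite ifT ?ifT //; lia.
Qed.

Lemma len_wprod_map (f : int -> int) (theta : SZ -> SZ) :
  {morph theta : u v / (u * v)%g} -> (forall a, theta (s a) = s (f a)) ->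
  forall b, theta (wprod b) = wprod (map f b).
Proof.
move=> tM ts; have t1 : theta 1%g = 1%g by apply: (mulgI (theta 1%g)); rewrite -tM !mulg1.
by elim=> [|a b IH]; rewrite ?wprod_cons /= ?wprod_cons ?tM ?ts ?IH // /wprod !big_nil.
Qed.

(** A morphism that sends generators to generators cannot increase length; this is applied to
    [theta] and to its left inverse. The instances are [omega] and [gamma]. *)
Lemma len_theta (f g : int -> int) (theta theta' : SZ -> SZ) :
  {morph theta : u v / (u * v)%g} -> (forall a, theta (s a) = s (f a)) ->
  {morph theta' : u v / (u * v)%g} -> (forall a, theta' (s a) = s (g a)) ->
  cancel theta theta' ->
  forall w, len (theta w) = len w.
Proof.
move=> tM ts tM' ts' tK w; apply/eqP; rewrite eqn_leq; apply/andP; split.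
  have [rw _] := reduced_wordP w; rewrite -{1}rw (len_wprod_map tM ts).
  by rewrite lenE (leq_trans (ninv_wprod _)) // size_map.
have [rw _] := reduced_wordP (theta w).
rewrite -{1}(tK w) -{1}rw (len_wprod_map tM' ts').
by rewrite lenE (leq_trans (ninv_wprod _)) // size_map.
Qed.

Lemma theta_hword (f : int -> int) (theta : SZ -> SZ) :
  {morph theta : u v / (u * v)%g} -> (forall a, theta (s a) = s (f a)) ->
  (forall w, len (theta w) = len w) ->
  forall b, theta (hword b) = hword (map f b).
Proof.
move=> tM ts tl; have t1 : theta 1%g = 1%g by apply: (mulgI (theta 1%g)); rewrite -tM !mulg1.
elim=> [|a b IH] //=; rewrite -IH /hecke_s -ts -tM !tl.
by case: ifP => _; rewrite ?tM.
Qed.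

(** * The completed monoid algebra of the Hecke monoid *)

(* Finiteness of [hdec w] makes the product of infinite combinations meaningful. *)
Definition halg (A : comNzRingType) : Type := SZ -> A.

HB.instance Definition _ (A : comNzRingType) := GRing.Zmodule.on (halg A).

Section HeckeAlgebra.
Variable A : comNzRingType.
Implicit Types (f g h : halg A) (w : SZ).

Definition hmul f g : halg A := fun w => \sum_(p \in hdec w) f p.1 * g p.2.

Definition hone : halg A := fun w => (w == 1%g)%:R.

Let D w : seq _ := fset_set (hdec w).

Let D_uniq w : uniq (D w). Proof. exact: fset_uniq. Qed.

Lemma mem_hdec w p : (p \in (fset_set (hdec w) : seq _)) = (hecke p.1 p.2 == w).
Proof.
rewrite in_fset_set; last exact: hdec_finite.
by apply/idP/eqP; rewrite inE.
Qed.

Lemma hmulE f g w : hmul f g w = \sum_(p <- fset_set (hdec w)) f p.1 * g p.2.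
Proof. by rewrite /hmul fsbig_finite//; exact: hdec_finite. Qed.

Lemma hmulA : associative hmul.
Proof.
move=> F G H; apply/funext => m; rewrite !hmulE -!/(D m).
pose f (t : SZ * (SZ * SZ)) := F t.1 * (G t.2.1 * H t.2.2).
transitivity (\sum_(t <- [seq (p.1, (q.1, q.2)) | p <- D m, q <- D p.2]) f t).
  rewrite big_allpairs_dep; apply: eq_bigr => p _.
  by rewrite hmulE mulr_sumr.
transitivity (\sum_(t <- [seq (q.1, (q.2, p.2)) | p <- D m, q <- D p.1]) f t); last first.
  rewrite big_allpairs_dep; apply: eq_bigr => p _.
  by rewrite hmulE mulr_suml; apply: eq_bigr => q _; rewrite /f mulrA.
apply: perm_big; apply: uniq_perm.
- apply: allpairs_uniq_dep => //.
  move=> x y /allpairsPdep[[a b] [[c d] [_ + ->]]].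
  rewrite mem_hdec /= => /eqP <- /allpairsPdep[[a' b'] [[c' d'] [_ + ->]]].
  by rewrite mem_hdec /= => /eqP <- [-> -> ->].
- apply: allpairs_uniq_dep => //.
  move=> x y /allpairsPdep[[a b] [[c d] [_ + ->]]].
  rewrite mem_hdec /= => /eqP <- /allpairsPdep[[a' b'] [[c' d'] [_ + ->]]].
  by rewrite mem_hdec /= => /eqP <- [-> -> ->].
move=> [a [b c]]; apply/allpairsPdep/allpairsPdep => /=.
  move=> [[p q] [[p' q'] []]]; rewrite !mem_hdec /= => /eqP<- /eqP<- [-> -> ->].
  by exists (hecke p p', q'), (p, p'); rewrite !mem_hdec /= heckeA !eqxx.
move=> [[p q] [[p' q'] []]]; rewrite !mem_hdec /= => /eqP<- /eqP<- [-> -> ->].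
by exists (p', hecke q' q), (q', q); rewrite !mem_hdec /= heckeA !eqxx.
Qed.

Definition hmon (c : A) (u : SZ) : halg A := fun w => (c *+ (u == w)).

Lemma hmul_single f g w p : hecke p.1 p.2 = w ->
  (forall a b, hecke a b = w -> (a, b) <> p -> f a * g b = 0) ->
  hmul f g w = f p.1 * g p.2.
Proof.
move=> pw fg0; rewrite hmulE (bigD1_seq p) ?mem_hdec ?pw ?fset_uniq //=.
rewrite big_seq_cond big1 ?addr0 // => -[a b] /andP[].
by rewrite mem_hdec /= => /eqP abw /eqP; exact: fg0.
Qed.

Lemma hone_mull : left_id hone hmul.
Proof.
move=> f; apply/funext => w; rewrite (hmul_single (p := (1%g, w))) /=.
- by rewrite /hone eqxx mul1r.
- exact: hecke1.
move=> a b <-; rewrite /hone; case: eqP => [->|_]; last by rewrite mul0r.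
by rewrite hecke1.
Qed.

Lemma hmul_scalr c f w : hmul f (hmon c 1%g) w = c * f w.
Proof.
rewrite (hmul_single (p := (w, 1%g))) /=.
- by rewrite /hmon eqxx mulrC.
- exact: hecker1.
move=> a b <-; rewrite /hmon; case: eqP => [<-|_]; last by rewrite mulr0.
by rewrite hecker1.
Qed.

Lemma hone_mulr : right_id hone hmul.
Proof.
move=> f; apply/funext => w; rewrite (_ : hone = hmon 1 1%g).
  by rewrite hmul_scalr mul1r.
by apply/funext => v; rewrite /hmon /hone eq_sym.
Qed.

Lemma hmulDl : left_distributive hmul +%R.
Proof.
move=> F G H; apply/funext => m.
rewrite -[RHS]/(hmul F H m + hmul G H m) !hmulE -big_split.
by apply: eq_bigr => p _; exact: mulrDl.
Qed.

Lemma hmulDr : right_distributive hmul +%R.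
Proof.
move=> F G H; apply/funext => m.
rewrite -[RHS]/(hmul F G m + hmul F H m) !hmulE -big_split.
by apply: eq_bigr => p _; exact: mulrDr.
Qed.

Lemma hone_neq0 : hone != 0.
Proof.
apply/eqP => /(congr1 (fun F : halg A => F 1%g)); rewrite /hone eqxx => /eqP.
by rewrite oner_eq0.
Qed.

HB.instance Definition _ := GRing.Zmodule_isNzRing.Build (halg A)
  hmulA hone_mull hone_mulr hmulDl hmulDr hone_neq0.

Lemma halgME f g w : (f * g) w = \sum_(p <- fset_set (hdec w)) f p.1 * g p.2.
Proof. exact: hmulE. Qed.

Lemma halgDE f g w : (f + g) w = f w + g w. Proof. by []. Qed.

Lemma halgNE f w : (- f) w = - f w. Proof. by []. Qed.

Lemma halg_sumE (I : Type) (r : seq I) (F : I -> halg A) w :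
  (\sum_(i <- r) F i) w = \sum_(i <- r) F i w.
Proof. by elim: r => [|i r IH]; rewrite ?big_nil // !big_cons halgDE IH. Qed.

Lemma halg1E : 1 = hmon 1 1%g.
Proof. by apply/funext => v; rewrite /hmon eq_sym. Qed.

Lemma hmonM c u d v : hmon c u * hmon d v = hmon (c * d) (hecke u v).
Proof.
apply/funext => w; rewrite {3}/hmon.
have [<-|ne] := eqVneq (hecke u v) w.
  rewrite [LHS](hmul_single (p := (u, v))) //= ?/hmon ?eqxx // => a b ab.
  by case: eqP => [<-|]; case: eqP => [<-|]; rewrite ?mul0r ?mulr0.
rewrite halgME big_seq big1 // => -[a b]; rewrite mem_hdec /= /hmon => /eqP abw.
by case: eqP => [ua|]; case: eqP => [vb|]; rewrite ?mul0r ?mulr0 //; move: ne; rewrite ua vb abw eqxx.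
Qed.

End HeckeAlgebra.

Arguments hmon {A} c u.

(** * The Yang-Baxter equation *)

Section YangBaxter.
Variable A : comNzRingType.
Implicit Types (x y : A) (a b : int).

(** With the rescaled basis, T_a is [hmon 1 (s a)], an idempotent. *)
Definition hh a x : halg A := 1 - hmon x (s a).

(** The multiplicative formal group law: 1 - qplus x y = (1 - x)(1 - y). By idempotence of T_a, x
    |-> h_a(x) turns it into multiplication ([hhM]). *)
Definition qplus x y := x + y - x * y.

Lemma hmonD x y (u : SZ) : hmon (x + y) u = hmon x u + hmon y u :> halg A.
Proof. by apply/funext => w; rewrite halgDE /hmon mulrnDl. Qed.

Lemma hmonN x (u : SZ) : hmon (- x) u = - hmon x u :> halg A.
Proof. by apply/funext => w; rewrite halgNE /hmon mulNrn. Qed.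

Lemma hmon0 (u : SZ) : hmon 0 u = 0 :> halg A.
Proof. by apply/funext => w; rewrite /hmon mul0rn. Qed.

Lemma hhM a x y : hh a x * hh a y = hh a (qplus x y).
Proof.
rewrite /hh mulrBl mul1r mulrBr mulr1 hmonM ss_hecke /qplus !hmonD hmonN !opprD !opprK.
by rewrite !addrA; congr (_ + _); rewrite addrAC.
Qed.

Lemma hhC a b x y : (a + 1 < b) || (b + 1 < a) -> hh a x * hh b y = hh b y * hh a x.
Proof.
move=> ab; rewrite /hh !mulrBl !mul1r !mulrBr !mulr1 !hmonM (hecke_comm ab) mulrC.
rewrite !opprB !addrA addrAC [RHS]addrAC; congr (_ + _); exact: addrAC.
Qed.

(** The outer parameters add up to the middle one z, so the terms in the outer letter alone collapse
    to -z T_b. The expansion [h3] is then unchanged when the two letters and the two outer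
    parameters are exchanged, up to the braid relation. *)
Lemma hh_yang_baxter a x y :
  hh a x * hh (a + 1) (qplus x y) * hh a y =
  hh (a + 1) y * hh a (qplus x y) * hh (a + 1) x.
Proof.
set z := qplus x y.
have h3 b c p q : qplus p q = z -> hh b p * hh c z * hh b q = 1 - hmon z (s b) -
   (hmon z (s c) + (hmon (p * z * q) (hecke (s b) (hecke (s c) (s b)))
     - hmon (p * z) (hecke (s b) (s c)) - hmon (z * q) (hecke (s c) (s b)))).
  move=> pq; rewrite (_ : hh b p * hh c z = hh b p - hh b p * hmon z (s c)); last first.
    by rewrite {2}/hh mulrBr mulr1.
  rewrite mulrBl hhM pq; congr (_ - _).
  rewrite /hh mulrBl mul1r mulrBr mulr1 mulrBl !hmonM heckeA.
  by rewrite opprB -addrA; congr (_ + _); rewrite addrA (addrC (- _)).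
rewrite h3 // h3; last by rewrite /qplus mulrC (addrC y).
rewrite hecke_braid (mulrC z y) (mulrC z x) (mulrAC y) -mulrA (mulrC y z) mulrA.
rewrite [in X in _ = _ - X]addrAC !opprD !addrA; do 3! congr (_ + _); first exact: addrAC.
by congr (- hmon _ _); rewrite -[RHS]mulrA mulrC.
Qed.

End YangBaxter.

Lemma prod_comm_perm (R : nzRingType) (I : eqType) (F : I -> R) (vs vs' : seq I) :
  perm_eq vs vs' -> (forall x y, x \in vs -> F x * F y = F y * F x) ->
  \prod_(x <- vs) F x = \prod_(x <- vs') F x.
Proof.
move=> pv cm.
have cmp (r : seq I) y : {subset r <= vs} ->
    (\prod_(x <- r) F x) * F y = F y * \prod_(x <- r) F x.
  elim: r => [|x r IH] h; first by rewrite big_nil mulr1 mul1r.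
  have xv : x \in vs by apply: h; rewrite inE eqxx.
  rewrite big_cons -mulrA IH; last by move=> z zr; apply: h; rewrite inE zr orbT.
  by rewrite mulrA cm // mulrA.
have cmp2 (r r' : seq I) : {subset r <= vs} ->
    (\prod_(x <- r) F x) * (\prod_(x <- r') F x) =
    (\prod_(x <- r') F x) * \prod_(x <- r) F x.
  move=> rv; elim: r' => [|x r' IH]; first by rewrite big_nil mulr1 mul1r.
  by rewrite big_cons mulrA cmp // -mulrA IH mulrA.
pose P (v : seq I) := perm_eq vs v /\ \prod_(x <- vs) F x = \prod_(x <- v) F x.
suff : P vs' by case.
apply: (catCA_perm_ind _ pv); last by split.
move=> s1 s2 s3 [p1 e1]; split; first by rewrite perm_sym perm_catCA perm_sym.
rewrite e1 !big_cat /= !mulrA cmp2 // => z z1.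
by rewrite (perm_mem p1) mem_cat z1.
Qed.

Section Blocks.
Variable A : comNzRingType.
Implicit Types (x y : A) (a b : int) (k n : nat).

(* The letters a + k - 1, ..., a + 1, a. *)
Fixpoint dn (a : int) (k : nat) : seq int :=
  if k is k'.+1 then rcons (dn (a + 1) k') a else [::].

Lemma mem_dn a k b : (b \in dn a k) = (a <= b < a + k%:Z).
Proof.
elim: k a => [|k IH] a /=; first by rewrite in_nil; lia.
by rewrite mem_rcons inE IH; lia.
Qed.

Definition EE (z : seq (int * A)) : halg A := \prod_(p <- z) hh p.1 p.2.

Lemma EE_cat z z' : EE (z ++ z') = EE z * EE z'.
Proof. by rewrite /EE big_cat. Qed.

Lemma EE_nil : EE [::] = 1. Proof. by rewrite /EE big_nil. Qed.

Lemma EE_seq1 p : EE [:: p] = hh p.1 p.2.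
Proof. by rewrite /EE big_seq1. Qed.

Lemma EE_cons p z : EE (p :: z) = hh p.1 p.2 * EE z.
Proof. by rewrite /EE big_cons. Qed.

Definition bl a k x : seq (int * A) := [seq (b, x) | b <- dn a k].

(** A_a(x) restricted to the letters a, ..., a + k - 1. With a = -n and k = 2n + 1 it also serves as
    truncation of C(x). *)
Definition AA a k x : halg A := EE (bl a k x).

Lemma AA0 a x : AA a 0 x = 1. Proof. exact: EE_nil. Qed.

Lemma AAS a k x : AA a k.+1 x = AA (a + 1) k x * hh a x.
Proof. by rewrite /AA /bl /= map_rcons -cats1 EE_cat EE_seq1. Qed.

Lemma hh0 a : hh a (0 : A) = 1.
Proof. by rewrite /hh hmon0 subr0. Qed.

Lemma hhV a x x' : qplus x x' = 0 -> hh a x * hh a x' = 1.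
Proof. by move=> xx; rewrite hhM xx hh0. Qed.

Lemma qplusC x y : qplus x y = qplus y x.
Proof. by rewrite /qplus mulrC (addrC x). Qed.

Lemma qplusE x y : qplus x y = 1 - (1 - x) * (1 - y).
Proof.
rewrite mulrBl mul1r mulrBr mulr1 !opprB addrC !addrA subrK.
by rewrite /qplus addrAC.
Qed.

Lemma qplusA x y z : qplus x (qplus y z) = qplus (qplus x y) z.
Proof. by rewrite !qplusE !subKr mulrA. Qed.

Lemma qplus0 x : qplus x 0 = x.
Proof. by rewrite /qplus mulr0 subr0 addr0. Qed.

Lemma hh_EE_comm b y (z : seq (int * A)) :
  (forall p, p \in z -> (b + 1 < p.1) || (p.1 + 1 < b)) -> hh b y * EE z = EE z * hh b y.
Proof.
elim: z => [|p z IH] h; first by rewrite EE_nil mulr1 mul1r.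
rewrite EE_cons mulrA hhC; last by apply: h; rewrite inE eqxx.
by rewrite -!mulrA IH // => q qz; apply: h; rewrite inE qz orbT.
Qed.

Lemma EE_comm (z z' : seq (int * A)) :
  (forall p q, p \in z -> q \in z' -> (p.1 + 1 < q.1) || (q.1 + 1 < p.1)) ->
  EE z * EE z' = EE z' * EE z.
Proof.
elim: z => [|p z IH] h; first by rewrite EE_nil mulr1 mul1r.
rewrite EE_cons -mulrA IH; last by move=> q r qz; apply: h; rewrite inE qz orbT.
by rewrite mulrA hh_EE_comm ?mulrA // => q qz; apply: h => //; rewrite inE eqxx.
Qed.

Lemma hh_AA_comm b y a k x : b + 1 < a -> hh b y * AA a k x = AA a k x * hh b y.
Proof.
move=> ba; apply: hh_EE_comm => _ /mapP[c + ->] /=.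
by rewrite mem_dn; lia.
Qed.

(* Fomin and Kirillov: downward induction on the lowest letter, with
   h_a(x) h_(a+1)(y) h_a(y - x) = h_(a+1)(y - x) h_a(y) h_(a+1)(x), where y - x is
   the subtraction of the multiplicative formal group law. *)
Lemma AA_comm a k x y x' : qplus x x' = 0 -> AA a k x * AA a k y = AA a k y * AA a k x.
Proof.
move=> xx; elim: k a => [|k IH] a; first by rewrite !AA0.
case: k IH => [|k] IH; first by rewrite !AAS !AA0 !mul1r !hhM qplusC.
pose d := qplus y x'.
have dx : qplus x d = y by rewrite /d qplusC -qplusA (qplusC x') xx qplus0.
have hy b : hh b y = hh b d * hh b x by rewrite hhM qplusC dx.
have hd b : hh b d = hh b y * hh b x' by rewrite hhM.
have key : hh a x * hh (a + 1) y * hh a y =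
           hh (a + 1) d * hh a y * hh (a + 1) x * hh a x.
  have yb := hh_yang_baxter a x d; rewrite dx in yb.
  by rewrite [in LHS](hy a) mulrA yb.
have IH' := IH (a + 1).
have ENx := AAS (a + 1) k x; have ENy := AAS (a + 1) k y.
have cx : hh a x * AA (a + 1 + 1) k y = AA (a + 1 + 1) k y * hh a x.
  by apply: hh_AA_comm; lia.
have cy : hh a y * AA (a + 1 + 1) k x = AA (a + 1 + 1) k x * hh a y.
  by apply: hh_AA_comm; lia.
rewrite (AAS a k.+1 x) (AAS a k.+1 y).
move: (AA (a + 1) k.+1 x) (AA (a + 1) k.+1 y) IH' ENx ENy => Nx Ny IH' ENx ENy.
move: (AA (a + 1 + 1) k x) (AA (a + 1 + 1) k y) ENx ENy cx cy => Mx My ENx ENy cx cy.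
transitivity (Nx * (My * (hh a x * hh (a + 1) y * hh a y))).
  by rewrite ENy !mulrA -(mulrA Nx (hh a x)) cx !mulrA.
rewrite key.
(* Once [Nx] has been moved past [Ny] by induction, h_(a+1)(x') cancels its last factor. *)
transitivity (Nx * Ny * hh (a + 1) x' * hh a y * hh (a + 1) x * hh a x).
  by rewrite ENy hd !mulrA.
have -> : Nx * Ny * hh (a + 1) x' = Ny * Mx by rewrite IH' ENx -!mulrA hhV // mulr1.
by rewrite ENx !mulrA -(mulrA Ny Mx) -cy !mulrA.
Qed.

Fixpoint up (a : int) (k : nat) : seq int :=
  if k is k'.+1 then a :: up (a + 1) k' else [::].

Lemma mem_up a k b : (b \in up a k) = (a <= b < a + k%:Z).
Proof.
elim: k a => [|k IH] a /=; first by rewrite in_nil; lia.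
by rewrite inE IH; lia.
Qed.

(** The truncated form of A_i = C D_i^-1. The last factors of [AA p (k + r) x] are cancelled from
    the lowest letter up, so the inverses come in increasing order. *)
Lemma AA_split p r k x x' : qplus x x' = 0 ->
  AA (p + r%:Z) k x = AA p (k + r) x * EE [seq (b, x') | b <- up p r].
Proof.
move=> xx; elim: r p => [|r IH] p /=; first by rewrite EE_nil mulr1 addr0 addn0.
rewrite addnS AAS EE_cons -mulrA (mulrA (hh p x)) hhV // mul1r -IH.
by congr AA; lia.
Qed.

(** Since A_(a+1)(x) = A_a(x) h_a(x'), exchanging x and y amounts to commuting A_a(x) with A_a(y).
    The remaining factor, h_a of the formal difference of y and x, is the source of the operators
    [tpi]. *)
Lemma hh_AA_swap a k x y x' : qplus x x' = 0 ->
  AA a k.+1 y * AA (a + 1) k x = AA a k.+1 x * AA (a + 1) k y * hh a (qplus y x').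
Proof.
move=> xx; rewrite -[LHS]mulr1 -(hhV a xx) mulrA -(mulrA _ _ (hh a x)) -AAS.
by rewrite -(AA_comm _ _ _ xx) [AA a _ y]AAS mulrA -(mulrA _ (hh a y)) hhM.
Qed.

End Blocks.

(** * Monomials and substitution *)

Section Monomials.
Variable K : choiceType.
Implicit Types (m : {mset K}%mset) (f g : series K).

Definition mon m : series K := fun m' => (m' == m)%:R.

Lemma XE (i : K) : X i = mon [mset i]%mset. Proof. by []. Qed.

Lemma smul_single f g m p : (p.1 `+` p.2)%mset = m ->
  (forall a b, (a `+` b)%mset = m -> (a, b) <> p -> f a * g b = 0) ->
  (f * g) m = f p.1 * g p.2.
Proof.
move=> pw fg0; rewrite -[LHS]/(series_mul f g m) series_mulE.
have mD q : (q \in (fset_set (decomp m) : seq _)) = ((q.1 `+` q.2)%mset == m).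
  by rewrite in_fset_set; [apply/idP/eqP; rewrite inE|exact: finite_decomp].
rewrite (bigD1_seq p) ?mD ?pw ?fset_uniq //=.
rewrite big_seq_cond big1 ?addr0 // => -[a b] /andP[].
by rewrite mD /= => /eqP abw /eqP; exact: fg0.
Qed.

Lemma smul_zero f g m :
  (forall a b, (a `+` b)%mset = m -> f a * g b = 0) -> (f * g) m = 0.
Proof.
move=> fg0; rewrite -[LHS]/(series_mul f g m) /series_mul fsbig1 // => -[a b] /=.
exact: fg0.
Qed.

Lemma msetDI m m1 m2 : (m `+` m1)%mset = (m `+` m2)%mset -> m1 = m2.
Proof.
move=> /msetP h; apply/msetP => i; have := h i; rewrite !msetE2; lia.
Qed.

Lemma mon_mulE m f m' : (mon m * f) (m `+` m')%mset = f m'.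
Proof.
rewrite (smul_single (p := (m, m'))) //=; first by rewrite /mon eqxx mul1r.
move=> a b; rewrite /mon; case: eqP => [->|_]; last by rewrite mul0r.
by move/msetDI->.
Qed.

Lemma mon_mul0 m f m' : (forall m'', (m `+` m'')%mset <> m') -> (mon m * f) m' = 0.
Proof.
move=> h; apply: smul_zero => a b ab; rewrite /mon; case: eqP => [am|_]; last by rewrite mul0r.
by subst a; case: (h b).
Qed.

Lemma monM m m' : mon m * mon m' = mon (m `+` m')%mset.
Proof.
apply/funext => n.
have [[n' <-]|h] := pselect (exists n', (m `+` n')%mset = n).
  rewrite mon_mulE /mon; congr (_ %:R); congr nat_of_bool.
  by apply/eqP/eqP => [->//|/msetDI].
rewrite mon_mul0; last by move=> n' n'n; apply: h; exists n'.
by rewrite /mon; case: eqP => // nm; case: h; exists m'.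
Qed.

Lemma mon0 : mon mset0 = 1. Proof. by []. Qed.

Lemma prodXE (r : seq K) : \prod_(i <- r) X i = mon (seq_mset r).
Proof.
elim: r => [|i r IH].
  by rewrite big_nil -mon0; congr mon; apply/msetP => i; rewrite mset0E mset_seqE.
rewrite big_cons IH.
rewrite XE.
rewrite monM.
congr mon.
by rewrite mset_cons.
Qed.

Lemma serDE f g m : (f + g) m = f m + g m. Proof. by []. Qed.

Lemma ser1E m : (1 : series K) m = (m == mset0)%:R. Proof. by []. Qed.

Lemma serNE f m : (- f) m = - f m. Proof. by []. Qed.

Lemma ser_sumE (I : Type) (r : seq I) (P : pred I) (F : I -> series K) m :
  (\sum_(i <- r | P i) F i) m = \sum_(i <- r | P i) F i m.
Proof.
by elim: r => [|i r IH]; rewrite ?big_nil // !big_cons; case: ifP; rewrite ?serDE IH.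
Qed.

Lemma ser_mulrz f (c : int) m : (f *~ c) m = f m * c.
Proof.
have E n : (f *+ n) m = f m *+ n.
  by elim: n => [|n IH]; rewrite ?mulr0n // !mulrS serDE IH.
case: c => n; first by rewrite -[LHS]/((f *+ n) m) E -mulr_natr natz.
rewrite NegzE mulrN -[LHS]/(- (f *+ n.+1) m) E -mulr_natr natz //.
Qed.

End Monomials.

Section Subst.
Variables K L : choiceType.
Implicit Types (m : {mset K}%mset) (f g : series K) (b : K -> series L).

Definition mpow b m : series L := \prod_(i <- m) b i.

Lemma mpowE b m : \prod_(i <- finsupp m) b i ^+ m i = mpow b m.
Proof. by rewrite /mpow big_mset. Qed.

Lemma substE b f (m' : {mset L}%mset) :
  subst b f m' = \sum_(m \in [set: {mset K}%mset]) mpow b m m' * f m.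
Proof.
rewrite /subst /ssum; apply: eq_fsbigr => m _.
by rewrite mpowE ser_mulrz.
Qed.

(** The coefficients of [subst b f] are sums that count as 0 when infinitely many terms are nonzero,
    so additivity is only claimed for polynomials. *)
Definition fsupp f := exists S : {fset {mset K}%mset}, forall m, m \notin S -> f m = 0.

Lemma subst_fsupp b f (S : {fset {mset K}%mset}) (m' : {mset L}%mset) : (forall m, m \notin S -> f m = 0) ->
  subst b f m' = \sum_(m <- S) mpow b m m' * f m.
Proof.
by move=> fS; rewrite substE (fsbigTE S) // => m /fS ->; rewrite mulr0.
Qed.

Lemma subst_add b f g : fsupp f -> fsupp g -> subst b (f + g) = subst b f + subst b g.
Proof.
move=> [S fS] [T gT]; apply/funext => m'; rewrite serDE.
have fST m : m \notin (S `|` T)%fset -> f m = 0.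
  by rewrite in_fsetU negb_or => /andP[/fS].
have gST m : m \notin (S `|` T)%fset -> g m = 0.
  by rewrite in_fsetU negb_or => /andP[_ /gT].
rewrite (@subst_fsupp b f _ m' fST) (@subst_fsupp b g _ m' gST)
  (@subst_fsupp b (f + g) (S `|` T)%fset).
  by rewrite -big_split; apply: eq_bigr => m _; rewrite serDE mulrDr.
by move=> m mS; rewrite serDE fST ?gST.
Qed.

Lemma fsupp_mon m (c : int) : fsupp (mon m *~ c).
Proof.
exists [fset m]%fset => n; rewrite in_fset1 ser_mulrz /mon => /negbTE->.
by rewrite mul0r.
Qed.

Lemma fsupp_sum (I : Type) (r : seq I) (P : pred I) (F : I -> series K) :
  (forall i, P i -> fsupp (F i)) -> fsupp (\sum_(i <- r | P i) F i).
Proof.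
move=> h; apply: (big_ind fsupp) => //; first by exists fset0.
move=> f g [S fS] [T gT]; exists (S `|` T)%fset => m.
by rewrite in_fsetU negb_or serDE => /andP[/fS-> /gT->].
Qed.

Lemma subst_mon b m (c : int) : subst b (mon m *~ c) = mpow b m *~ c.
Proof.
apply/funext => m'; rewrite (@subst_fsupp b _ [fset m]%fset).
  by rewrite big_seq_fset1 !ser_mulrz /mon eqxx mul1r.
by move=> n; rewrite in_fset1 ser_mulrz /mon => /negbTE->; rewrite mul0r.
Qed.

Lemma subst_sum_mon b (I : Type) (r : seq I) (P : pred I)
    (M : I -> {mset K}%mset) (c : I -> int) :
  subst b (\sum_(i <- r | P i) mon (M i) *~ c i) =
  \sum_(i <- r | P i) mpow b (M i) *~ c i.
Proof.
elim: r => [|i r IH].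
  rewrite !big_nil; apply/funext => m'; rewrite (@subst_fsupp b _ fset0) //.
  by rewrite big_seq_fset0.
rewrite !big_cons; case: ifP => // Pi; rewrite subst_add ?subst_mon ?IH //.
  exact: fsupp_mon.
by apply: fsupp_sum => j _; exact: fsupp_mon.
Qed.

Lemma mpow_seq b (r : seq K) : mpow b (seq_mset r) = \prod_(j <- r) b j.
Proof. by apply: perm_big; exact: perm_eq_seq_mset. Qed.

End Subst.

Section PushMonomial.
Variables (K L : choiceType) (phi : K -> L).
Implicit Types (m : {mset K}%mset) (f g : series K).

Definition pm m : {mset L}%mset := seq_mset (map phi m).

Lemma pmD m1 m2 : pm (m1 `+` m2)%mset = (pm m1 `+` pm m2)%mset.
Proof.
have E : perm_eq (m1 `+` m2)%mset ((m1 : seq K) ++ m2).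
  apply/allP => x _; apply/eqP.
  by rewrite /= count_cat !count_mem_mset msetE2.
by apply/msetP => i; rewrite /pm msetE2 !mset_seqE -count_cat -map_cat; apply/permP/perm_map.
Qed.

Lemma mem_pm m j : j \in pm m = (j \in map phi m).
Proof. by rewrite (perm_mem (perm_eq_seq_mset _)). Qed.

Lemma pm_lift (P : K -> Prop) (c : {mset L}%mset) :
  (forall j, j \in c -> exists2 i, P i & j = phi i) ->
  exists2 p, c = pm p & forall i, i \in p -> P i.
Proof.
move=> cP; have h (r : seq L) : {subset r <= c} ->
    exists2 r', r = map phi r' & forall i, i \in r' -> P i.
  elim: r => [|j r IH] h; first by exists [::].
  have [|r' -> Pr'] := IH; first by move=> k kr; apply: h; rewrite inE kr orbT.
  have [|i Pi ->] := cP j; first by apply: h; rewrite inE eqxx.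
  by exists (i :: r') => // k; rewrite inE => /orP[/eqP->|/Pr'].
have [//|r' cr Pr'] := h (c : seq L).
exists (seq_mset r').
  rewrite -[LHS]seq_mset_id cr /pm; apply/eq_seq_msetP.
  by apply: perm_map; rewrite perm_sym perm_eq_seq_mset.
by move=> i; rewrite (perm_mem (perm_eq_seq_mset _)) => /Pr'.
Qed.

Lemma renE f (m' : {mset L}%mset) : subst (fun i => X (phi i)) f m' =
  \sum_(m \in [set: {mset K}%mset]) (m' == pm m)%:R * f m.
Proof.
rewrite substE; apply: eq_fsbigr => m _.
by rewrite /mpow -(big_map phi xpredT (fun j => X j)) prodXE.
Qed.

End PushMonomial.

Section Renaming.
Variables (K L : choiceType) (phi : K -> L) (D : pred K).
Hypothesis phi_inj : {in D &, injective phi}.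
Implicit Types (m : {mset K}%mset) (f g : series K).

Lemma pmE m i : (forall j, j \in m -> D j) -> D i -> pm phi m (phi i) = m i.
Proof.
move=> mD iD; rewrite /pm mset_seqE count_map -(count_mem_mset i m).
apply: eq_in_count => j jm /=; apply/eqP/eqP => [|->//].
by apply: phi_inj => //; exact: mD.
Qed.

Lemma pm_inj m (m' : {mset K}%mset) :
  (forall j, j \in m -> D j) -> (forall j, j \in m' -> D j) ->
  pm phi m = pm phi m' -> m = m'.
Proof.
move=> mD mD' e; apply/msetP => i.
have [iD|iD] := boolP (D i); first by rewrite -(pmE mD iD) -(pmE mD' iD) e.
have /eqP-> : m i == 0%N by rewrite mset_eq0; apply: contra iD; exact: mD.
by apply/esym/eqP; rewrite mset_eq0; apply: contra iD; exact: mD'.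
Qed.

Lemma pm_split m (a b : {mset L}%mset) : (forall j, j \in m -> D j) ->
  (a `+` b)%mset = pm phi m ->
  exists p q, [/\ (p `+` q)%mset = m, a = pm phi p & b = pm phi q].
Proof.
move=> mD ab; have lift (c : {mset L}%mset) : (forall j, j \in c -> j \in (a `+` b)%mset) ->
    exists2 p, c = pm phi p & forall i, i \in p -> D i.
  move=> h; apply: pm_lift => j /h; rewrite ab mem_pm => /mapP[i im ->].
  by exists i => //; exact: mD.
have [p ep pD] : exists2 p, a = pm phi p & forall i, i \in p -> D i.
  by apply: lift => j ja; rewrite in_msetD ja.
have [q eq qD] : exists2 q, b = pm phi q & forall i, i \in q -> D i.
  by apply: lift => j jb; rewrite in_msetD jb orbT.
exists p, q; split => //; apply: pm_inj => //; last by rewrite pmD -ep -eq.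
by move=> j; rewrite in_msetD => /orP[/pD|/qD].
Qed.

(** A renaming that is injective only on D still acts faithfully on series in the variables of D.
    The case in view is [interleave], which depends on |i| alone and is injective on nonpositive
    indices. *)
Definition suppin f := forall m, f m != 0 -> forall j, j \in m -> D j.

Lemma ren_pm f m : suppin f -> (forall j, j \in m -> D j) ->
  subst (fun i => X (phi i)) f (pm phi m) = f m.
Proof.
move=> fD mD; rewrite renE (fsbigTE [fset m]%fset).
  by rewrite big_seq_fset1 eqxx mul1r.
move=> n; rewrite in_fset1 => nm; have [->|fn] := eqVneq (f n) 0; first by rewrite mulr0.
case: eqP => [/pm_inj e|_]; last by rewrite mul0r.
by move: nm; rewrite -e ?eqxx //; exact: fD.
Qed.

Lemma ren_notpm f (m' : {mset L}%mset) : suppin f ->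
  (forall m, (forall j, j \in m -> D j) -> m' <> pm phi m) ->
  subst (fun i => X (phi i)) f m' = 0.
Proof.
move=> fD h; rewrite renE fsbig1 // => m _.
have [->|fn] := eqVneq (f m) 0; first by rewrite mulr0.
case: eqP => [e|_]; last by rewrite mul0r.
by case: (h m) => //; exact: fD.
Qed.

End Renaming.

Section InjectiveRenaming.
Variables (K L : choiceType) (phi : K -> L).
Hypothesis phi_inj : injective phi.
Implicit Types (m : {mset K}%mset) (f g : series K).

Let injT : {in predT &, injective phi}. Proof. by move=> x y _ _; exact: phi_inj. Qed.

Lemma suppinT f : suppin predT f. Proof. by []. Qed.

Lemma ren_pmT f m : subst (fun i => X (phi i)) f (pm phi m) = f m.
Proof. exact: (ren_pm injT). Qed.

Lemma ren_notpmT f (m' : {mset L}%mset) : (forall m, m' <> pm phi m) -> subst (fun i => X (phi i)) f m' = 0.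
Proof. by move=> h; apply: (ren_notpm (D := predT)) => // m _; exact: h. Qed.

Lemma pm_injT : injective (pm phi).
Proof. by move=> m m'; exact: (pm_inj injT). Qed.

Lemma ren_mul f g : subst (fun i => X (phi i)) (f * g) =
  subst (fun i => X (phi i)) f * subst (fun i => X (phi i)) g.
Proof.
apply/funext => m'; have [[m ->]|h] := pselect (exists m, m' = pm phi m); last first.
  rewrite ren_notpmT; last by move=> m e; apply: h; exists m.
  rewrite smul_zero // => a b ab.
  have [[p ep]|ha] := pselect (exists p, a = pm phi p); last first.
    by rewrite [X in X * _]ren_notpmT ?mul0r // => m e; apply: ha; exists m.
  have [[q eq]|hb] := pselect (exists q, b = pm phi q); last first.
    by rewrite [X in _ * X]ren_notpmT ?mulr0 // => m e; apply: hb; exists m.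
  by case: h; exists (p `+` q)%mset; rewrite pmD -ep -eq.
rewrite ren_pmT -[LHS]/(series_mul f g m) -[RHS]/(series_mul _ _ (pm phi m)) /series_mul.
pose h (p : {mset K}%mset * {mset K}%mset) := (pm phi p.1, pm phi p.2).
rewrite (reindex_fsbig h (decomp m)); last first.
  split.
  - by move=> [p q] /=; rewrite /decomp /= -pmD => ->.
  - by move=> [p q] [p' q'] _ _ [/pm_injT -> /pm_injT ->].
  move=> [a b] /= ab; have [//|p [q [pq /= pa qb]]] := pm_split injT _ ab.
  by exists (p, q) => //; rewrite /h /= -pa -qb.
by apply: eq_fsbigr => p _; rewrite /= !ren_pmT.
Qed.

Lemma ren_add f g : subst (fun i => X (phi i)) (f + g) =
  subst (fun i => X (phi i)) f + subst (fun i => X (phi i)) g.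
Proof.
apply/funext => m'; rewrite serDE.
have [[m ->]|h] := pselect (exists m, m' = pm phi m); first by rewrite !ren_pmT.
by rewrite !ren_notpmT ?addr0 // => m e; apply: h; exists m.
Qed.

Lemma ren0 : subst (fun i => X (phi i)) 0 = 0.
Proof.
apply/funext => m'; have [[m ->]|h] := pselect (exists m, m' = pm phi m).
  by rewrite ren_pmT.
by rewrite ren_notpmT // => m e; apply: h; exists m.
Qed.

Lemma ren1 : subst (fun i => X (phi i)) 1 = 1.
Proof.
rewrite -[in LHS]mon0 -[mon _]mulr1z subst_mon /mpow.
by rewrite (perm_big [::]) ?big_nil // enum_mset0.
Qed.

Lemma ren_opp f : subst (fun i => X (phi i)) (- f) = - subst (fun i => X (phi i)) f.
Proof. by apply/eqP; rewrite -addr_eq0 -ren_add addNr ren0. Qed.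

Lemma ren_sum (I : Type) (r : seq I) (F : I -> series K) :
  subst (fun i => X (phi i)) (\sum_(i <- r) F i) =
  \sum_(i <- r) subst (fun i => X (phi i)) (F i).
Proof. by elim: r => [|i r IH]; rewrite ?big_nil ?ren0 // !big_cons ren_add IH. Qed.

Lemma ren_sign n f : subst (fun i => X (phi i)) ((-1) ^+ n * f) =
  (-1) ^+ n * subst (fun i => X (phi i)) f.
Proof. by rewrite -[(-1) ^+ n in LHS]signr_odd -[(-1) ^+ n in RHS]signr_odd; case: (odd n); rewrite ?expr0 ?expr1 ?mul1r // !mulN1r ren_opp. Qed.

End InjectiveRenaming.

Section Geom.
Variable K : choiceType.
Implicit Types (i : K) (m : {mset K}%mset).

Lemma Xexp i k : X i ^+ k = mon (msetn k i).
Proof.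
elim: k => [|k IH]; first by rewrite msetn0.
rewrite exprS IH XE monM; congr mon; apply/msetP => j.
by rewrite msetE2 !msetnE; case: eqP.
Qed.

Lemma geomE i m : geom (X i) m = (m == msetn (m i) i)%:R.
Proof.
rewrite /geom /ssum (fsbigTE [fset m i]%fset); first by rewrite big_seq_fset1 Xexp.
move=> k; rewrite in_fset1 Xexp /mon => ki; case: eqP => // mk.
by move: ki; rewrite {1}mk msetnxx eqxx.
Qed.

Lemma geom_X i : geom (X i) = 1 + X i * geom (X i).
Proof.
apply/funext => m; rewrite serDE ser1E.
have [im|im] := boolP (i \in m).
  rewrite -(msetB1K im) [X i in RHS]XE mon_mulE !geomE.
  have /negbTE-> : (i +` m `\ i)%mset != mset0.
    by apply/eqP => /msetP/(_ i); rewrite mset0E mset1DE eqxx.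
  rewrite add0r; congr (_%:R); congr nat_of_bool.
  apply/eqP/eqP => [/msetP e|e]; apply/msetP => j.
    have := e j; rewrite !mset1DE !msetnE eqxx; case: eqP => [->|_] //.
  rewrite !mset1DE eqxx msetnE e !msetnE eqxx; case: eqP => //.
rewrite [X i in RHS]XE mon_mul0 ?addr0; last first.
  by move=> m'' e; move: im; rewrite -e mset1D1.
rewrite geomE (_ : m i = 0%N) ?msetn0 //.
by apply/eqP; rewrite mset_eq0.
Qed.

Lemma qplus_ominus i : qplus (X i) (ominus (X i)) = 0.
Proof.
rewrite /ominus; move: (geom (X i)) (geom_X i) => g; move: (X i) => x e.
by rewrite qplusE mulNr opprK -e mulrBl mul1r {1}e addrK subrr.
Qed.

End Geom.

(** * Expansion over subwords *)

Section Subwords.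
Variable T : eqType.

Fixpoint subs (z : seq T) : seq (seq T) :=
  if z is x :: z' then subs z' ++ map (cons x) (subs z') else [:: [::]].

Lemma mem_subs t z : (t \in subs z) = subseq t z.
Proof.
elim: z t => [|x z IH] t /=; first by rewrite inE; case: t.
rewrite mem_cat IH; apply/orP/idP => [[h|/mapP[t' + ->]]|].
- exact: subseq_trans h (subseq_cons z x).
- by rewrite IH eqxx.
case: t => [|y t]; first by left; rewrite sub0seq.
case: eqP => [->|_] h; last by left.
by right; rewrite mem_map ?IH //; move=> ? ? [].
Qed.

Lemma subs_uniq z : uniq z -> uniq (subs z).
Proof.
elim: z => [|x z IH] //= /andP[xz /IH uz]; rewrite cat_uniq uz map_inj_uniq ?uz ?andbT /=.
  apply/hasPn => _ /mapP[t _ ->]; rewrite mem_subs; apply: contra xz => /mem_subseq.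
  by apply; rewrite inE eqxx.
by move=> ? ? [].
Qed.

Lemma subs_filter (Q : pred T) z : subs (seq.filter Q z) = seq.filter (all Q) (subs z).
Proof.
elim: z => [|x z IH] //=; rewrite filter_cat filter_map.
case: ifP => Qx /=; rewrite IH.
  by congr (_ ++ map _ _); apply: eq_filter => t /=; rewrite Qx.
rewrite [X in _ ++ map _ X](eq_filter (a2 := pred0)) ?filter_pred0 ?cats0 // => t /=.
by rewrite Qx.
Qed.

End Subwords.

Definition fsts {K : Type} (t : seq (int * K)) : seq int := [seq p.1 | p <- t].
Definition snds {K : Type} (t : seq (int * K)) : seq K := [seq p.2 | p <- t].

Lemma EE_expand (A : comNzRingType) (z : seq (int * A)) : EE z =
  \sum_(t <- subs z) hmon ((-1) ^+ size t * \prod_(p <- t) p.2) (hword (fsts t)).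
Proof.
elim: z => [|[a x] z IH]; first by rewrite EE_nil big_seq1 big_nil mulr1 halg1E.
rewrite EE_cons IH /hh mulrBl mul1r /= big_cat big_map; congr (_ + _).
rewrite mulr_sumr -sumrN; apply: eq_bigr => t _.
rewrite hmonM heckes -hmonN big_cons exprS /=; congr hmon.
by rewrite mulN1r mulNr mulrCA.
Qed.

Section EB.
Variables (K : choiceType) (A : comNzRingType).
Implicit Types (b : K -> A) (l : seq (int * K)).

Definition EB b l : halg A := EE [seq (p.1, b p.2) | p <- l].

Lemma EB_expand b l w : EB b l w =
  \sum_(t <- subs l | hword (fsts t) == w) (-1) ^+ size t * \prod_(p <- t) b p.2.
Proof.
rewrite /EB EE_expand halg_sumE [RHS]big_mkcond /=.
have -> : subs [seq (p.1, b p.2) | p <- l] = map (map (fun p => (p.1, b p.2))) (subs l).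
  elim: l => [|x l IH] //=; rewrite IH map_cat -!map_comp; congr (_ ++ _).
rewrite big_map; apply: eq_bigr => t _.
rewrite /hmon size_map big_map /fsts -map_comp /=.
by case: ifP => _.
Qed.

Lemma EB_cat b l l' : EB b (l ++ l') = EB b l * EB b l'.
Proof. by rewrite /EB map_cat EE_cat. Qed.

Lemma EB_letters b l w (Q : pred int) : (forall a, letter w a -> Q a) ->
  EB b l w = EB b [seq p <- l | Q p.1] w.
Proof.
move=> wQ; rewrite !EB_expand subs_filter big_filter_cond.
apply: eq_bigl => t; case: eqP => [tw|_]; last by rewrite andbF.
rewrite /= ?andbT; apply/esym/allP => p pt; apply: wQ.
by rewrite -tw; apply/letter_hword; exact: map_f.
Qed.

Lemma EB_notletter b l w a : letter w a -> a \notin fsts l -> EB b l w = 0.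
Proof.
move=> wa al; rewrite EB_expand big_seq_cond big1 // => t /andP[].
rewrite mem_subs => tl /eqP tw; move: wa; rewrite -tw => /letter_hword at'.
case/negP: al; apply: (mem_subseq _ at').
exact: map_subseq.
Qed.

End EB.

Section EX.
Variable K : choiceType.
Implicit Types (l : seq (int * K)) (m : {mset K}%mset).

Definition EX l : halg (series K) := EB (fun i => X i) l.

Lemma EX_mon l w : EX l w =
  \sum_(t <- subs l | hword (fsts t) == w) mon (seq_mset (snds t)) *~ ((-1) ^+ size t).
Proof.
rewrite /EX EB_expand; apply: eq_bigr => t _.
rewrite -(big_map snd xpredT (fun i => X i)) prodXE -mulrzl.
by rewrite rmorphXn /= rmorphN1.
Qed.

Lemma EX_coef l w m : EX l w m =
  \sum_(t <- subs l | (hword (fsts t) == w) && (seq_mset (snds t) == m)) (-1) ^+ size t.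
Proof.
rewrite EX_mon ser_sumE [RHS]big_mkcondr /=; apply: eq_bigr => t _.
by rewrite ser_mulrz /mon eq_sym; case: eqP; rewrite ?mul1r ?mul0r.
Qed.

(** A contributing subword is a Hecke word for w, so its letters are those of w, and its variables
    multiply to m. This locality is what makes the coefficients of truncated products stabilize. *)
Lemma EX_filter l w m (Q : pred (int * K)) :
  (forall p, letter w p.1 -> p.2 \in m -> Q p) -> EX l w m = EX (seq.filter Q l) w m.
Proof.
move=> wQ; rewrite !EX_coef subs_filter big_filter_cond.
apply: eq_bigl => t; case: eqP => [tw|_]; last by rewrite andbF.
case: eqP => [tm|_]; last by rewrite !andbF.
rewrite /= ?andbT; apply/esym/allP => p pt; apply: wQ.
  by rewrite -tw; apply/letter_hword; exact: map_f.
by rewrite -tm (perm_mem (perm_eq_seq_mset _)); exact: map_f.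
Qed.

Lemma subst_EX (L : choiceType) (b : K -> series L) l w : subst b (EX l w) = EB b l w.
Proof.
rewrite EX_mon subst_sum_mon EB_expand; apply: eq_bigr => t _.
rewrite mpow_seq -mulrzl rmorphXn /= rmorphN1 /snds big_map //.
Qed.

Lemma EX_supp l w m i : EX l w m != 0 -> i \in m -> i \in snds l.
Proof.
move=> h im; apply: contraT => il; move: h; rewrite EX_coef big_seq_cond big1 ?eqxx //.
move=> t /andP[]; rewrite mem_subs => tl /andP[_ /eqP tm].
move: im; rewrite -tm (perm_mem (perm_eq_seq_mset _)) => it.
by case/negP: il; apply: (mem_subseq _ it); exact: map_subseq.
Qed.

End EX.

(** * Staircases and rectangles *)

(** The reading order of A_1(x_1) A_2(x_2) ...: variables increase, and letters decrease within one
    variable. Sorted lists are determined by their entries, so truncations can be compared by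
    membership alone. *)
Definition ltw (p q : int * int) : bool :=
  (p.2 < q.2) || (p.2 == q.2) && (q.1 < p.1).

Lemma ltw_trans : transitive ltw.
Proof. by move=> [a i] [b j] [c k]; rewrite /ltw /=; lia. Qed.

Lemma ltw_irr : irreflexive ltw.
Proof. by move=> [a i]; rewrite /ltw /=; lia. Qed.

Definition brow (a : int) (k : nat) (i : int) : seq (int * int) :=
  [seq (b, i) | b <- dn a k].

(** The word of A_p(x_p) A_(p+1)(x_(p+1)) ... restricted to letters below p + k; the rows shrink
    because this upper bound is common to all of them. [RT] is the analogue for a product of
    truncated C(x_i). *)
Fixpoint ST (p : int) (k : nat) : seq (int * int) :=
  if k is k'.+1 then brow p k p ++ ST (p + 1) k' else [::].

Definition RT (a : int) (k : nat) (vs : seq int) : seq (int * int) :=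
  flatten [seq brow a k i | i <- vs].

Lemma mem_row a k i q : (q \in brow a k i) = (q.2 == i) && (a <= q.1 < a + k%:Z).
Proof.
case: q => c j; apply/mapP/idP => /= [[b + [-> ->]]|].
  by rewrite mem_dn eqxx.
by rewrite -mem_dn => /andP[/eqP-> h]; exists c.
Qed.

Lemma mem_ST p k q : (q \in ST p k) = (p <= q.2 <= q.1) && (q.1 < p + k%:Z).
Proof.
elim: k p => [|k IH] p; first by rewrite in_nil; lia.
by rewrite mem_cat IH mem_row; lia.
Qed.

Lemma mem_RT a k vs q : (q \in RT a k vs) = (q.2 \in vs) && (a <= q.1 < a + k%:Z).
Proof.
apply/flatten_mapP/idP => [[i iv]|/andP[qv qa]].
  by rewrite mem_row => /andP[/eqP-> ->]; rewrite iv.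
by exists q.2 => //; rewrite mem_row eqxx.
Qed.

Lemma row_pairwise a k i : pairwise ltw (brow a k i).
Proof.
elim: k a => [|k IH] a //; rewrite /brow /= map_rcons -cats1 pairwise_cat /= !andbT.
apply/andP; split; last exact: IH.
apply/allP => q; rewrite -/(brow _ _ _) mem_row /ltw /= andbT.
by case: q => c j /=; lia.
Qed.

Lemma ST_sorted p k : sorted ltw (ST p k).
Proof.
rewrite (sorted_pairwise ltw_trans).
elim: k p => [|k IH] p //; rewrite /= -/(brow p k.+1 p) pairwise_cat row_pairwise IH !andbT.
by apply/allrelP => -[a i] [c j]; rewrite mem_row mem_ST /ltw /=; lia.
Qed.

Lemma RT_sorted a k vs : sorted (fun i j : int => i < j) vs -> sorted ltw (RT a k vs).
Proof.
have tr : transitive (fun i j : int => i < j) by move=> i j l; lia.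
rewrite (sorted_pairwise ltw_trans) (sorted_pairwise tr) /RT.
elim: vs => [|i vs IH] //= /andP[/allP iv /IH h].
rewrite pairwise_cat row_pairwise h !andbT.
apply/allrelP => x y; rewrite mem_row => /andP[/eqP xi _].
by rewrite mem_RT => /andP[/iv yv _]; rewrite /ltw xi yv.
Qed.

Lemma sorted_filter_eq (Q : pred (int * int)) l l' : sorted ltw l -> sorted ltw l' ->
  (forall q, Q q -> (q \in l) = (q \in l')) -> seq.filter Q l = seq.filter Q l'.
Proof.
move=> sl sl' h; apply: (irr_sorted_eq ltw_trans ltw_irr).
- exact: sorted_filter ltw_trans _ _ sl.
- exact: sorted_filter ltw_trans _ _ sl'.
by move=> q; rewrite !mem_filter; case Qq: (Q q) => //=; exact: h.
Qed.

Lemma EX_eq l l' w m : sorted ltw l -> sorted ltw l' ->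
  (forall q, letter w q.1 -> q.2 \in m -> (q \in l) = (q \in l')) ->
  EX l w m = EX l' w m.
Proof.
move=> sl sl' h; pose Q q := `[< letter w q.1 >] && (q.2 \in m).
have hQ p : letter w p.1 -> p.2 \in m -> Q p by move=> h1 h2; rewrite /Q h2 asboolT.
rewrite (EX_filter l hQ) (EX_filter l' hQ); congr (EX _ w m).
by apply: sorted_filter_eq => // q /andP[/asboolP h1 h2]; exact: h.
Qed.

Lemma EB_eq (A : comNzRingType) (b : int -> A) l l' w : sorted ltw l -> sorted ltw l' ->
  (forall q, letter w q.1 -> (q \in l) = (q \in l')) ->
  EB b l w = EB b l' w.
Proof.
move=> sl sl' h; pose Q a := `[< letter w a >].
have hQ a : letter w a -> Q a by move=> h1; rewrite /Q asboolT.
rewrite (EB_letters b l hQ) (EB_letters b l' hQ); congr (EB _ _ w).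
by apply: sorted_filter_eq => // q /asboolP h1; exact: h.
Qed.

Section Factor.
Variable A : comNzRingType.
Implicit Types (b : int -> A).

Lemma EB_row b a k i : EB b (brow a k i) = AA a k (b i).
Proof. by rewrite /EB /AA /bl /brow -map_comp. Qed.

Lemma EB_ST b p k : EB b (ST p k.+1) = AA p k.+1 (b p) * EB b (ST (p + 1) k).
Proof. by rewrite [ST _ _]/= EB_cat -/(brow p k.+1 p) EB_row. Qed.

Lemma EB_nil b : EB b [::] = 1. Proof. exact: EE_nil. Qed.

Lemma EB_RT b a k vs : EB b (RT a k vs) = \prod_(i <- vs) AA a k (b i).
Proof.
elim: vs => [|i vs IH]; first by rewrite big_nil EB_nil.
by rewrite [RT _ _ _]/= EB_cat EB_row -/(RT a k vs) IH big_cons.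
Qed.

(** The product D_0^-1 D_(-1)^-1 ... D_(1-j)^-1 for letters at least -n, where D_i^-1 has the
    letters -n, ..., i - 1; [b'] stands for the formal inverses of the variables. *)
Fixpoint MM (b' : int -> A) (n j : nat) : halg A :=
  if j is j'.+1 then MM b' n j' * EE [seq (c, b' (- j'%:Z)) | c <- up (- n%:Z) (n - j')]
  else 1.

Lemma map_opp_dn p k : map -%R (dn p k) = up (1 - p - k%:Z) k.
Proof.
elim: k p => [|k IH] p //.
have upS a j : up a j.+1 = rcons (up a j) (a + j%:Z).
  elim: j a => [|j IHj] a; first by rewrite /= addr0.
  by rewrite [LHS]/= -/(up (a + 1) j.+1) IHj /=; congr (_ :: rcons _ _); lia.
rewrite upS /= map_rcons IH; congr (rcons (up _ _) _); lia.
Qed.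

(** The reflection (a, i) |-> (-a, 1 - i) carries row i of [ST 1 n] to D_(1-i)^-1. It acts as
    [omega] on letters and as x_i |-> x_(1-i) on variables, just as in the definition of
    [grothM]. *)
Lemma MM_ST b' (n j : nat) : (j <= n)%N ->
  MM b' n j * EE [seq (- p.1, b' (1 - p.2)) | p <- ST (1 + j%:Z) (n - j)] =
  EE [seq (- p.1, b' (1 - p.2)) | p <- ST 1 n].
Proof.
elim: j => [|j IH] jn; first by rewrite mul1r addr0 subn0.
rewrite -IH; last by lia.
have -> : (n - j = (n - j.+1).+1)%N by lia.
rewrite /= -/(brow (1 + j%:Z) (n - j.+1).+1 (1 + j%:Z)) map_cat EE_cat mulrA; congr (_ * _ * EE _).
  have -> a k i : [seq (- p.1, b' (1 - p.2)) | p <- brow a k i] =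
      [seq (c, b' (1 - i)) | c <- map -%R (dn a k)] by rewrite /brow -!map_comp.
  rewrite map_opp_dn; congr EE.
  have -> : (n - j = (n - j.+1).+1)%N by lia.
  rewrite (_ : 1 - (1 + j%:Z) - (n - j.+1).+1%:Z = - n%:Z); last by lia.
  by rewrite (_ : 1 - (1 + j%:Z) = - j%:Z); last by lia.
by congr (map _ (ST _ _)); lia.
Qed.

(* For i <= 0 write A_i(x) = C(x) D_i(x)^-1, where C runs over all the letters and
   D_i over those smaller than i; D_i commutes with A_j for j > i. *)
Lemma finite_factor b b' (n j : nat) : (forall i, qplus (b i) (b' i) = 0) -> (j <= n)%N ->
  EB b (ST (1 - j%:Z) (n + j)) =
  EB b (RT (- n%:Z) (n + n.+1) (zint (1 - j%:Z) j)) * MM b' n j * EB b (ST 1 n).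
Proof.
move=> bb; elim: j => [|j IH] jn; first by rewrite subr0 addn0 EB_nil !mul1r.
have jn' : (j <= n)%N by lia.
have -> : zint (1 - j.+1%:Z) j.+1 = - j%:Z :: zint (1 - j%:Z) j.
  rewrite /zint /= addr0 -[1%N]addn0 iotaDl -map_comp; congr (_ :: _); first by lia.
  by apply: eq_map => i /=; lia.
rewrite (_ : 1 - j.+1%:Z = - j%:Z); last by lia.
rewrite addnS EB_ST (_ : - j%:Z + 1 = 1 - j%:Z); last by lia.
set U := EE [seq (c, b' (- j%:Z)) | c <- up (- n%:Z) (n - j)].
have -> : AA (- j%:Z) (n + j).+1 (b (- j%:Z)) = AA (- n%:Z) (n + n.+1) (b (- j%:Z)) * U.
  rewrite (_ : - j%:Z = - n%:Z + (n - j)%:Z); last by lia.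
  rewrite (AA_split _ _ _ (bb _)) (_ : - n%:Z + (n - j)%:Z = - j%:Z); last by lia.
  by congr (AA _ _ _ * _); lia.
(* The letters of [U] are below -j and those of the staircase are at least 1 - j, so they differ by
   at least two. *)
have cU k (p : int) : 1 - j%:Z <= p -> U * EB b (ST p k) = EB b (ST p k) * U.
  move=> pj; apply: EE_comm => _ _ /mapP[c + ->] /mapP[[a i] + ->] /=.
  by rewrite mem_up mem_ST /=; lia.
rewrite -mulrA cU // IH // [RT _ _ _]/= EB_cat -/(RT (- n%:Z) (n + n.+1) (zint (1 - j%:Z) j)) EB_row.
rewrite [MM _ _ j.+1]/= -/U -!mulrA -(cU n 1) //; lia.
Qed.

End Factor.

(** * Coefficientwise limits *)

Definition hconv (K : choiceType) (F : nat -> halg (series K)) (f : halg (series K)) : Prop :=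
  forall w m, exists n0 : nat, forall n, (n0 <= n)%N -> F n w m = f w m.

Lemma eventually_all (T : eqType) (r : seq T) (P : T -> nat -> Prop) :
  (forall x, x \in r -> exists n0 : nat, forall n, (n0 <= n)%N -> P x n) ->
  exists n0 : nat, forall n, (n0 <= n)%N -> forall x, x \in r -> P x n.
Proof.
elim: r => [|x r IH] h; first by exists 0%N.
have [n1 h1] := IH (fun y yr => h y (mem_behead (s := x :: r) yr)).
have [n2 h2] := h x (mem_head x r).
exists (maxn n1 n2) => n nn y; rewrite inE => /orP[/eqP->|yr].
  by apply: h2; lia.
by apply: h1 => //; lia.
Qed.

Section Limits.
Variable K : choiceType.
Implicit Types (F G : nat -> halg (series K)) (f g : halg (series K)).

(** A coefficient of the product involves only finitely many coefficients of the factors, as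
    [hdec w] and [decomp m] are finite. *)
Lemma hconv_mul F G f g : hconv F f -> hconv G g -> hconv (fun n => F n * G n) (f * g).
Proof.
move=> Ff Gg w m.
have [n0 h] : exists n0 : nat, forall n, (n0 <= n)%N ->
    forall p, p \in (fset_set (hdec w) : seq _) ->
    forall q, q \in (fset_set (decomp m) : seq _) ->
    F n p.1 q.1 = f p.1 q.1 /\ G n p.2 q.2 = g p.2 q.2.
  apply: eventually_all => p _; apply: eventually_all => q _.
  have [n1 h1] := Ff p.1 q.1; have [n2 h2] := Gg p.2 q.2.
  exists (maxn n1 n2) => n nn; split; first by apply: h1; lia.
  by apply: h2; lia.
exists n0 => n nn; rewrite !halgME !ser_sumE big_seq [RHS]big_seq; apply: eq_bigr => p pw.
rewrite -[LHS]/(series_mul _ _ m) -[RHS]/(series_mul _ _ m) !series_mulE.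
rewrite big_seq [RHS]big_seq; apply: eq_bigr => q qm.
by have [-> ->] := h n nn p pw q qm.
Qed.

Lemma hconv_unique F G f g : (forall n, F n = G n) -> hconv F f -> hconv G g -> f = g.
Proof.
move=> FG Ff Gg; apply/funext => w; apply/funext => m.
have [n1 h1] := Ff w m; have [n2 h2] := Gg w m.
by rewrite -(h1 (maxn n1 n2)) -?(h2 (maxn n1 n2)) ?FG //; lia.
Qed.

End Limits.

(** * Grothendieck polynomials *)

Section Swap.
Variable A : comNzRingType.
Implicit Types (b : int -> A).

Lemma ST_split p j r : exists2 pre, ST p (j + r) = pre ++ ST (p + j%:Z) r &
  {in pre, forall q : int * int, q.2 < p + j%:Z}.
Proof.
elim: j p => [|j IH] p; first by exists [::]; rewrite ?addr0.
have [pre E h] := IH (p + 1).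
exists (brow p (j + r).+1 p ++ pre).
  rewrite [LHS]/= -/(brow p (j + r).+1 p) E catA; congr (_ ++ ST _ _); lia.
by case=> a i; rewrite mem_cat mem_row => /orP[/=|/h /=]; lia.
Qed.

Lemma eq_EB b b' l : {in l, forall q, b q.2 = b' q.2} -> EB b l = EB b' l.
Proof.
move=> h; rewrite /EB; congr EE; apply/eq_in_map => q ql.
by rewrite h.
Qed.

(** Only rows i and i + 1 involve the two variables. [hh_AA_swap] exchanges them at the cost of one
    factor, which commutes with the later rows because their letters are at least i + 2. *)
Lemma EB_swap b (i : int) k x' : qplus (b i) x' = 0 -> 1 <= i <= k%:Z ->
  EB (b \o sfun i) (ST 1 k) = EB b (ST 1 k) * hh i (qplus (b (i + 1)) x').
Proof.
move=> bx ik.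
pose j := absz (i - 1); pose r := (k - j.+1)%N.
have [pre E h] := ST_split 1 j r.+1.
rewrite (_ : (j + r.+1)%N = k) in E; last by lia.
rewrite (_ : 1 + j%:Z = i) in E h; last by lia.
(* For r = 0 the last two blocks are empty, which makes the truncated predecessor harmless. *)
have E2 : ST i r.+1 = brow i r.+1 i ++ brow (i + 1) r (i + 1) ++ ST (i + 1 + 1) r.-1.
  by case: (r) => [|r']; rewrite //= cats0.
rewrite E E2 !EB_cat !EB_row /= !sfun_mv.
rewrite (eq_EB (b := b \o sfun i) (b' := b)); last first.
  by case=> a c /h /= ci; rewrite sfun_id //; lia.
rewrite (eq_EB (b := b \o sfun i) (b' := b)); last first.
  by case=> a c; rewrite mem_ST /= => ci; rewrite sfun_id //; lia.
rewrite -!mulrA -hh_EE_comm; last first.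
  by move=> _ /mapP[[a c] + ->] /=; rewrite mem_ST /=; lia.
by rewrite !mulrA -(mulrA (EB b pre)) (hh_AA_swap _ _ _ bx) !mulrA.
Qed.

(** If v has a right descent at i, then u * s_i = v has exactly the two solutions u = v and u = v
    s_i. *)
Lemma mul_hmon_s (f : halg A) z (v : SZ) (i : int) : v (i + 1) < v i ->
  (f * hmon z (s i)) v = z * (f v + f (v * s i)%g).
Proof.
move=> vi; have e1 : hecke v (s i) = v by rewrite hecke_rs /hecke_r ifF //; lia.
have vsi : (v * s i)%g i < (v * s i)%g (i + 1) by rewrite !SZmulE /= !sfun_mv.
have e2 : hecke (v * s i)%g (s i) = v by rewrite hecke_rs /hecke_r vsi -mulgA ss mulg1.
rewrite -[LHS]/(hmul f _ v) /hmul (fsbigE [:: (v, s i); ((v * s i)%g, s i)]).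
- rewrite !big_cons big_nil !ifT ?inE //= /hmon eqxx mulr1n addr0.
  by rewrite mulrDr !(mulrC z).
- rewrite /= inE andbT; apply/eqP => /(congr1 fst) /= e.
  by rewrite -e in vsi; lia.
- by move=> p /=; rewrite !inE => /orP[] /eqP->.
move=> [u u'] /= uv; rewrite !inE !xpair_eqE negb_or /hmon.
case: (eqVneq (s i) u') => [e|_] in uv *; last by rewrite mulr0.
rewrite !andbT => /andP[/eqP uv1 /eqP uv2]; exfalso.
move: uv uv1 uv2; rewrite /hdec /= -e hecke_rs /hecke_r; case: ifP => _ <- //.
by rewrite -mulgA ss mulg1.
Qed.

(** The formal difference of y and x is (y - x)/(1 - x). Clearing its denominator brings the factor
    1 - x_i into the recursion. *)
Lemma qplus_sub x y (x' : A) : qplus x x' = 0 -> (1 - x) * qplus y x' = y - x.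
Proof.
move=> xx; have e : (1 - x) * (1 - x') = 1.
  by move/eqP: xx; rewrite qplusE subr_eq0 => /eqP.
rewrite [qplus y _]qplusE mulrBr mulr1 mulrCA e mulr1 opprB addrC.
by rewrite addrA subrK.
Qed.

Lemma recursion_algebra (x y p q : A) :
  (1 - y) * p - ((1 - x) * p - (y - x) * (p + q)) = - ((x - y) * q).
Proof.
have -> : (1 - y) * p = (1 - x) * p - (y - x) * p.
  by rewrite -mulrBl opprB addrA subrK.
by rewrite opprB mulrDr addrA subrKA addrAC subrr add0r -mulNr opprB.
Qed.

Lemma EB_recursion b (i : int) k x' (w : SZ) : qplus (b i) x' = 0 -> 1 <= i <= k%:Z ->
  w i < w (i + 1) ->
  (1 - b (i + 1)) * EB b (ST 1 k) (w * s i)%g -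
    (1 - b i) * EB (b \o sfun i) (ST 1 k) (w * s i)%g =
  - ((b i - b (i + 1)) * EB b (ST 1 k) w).
Proof.
move=> bx ik wi.
have vi : (w * s i)%g (i + 1) < (w * s i)%g i by rewrite !SZmulE /= !sfun_mv.
rewrite (EB_swap bx ik) /hh mulrBr mulr1 halgDE halgNE mul_hmon_s //.
rewrite mulrBr mulrA (qplus_sub _ bx) -mulgA ss mulg1.
exact: recursion_algebra.
Qed.

Lemma sign_algebra (e x y p q r : A) : (1 - y) * p - (1 - x) * q = - ((x - y) * r) ->
  (x - y) * (e * r) = (1 - y) * (-1 * e * p) - (1 - x) * (-1 * e * q).
Proof.
move=> h; rewrite mulrCA [(1 - y) * _]mulrCA [(1 - x) * _]mulrCA -mulrBr h.
by rewrite mulN1r mulNr mulrN opprK.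
Qed.

End Swap.

(** If X_i g = X_j g, the coefficient of g at m equals the one at m x_i / x_j, and is 0 when x_j
    does not divide m; this allows induction on the exponent of x_j. *)
Lemma nonzerodivisor (K : choiceType) (i j : K) (g : series K) : i != j ->
  (X i - X j) * g = 0 -> g = 0.
Proof.
move=> ij h; have {}h : X i * g = X j * g.
  by apply/eqP; rewrite -subr_eq0 -mulrBl h.
have step m : g m = (X j * g) (i +` m)%mset.
  by rewrite -h XE mon_mulE.
suff H (k : nat) (m : {mset K}%mset) : m j = k -> g m = 0 by apply/funext => m; exact: (H (m j)).
elim: k m => [|k IH] m mj.
  rewrite step XE; apply: mon_mul0 => m'' /msetP/(_ j).
  by rewrite !mset1DE mj eqxx eq_sym (negbTE ij).
have jm : j \in m by rewrite in_mset mj.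
rewrite step XE -(msetB1K jm) msetDCA mon_mulE; apply: IH.
by rewrite mset1DE msetB1E mj eqxx eq_sym (negbTE ij) add0n subn1.
Qed.

Lemma tpi_unique (i : int) (f g : series int) :
  (X i - X (i + 1)) * g = (1 - X (i + 1)) * f - (1 - X i) * swap i f -> tpi i f = g.
Proof.
rewrite /tpi; move: ((1 - X (i + 1)) * f - (1 - X i) * swap i f) => c e.
apply: xget_unique => // g' /= e'; apply/eqP; rewrite -subr_eq0; apply/eqP.
apply: (@nonzerodivisor _ i (i + 1)); first by apply/eqP; lia.
by move: (X i - X (i + 1)) e e' => d e e'; rewrite mulrBr e' e subrr.
Qed.

Lemma tpi_EX (i : int) k (w : SZ) : 1 <= i <= k%:Z -> w i < w (i + 1) ->
  tpi i ((-1) ^+ len (w * s i)%g * EX (ST 1 k) (w * s i)%g) = (-1) ^+ len w * EX (ST 1 k) w.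
Proof.
move=> ik wi; apply: tpi_unique.
have sinj : injective (s i) by exact: SZ_inj.
rewrite /swap (ren_sign sinj) subst_EX len_mulr wi exprS; apply: sign_algebra.
exact: (EB_recursion (qplus_ominus i) ik wi).
Qed.

(** * The longest element and the recursion from it *)

Lemma wprod_dn (p : int) k (j : int) : wprod (dn p k) j =
  if j == p then p + k%:Z else if p < j <= p + k%:Z then j - 1 else j.
Proof.
elim: k p j => [|k IH] p j.
  rewrite /wprod big_nil SZ1E; case: eqP => [->|]; first by rewrite addr0.
  by case: ifP => //; lia.
rewrite [dn _ _]/= wprod_rcons SZmulE IH /=.
case: (sfunP p j) => [[-> ->]|[-> ->]|[h1 h2 ->]].
- by rewrite eqxx eqxx; lia.
- by repeat (case: eqP => ?); repeat case: ifP => ?; lia.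
by repeat (case: eqP => ?); repeat case: ifP => ?; lia.
Qed.

(** Each row is a cycle, and their product is the reversal of the interval from p to p + k, that is,
    w_0. *)
Lemma wprod_ST (p : int) k (j : int) : wprod (fsts (ST p k)) j =
  if p <= j <= p + k%:Z then p + p + k%:Z - j else j.
Proof.
elim: k p j => [|k IH] p j; first by rewrite /wprod big_nil SZ1E; case: ifP => //; lia.
rewrite [ST _ _]/= /fsts map_cat -/(brow p k.+1 p) wprod_cat SZmulE -/(fsts _) IH.
have -> : fsts (brow p k.+1 p) = dn p k.+1 by rewrite /fsts /brow -map_comp map_id.
case: ifP => ?; rewrite wprod_dn; (case: eqP => ?; [|case: ifP => ?]); case: ifP => ?; lia.
Qed.

Lemma ST_uniq p k : uniq (ST p k).
Proof. exact: sorted_uniq ltw_trans ltw_irr _ (ST_sorted p k). Qed.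

Lemma invs_ST p k : invs (wprod (fsts (ST p k))) =
  [set` [fset (q.2, (q.1 + 1)%R) | q in ST p k]%fset].
Proof.
apply/seteqP; split => [[i j]|[i j]].
  rewrite /invs /= !wprod_ST => -[ij h]; apply/imfsetP; exists (j - 1, i) => /=.
    by rewrite mem_ST /=; move: h; repeat case: ifP => ?; lia.
  by rewrite subrK.
case/imfsetP => -[a c] /=; rewrite mem_ST /= => h [-> ->]; rewrite /invs /= !wprod_ST.
by repeat case: ifP => ?; lia.
Qed.

(** The cells (a, i) of the staircase correspond to the inversions (i, a + 1) of the reversal, so
    the staircase word is reduced. *)
Lemma len_ST p k : len (wprod (fsts (ST p k))) = size (ST p k).
Proof.
rewrite lenE /ninv invs_ST set_fsetK card_imfset /=; last by move=> [a i] [c j] /= [-> h]; congr (_, _); lia.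
by rewrite undup_id // ST_uniq.
Qed.

Lemma Sn_range n w (i : int) : Sn n w -> 1 <= i <= n%:Z -> 1 <= w i <= n%:Z.
Proof.
move=> wn ik; apply: contraT => h.
by have /SZ_inj e := wn _ h; move: h; rewrite e ik.
Qed.

Lemma Sn_mulr n w (i : int) : Sn n w -> 0 < i < n%:Z -> Sn n (w * s i)%g.
Proof. by move=> wn ik j hj; rewrite SZmulE /= sfun_id ?wn //; lia. Qed.

Lemma Sn_decreasing k w : Sn k.+1 w -> (forall i : int, 1 <= i <= k%:Z -> w (i + 1) < w i) ->
  w = wprod (fsts (ST 1 k)).
Proof.
move=> wn dec.
have up (j : nat) : (j <= k)%N -> w (1 + j%:Z) <= k.+1%:Z - j%:Z.
  elim: j => [|j IH] jk; first by have := Sn_range wn (i := 1 + 0%:Z); lia.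
  have := dec (1 + j%:Z); rewrite (_ : 1 + j%:Z + 1 = 1 + j.+1%:Z); last by lia.
  by have := IH; lia.
have dn' (j : nat) : (j <= k)%N -> 1 + j%:Z <= w (k.+1%:Z - j%:Z).
  elim: j => [|j IH] jk; first by have := Sn_range wn (i := k.+1%:Z - 0%:Z); lia.
  have := dec (k.+1%:Z - j.+1%:Z); rewrite (_ : k.+1%:Z - j.+1%:Z + 1 = k.+1%:Z - j%:Z); last by lia.
  by have := IH; lia.
apply: SZP => i; rewrite wprod_ST; case: ifP => ik; last by apply: wn; lia.
have := up (absz (i - 1)); have := dn' (absz (k.+1%:Z - i)).
rewrite (_ : 1 + (absz (i - 1)%R)%:Z = i); last by lia.
by rewrite (_ : k.+1%:Z - (absz (k.+1%:Z - i)%R)%:Z = i); lia.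
Qed.

Lemma len_Sn_max k w : Sn k.+1 w -> (len w <= size (ST 1%R k))%N.
Proof.
move=> wn; rewrite -len_ST !lenE /ninv; apply: fsubset_leq_card.
rewrite -fset_set_sub; [|exact: invs_finite|exact: invs_finite].
move=> [i j] [/= ij wij]; rewrite /invs /= !wprod_ST.
have hi := wn i; have hj := wn j; have ri := Sn_range wn (i := i); have rj := Sn_range wn (i := j).
by repeat case: ifP => ?; lia.
Qed.

Lemma prod_ST (A : comNzRingType) (F : int -> A) (p : int) k :
  \prod_(q <- ST p k) F q.2 = \prod_(0 <= j < k) F (p + j%:Z) ^+ (k - j).
Proof.
elim: k p => [|k IH] p; first by rewrite big_nil big_geq.
rewrite [ST _ _]/= big_cat -/(brow p k.+1 p) IH big_nat_recl // addr0 subn0; congr (_ * _).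
  rewrite /brow big_map /= (eq_bigr (fun=> F p)) // big_const_seq count_predT.
  have -> : size (dn p k.+1) = k.+1.
    by elim: (k.+1) p => //= k' IHk p'; rewrite size_rcons IHk.
  by elim: (k.+1) => //= k' ->; rewrite exprS.
by apply: eq_bigr => j _; congr (F _ ^+ _); lia.
Qed.

(** A Hecke word for w_0 needs as many letters as the whole staircase has, so no proper subword
    contributes. *)
Lemma EX_longest k : EX (ST 1 k) (wprod (fsts (ST 1 k))) =
  (-1) ^+ size (ST 1%R k) * \prod_(1 <= i < k.+1) X i%:Z ^+ (k.+1 - i).
Proof.
set l := ST 1 k; have hl : hword (fsts l) = wprod (fsts l).
  by apply: hecke_reduced_l; rewrite len_ST size_map.
rewrite /EX EB_expand big_seq_cond.
rewrite (eq_bigl (fun t => (t \in subs l) && (t == l))); last first.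
  move=> t; rewrite mem_subs; case tl: (subseq t l) => //=.
  apply/eqP/eqP => [tw|->//].
  have [st e] := size_subseq_leqif tl; apply/eqP; rewrite -e eqn_leq st -(len_ST 1 k) -tw.
  by rewrite -(size_map fst t) len_hword.
rewrite -big_seq_cond -big_filter filter_pred1_uniq ?mem_subs ?subs_uniq ?ST_uniq // big_seq1.
by congr (_ * _); rewrite (prod_ST (fun i => X i)) big_add1; apply: eq_bigr => j _; congr (X _ ^+ _); lia.
Qed.

(** The sign undoes the rescaling of T_w. The index k counts simple transpositions, so k = n - 1 for
    S_n. *)
Definition gpoly (k : nat) (w : SZ) : series int := (-1) ^+ len w * EX (ST 1 k) w.

Lemma gpoly_longest k : gpoly k (wprod (fsts (ST 1 k))) =
  \prod_(1 <= i < k.+1) X i%:Z ^+ (k.+1 - i).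
Proof. by rewrite /gpoly EX_longest len_ST mulrA -expr2 sqrr_sign mul1r. Qed.

Lemma Sn0 w : Sn 0 w -> w = 1%g.
Proof. by move=> wn; apply: SZP => i; rewrite SZ1E wn //; lia. Qed.

Lemma Sn_S n w : Sn n w -> Sn n.-1.+1 w.
Proof. by case: n => [|n] // wn i _; apply: wn; lia. Qed.

(** The relation allows many chains of ascents from w to w_0. They all give the same polynomial
    because each step computes a coefficient of one fixed product, by [tpi_EX]. *)
Lemma groth_relP n w f : groth_rel n w f -> Sn n w /\ f = gpoly n.-1 w.
Proof.
elim=> {w f} [w wn wmax|w i f ik wi _ [wn ->]].
  split=> //; case: n => [|k] in wn wmax *.
    rewrite (Sn0 wn); have <- : wprod (fsts (ST 1 0)) = 1%g by rewrite /wprod big_nil.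
    by rewrite gpoly_longest !big_geq.
  rewrite -gpoly_longest; congr gpoly; apply/esym/Sn_decreasing => // i ik.
  have := s_neq w i; rewrite neq_lt => /orP[h|//].
  have /wmax : Sn k.+1 (w * s i)%g by apply: Sn_mulr => //; lia.
  by rewrite len_mulr h ltnn.
rewrite len_mulr_lt in wi; split.
  by rewrite -[w]mulg1 -(ss i) mulgA; exact: Sn_mulr.
by rewrite /gpoly tpi_EX //; lia.
Qed.

Lemma groth_rel_exists k w : Sn k.+1 w -> exists f, groth_rel k.+1 w f.
Proof.
elim: {w}(size (ST 1%R k) - len w)%N {-2}w (erefl (size (ST 1%R k) - len w)%N) => [|d IH] w dE wn.
all: have [dec|] := pselect (forall i : int, 1 <= i <= k%:Z -> w (i + 1) < w i).
1,3: exists (\prod_(1 <= i < k.+1) X i%:Z ^+ (k.+1 - i)); apply: groth_longest => // v vn;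
  by rewrite (Sn_decreasing wn dec) len_ST; exact: len_Sn_max.
all: move=> /existsNP[i /not_implyP[ik /negP wi]].
all: have {}wi : w i < w (i + 1) by have := s_neq w i; lia.
all: have wn' : Sn k.+1 (w * s i)%g by apply: Sn_mulr => //; lia.
all: have := len_Sn_max wn'; rewrite len_mulr wi => lw.
  by lia.
have [|f hf] := IH (w * s i)%g _ wn'; first by rewrite len_mulr wi; lia.
exists (tpi i f); apply: groth_step hf; first by lia.
by rewrite len_mulr wi.
Qed.

Lemma Sn_letter n w a : Sn n w -> letter w a -> 0 < a < n%:Z.
Proof.
move=> wn [i ia ai]; have := wn i; have h := wn (w i).
have [i1|i1] := boolP (1 <= i <= n%:Z); last by move=> /(_ isT); lia.
by have := Sn_range wn i1; lia.
Qed.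

Lemma gpoly_stable k k' w : (forall a, letter w a -> 0 < a <= k%:Z) ->
  (forall a, letter w a -> 0 < a <= k'%:Z) -> gpoly k w = gpoly k' w.
Proof.
move=> h h'; congr (_ * _); apply: EB_eq; [exact: ST_sorted|exact: ST_sorted|].
by move=> [a i] /= wa; rewrite !mem_ST /=; have := h _ wa; have := h' _ wa; lia.
Qed.

Lemma grothPE n w : Sn n w -> grothP w = gpoly n.-1 w.
Proof.
move=> wn; rewrite /grothP.
have [f hf] := groth_rel_exists (Sn_S wn).
apply: xget_unique.
  by exists n.-1.+1; have [_ <-] := groth_relP hf.
move=> g [n' /groth_relP[wn' ->]]; apply: gpoly_stable => a.
  by move/(Sn_letter wn'); lia.
by move/(Sn_letter wn); lia.
Qed.

(** * Parabolic subgroups *)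

Lemma ser_sign (K : choiceType) n (f : series K) m : ((-1) ^+ n * f) m = (-1) ^+ n * f m.
Proof.
rewrite -[(-1) ^+ n in LHS]signr_odd -[(-1) ^+ n in RHS]signr_odd.
by case: (odd n); rewrite ?expr0 ?expr1 ?mul1r // !mulN1r.
Qed.

Lemma wprod_fix (a : seq int) (i : int) :
  (forall c, c \in a -> (i != c) && (i != c + 1)) -> wprod a i = i.
Proof.
elim: a => [|c a IH] h; first by rewrite /wprod big_nil.
rewrite wprod_cons SZmulE IH; last by move=> d da; apply: h; rewrite inE da orbT.
by have /andP[h1 h2] := h c (mem_head c a); rewrite /= sfun_id.
Qed.

Lemma SminusP w : Sminus w <-> forall a, letter w a -> a < 0.
Proof.
split=> [[a ha ->] b|h].
  case=> i ib; apply: contraTT; rewrite -leNgt => b0.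
  have [ip|ip] := ltP 0 i.
    by rewrite wprod_fix; [lia|move=> c /ha /= c0; lia].
  have [wi|wi] := leP (wprod a i) 0; first by lia.
  have : wprod a (wprod a i) = wprod a i by rewrite wprod_fix // => c /ha /= c0; lia.
  by move/SZ_inj => e; lia.
exists (reduced_word w); last by case: (reduced_wordP w).
by move=> a /letter_reduced /h.
Qed.

Lemma SplusP w : Splus w <-> forall a, letter w a -> 0 < a.
Proof.
split=> [[a ha ->] b|h].
  case=> i ib; apply: contraTT; rewrite -leNgt => b0.
  by rewrite wprod_fix // => [|c /ha /= c0]; lia.
exists (reduced_word w); last by case: (reduced_wordP w).
by move=> a /letter_reduced /h.
Qed.

Lemma Sminus_fix w (i : int) : Sminus w -> 0 < i -> w i = i.
Proof. by case=> a ha -> i0; apply: wprod_fix => c /ha /= c0; lia. Qed.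

Lemma Splus_fix w (i : int) : Splus w -> i <= 0 -> w i = i.
Proof. by case=> a ha -> i0; apply: wprod_fix => c /ha /= c0; lia. Qed.

Lemma Sminus_nonpos w (i : int) : Sminus w -> (w i <= 0) = (i <= 0).
Proof.
move=> /SminusP h; apply: letterN => /h; lia.
Qed.

Lemma fix_Sminus (w : SZ) : (forall i : int, 0 < i -> w i = i) -> Sminus w.
Proof.
move=> h; apply/SminusP => a [i ia ai]; rewrite ltNge; apply/negP => a0.
have /SZ_inj e : w (w i) = w i by apply: h; lia.
by lia.
Qed.

Lemma fix_Splus (w : SZ) : (forall i : int, i <= 0 -> w i = i) -> Splus w.
Proof.
move=> h; apply/SplusP => a [i ia ai]; rewrite ltNge; apply/negP => a0.
by have := h i; lia.
Qed.

(** For c < 0 both c and c + 1 are nonpositive. There v is the identity and x^-1 stays among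
    nonpositive integers, so s_c is a left ascent of x v exactly when it is one of x. *)
Lemma hecke_s_mulr (c : int) (x v : SZ) : c < 0 -> Sminus x -> Splus v ->
  hecke_s c (x * v)%g = (hecke_s c x * v)%g.
Proof.
move=> c0 xm vp; rewrite !hecke_sE invgM !SZmulE.
have fixV (i : int) : i <= 0 -> (v^-1)%g ((x^-1)%g i) = (x^-1)%g i.
  move=> i0; apply: (@SZ_inj v); rewrite SZKV (Splus_fix vp) //.
  by rewrite -(Sminus_nonpos _ xm) SZKV.
by rewrite !fixV; [case: ifP; rewrite ?mulgA|lia|lia].
Qed.

Lemma hword_Sminus (a : seq int) : {in a, forall c : int, c < 0} -> Sminus (hword a).
Proof. by move=> h; apply/SminusP => c /letter_hword /h. Qed.

Lemma hecke_Sne0 u v : Sminus u -> Splus v -> hecke u v = (u * v)%g.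
Proof.
move=> um vp; rewrite /hecke -{2}(hword_reduced u).
have : {in reduced_word u, forall c : int, c < 0}.
  by move=> c /letter_reduced; move/SminusP: um; apply.
elim: (reduced_word u) => [|c a IH] h /=; first by rewrite mul1g.
have ha : {in a, forall c : int, c < 0} by move=> d da; apply: h; rewrite inE da orbT.
rewrite IH // hecke_s_mulr //; first by apply: h; exact: mem_head.
exact: hword_Sminus.
Qed.

Lemma Sne0_unique u v u' v' : Sminus u -> Splus v -> Sminus u' -> Splus v' ->
  (u * v = u' * v')%g -> u = u' /\ v = v'.
Proof.
move=> um vp um' vp' e; have eu : u = u'.
  apply: SZP => i; have [i0|i0] := leP i 0; last by rewrite !Sminus_fix.
  have := congr1 (fun x : SZ => x i) e.
  by rewrite !SZmulE (Splus_fix vp i0) (Splus_fix vp' i0).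
by split=> //; move: e; rewrite eu => /mulgI.
Qed.

Lemma sgn_mulr (R : nzRingType) (w : SZ) a : (-1) ^+ len (w * s a)%g = - (-1) ^+ len w :> R.
Proof.
have := s_neq w a; rewrite neq_lt len_mulr => /orP[wa|wa].
  by rewrite wa exprS mulN1r.
rewrite lt_gtF // !lenE (ninv_mulr_desc wa) -pred_Sn exprS mulN1r opprK //.
Qed.

Lemma sgn_mul (R : nzRingType) (u v : SZ) :
  (-1) ^+ len (u * v)%g = (-1) ^+ len u * (-1) ^+ len v :> R.
Proof.
have [<- _] := reduced_wordP v.
elim/last_ind: (reduced_word v) => [|b a IH].
  by rewrite /wprod big_nil mulg1 lenE lenE ninv1 mulr1.
by rewrite wprod_rcons mulgA !sgn_mulr IH mulrN.
Qed.

(** The truncated subtraction is exact by [len_hecke]. The splitting turns signed sums over u * v =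
    w into products in [halg]. *)
Lemma sgn_sub (R : nzRingType) (u v : SZ) : (-1) ^+ (len u + len v - len (hecke u v)) =
  (-1) ^+ len u * (-1) ^+ len v * (-1) ^+ len (hecke u v) :> R.
Proof.
have h := len_hecke u v; rewrite -exprD -[in RHS](subnK h) exprD -mulrA -expr2 sqrr_sign mulr1 //.
Qed.

(** * K-Stanley functions and back stable limits *)

Lemma mset_bound (m : {mset int}%mset) : exists M : nat, forall i, i \in m -> (`|i| <= M)%N.
Proof.
exists (\max_(i <- m) `|i|%N) => i im.
by rewrite (big_rem i im) /= leq_maxl.
Qed.

Lemma letters_bound (w : SZ) : exists N : nat, forall a, letter w a -> (`|a| <= N)%N.
Proof.
have [N wN] := SZ_bound w; exists N => a /(letter_bound wN); lia.
Qed.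

Definition Fhat : halg (series int) := fun w => (-1) ^+ len w * kstanley w.
Definition Bhat : halg (series int) := fun w => (-1) ^+ len w * bsgroth w.

(** The condition on neighbours in a compatible pair is strict increase in the reading order, so G_u
    sums over subwords of the infinite word of ... C(x_(-1)) C(x_0). *)
Lemma compatible_sorted (a i : seq int) : compatible a i <->
  [/\ size a = size i, {in i, forall x : int, x <= 0} & sorted ltw (zip a i)].
Proof.
have nz k : size a = size i -> nth (0, 0) (zip a i) k = (a`_k, i`_k).
  by move=> e; rewrite nth_zip.
split=> [[e h1 h2 h3]|[e h1 /(sortedP (0, 0))]].
  split=> //; first by move=> x xi; rewrite -(nth_index 0 xi) h1 ?index_mem.
  apply/(sortedP (0, 0)) => k; rewrite size_zip e minnn !nz // /ltw /= => ki.
  have [xy|xy] := leP (a`_k) (a`_k.+1); first by rewrite h3.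
  by have := h2 k ki; rewrite le_eqVlt => /orP[->|->] //; rewrite orbT.
rewrite size_zip e minnn => h; split=> // k ki.
- by apply: h1; rewrite mem_nth.
- by have := h k ki; rewrite !nz // /ltw /=; lia.
by have := h k ki; rewrite !nz // /ltw /=; lia.
Qed.

(** For fixed w and m, the contributing compatible sequences are subwords of any finite sorted word
    that has the right entries at the letters of w and the variables of m. *)
Lemma kstanley_coef (l : seq (int * int)) w m : sorted ltw l ->
  (forall q : int * int, letter w q.1 -> q.2 \in m -> (q \in l) = (q.2 <= 0)) ->
  Fhat w m = EX l w m.
Proof.
move=> sl hl; have ul : uniq l := sorted_uniq ltw_trans ltw_irr sl.
rewrite /Fhat ser_sign /kstanley /ssum EX_coef.
pose P (t : seq (int * int)) := (hword (fsts t) == w) && (seq_mset (snds t) == m).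
pose f (t : seq (int * int)) := (fsts t, snds t).
have fI : injective f.
  by move=> t t' [e1 e2]; rewrite -(zip_unzip t) -(zip_unzip t') /unzip1 /unzip2 -/(fsts t) -/(snds t) e1 e2.
have cpt t : subseq t l -> hword (fsts t) = w -> seq_mset (snds t) = m ->
    compatible (fsts t) (snds t).
  move=> tl tw tm; apply/compatible_sorted; split.
  - by rewrite !size_map.
  - move=> x /mapP[q qt ->]; rewrite -hl ?(mem_subseq tl) //.
      by rewrite -tw; apply/letter_hword; exact: map_f.
    by rewrite -tm (perm_mem (perm_eq_seq_mset _)); exact: map_f.
  by rewrite -/(unzip1 t) -/(unzip2 t) zip_unzip; exact: subseq_sorted ltw_trans _ _ tl sl.
rewrite (fsbigE (map f (seq.filter P (subs l)))).
- rewrite big_map big_filter_cond mulr_sumr.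
  rewrite big_mkcond [RHS]big_mkcond /=; apply: eq_big_seq => t.
  rewrite mem_subs /P => tl; case: eqP => [tw|_] //; case: eqP => [tm|_] //=.
  rewrite ifT; last by rewrite inE /= foldr_heckeE; split=> //; exact: cpt.
  rewrite ser_sign prodXE /mon tm eqxx mulr1 /fsts size_map -/(fsts t).
  have st : (len w <= size t)%N by rewrite -tw (leq_trans (len_hword _)) // size_map.
  by rewrite -exprD subnKC.
- by rewrite map_inj_uniq // filter_uniq // subs_uniq.
- move=> _ /= /mapP[t + ->]; rewrite mem_filter mem_subs => /andP[/andP[/eqP tw /eqP tm] tl].
  by rewrite foldr_heckeE; split=> //; exact: cpt.
move=> [a i] /= [aw /compatible_sorted[e i0 si]] ni.
rewrite ser_sign prodXE /mon; case: eqP => [im|_]; last by rewrite mulr0.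
have e1 : fsts (zip a i) = a by rewrite /fsts -/(unzip1 _) unzip1_zip // e.
have e2 : snds (zip a i) = i by rewrite /snds -/(unzip2 _) unzip2_zip // e.
case/negP: ni; apply/mapP; exists (zip a i); last by rewrite /f e1 e2.
rewrite foldr_heckeE in aw.
rewrite mem_filter /P e1 e2 aw im !eqxx mem_subs /=.
(* A sorted list with all entries in [l] is the part of [l] that it selects, hence a subword. *)
suff -> : zip a i = seq.filter (mem (zip a i)) l by exact: filter_subseq.
apply: (irr_sorted_eq ltw_trans ltw_irr si).
  exact: sorted_filter ltw_trans _ _ sl.
move=> q; rewrite mem_filter /=; case qz: (q \in zip a i) => //=.
have q1 : q.1 \in a by rewrite -e1; exact: map_f.
have q2 : q.2 \in i by rewrite -{1}e2; exact: map_f.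
rewrite hl ?i0 //; first by rewrite -aw; apply/letter_hword.
by rewrite im (perm_mem (perm_eq_seq_mset _)).
Qed.

(** * Relabelling by [omega] and [gamma], and the back stable limit *)

Lemma EB_theta (K : choiceType) (A : comNzRingType) (b : K -> A) (theta : SZ -> SZ)
    (f : int -> int) l w : injective theta ->
  (forall c, theta (hword c) = hword (map f c)) ->
  EB b [seq (f q.1, q.2) | q <- l] (theta w) = EB b l w.
Proof.
move=> ti th; rewrite !EB_expand.
have -> : subs [seq (f q.1, q.2) | q <- l] = map (map (fun q => (f q.1, q.2))) (subs l).
  by elim: l => [|x l IH] //=; rewrite IH map_cat -!map_comp.
rewrite big_map; apply: eq_big => [t|t _]; last by rewrite size_map big_map.
have -> : fsts (map (fun q => (f q.1, q.2)) t) = map f (fsts t) by rewrite /fsts -!map_comp.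
by rewrite -th (inj_eq ti).
Qed.

Lemma EB_map (K K' : choiceType) (A : comNzRingType) (b : K' -> A) (f : int -> int)
    (g : K -> K') l :
  EB b [seq (f q.1, g q.2) | q <- l] = EE [seq (f q.1, b (g q.2)) | q <- l].
Proof. by rewrite /EB -map_comp. Qed.

Lemma omegaK : involutive omega.
Proof. by move=> w; apply: SZP => i /=; rewrite !subKr. Qed.

Lemma len_omega w : len (omega w) = len w.
Proof. by apply: (len_theta omegaM omega_s omegaM omega_s omegaK). Qed.

Lemma omega_hword c : omega (hword c) = hword (map -%R c).
Proof. by apply: (theta_hword omegaM omega_s len_omega). Qed.

(** The inverse of [gamma], written as a conjugate by [omega] so that its behaviour on products and
    generators is inherited. *)
Definition gammaV (w : SZ) : SZ := omega (gamma (omega w)).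

Lemma gammaVE w i : gammaV w i = w (i + 1) - 1.
Proof.
rewrite /gammaV /= (_ : 1 - (1 - i - 1) = i + 1); last by lia.
by lia.
Qed.

Lemma gammaK : cancel gamma gammaV.
Proof. by move=> w; apply: SZP => i; rewrite gammaVE /= !addrK. Qed.

Lemma gammaVM : {morph gammaV : u v / (u * v)%g}.
Proof. by move=> u v; rewrite /gammaV omegaM gammaM omegaM. Qed.

Lemma gammaV_s i : gammaV (s i) = s (i - 1).
Proof. by rewrite /gammaV omega_s gamma_s omega_s; congr s; lia. Qed.

Lemma len_gamma w : len (gamma w) = len w.
Proof. exact: (len_theta gammaM gamma_s gammaVM gammaV_s gammaK). Qed.

Lemma gamma_hword c : gamma (hword c) = hword (map (fun a => a + 1) c).
Proof. by apply: (theta_hword gammaM gamma_s len_gamma). Qed.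

Lemma iter_gammaE k w i : iter k gamma w i = w (i - k%:Z) + k%:Z.
Proof.
elim: k i => [|k IH] i; first by rewrite subr0 addr0.
rewrite iterS -[LHS]/(iter k gamma w (i - 1) + 1) IH.
by rewrite (_ : i - 1 - k%:Z = i - k.+1%:Z); lia.
Qed.

Lemma len_iter_gamma k w : len (iter k gamma w) = len w.
Proof. by elim: k => // k IH; rewrite iterS len_gamma. Qed.

Lemma iter_gamma_hword k c : iter k gamma (hword c) = hword (map (fun a => a + k%:Z) c).
Proof.
elim: k => [|k IH]; first by rewrite /= map_id_in // => a _; rewrite addr0.
rewrite iterS IH gamma_hword -map_comp; congr hword; apply: eq_map => a /=; lia.
Qed.

Lemma ST_shift (c p : int) k : ST (p + c) k = [seq (q.1 + c, q.2 + c) | q <- ST p k].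
Proof.
have dns (a : int) j : dn (a + c) j = map (fun b => b + c) (dn a j).
  elim: j a => //= j IH a; rewrite map_rcons -IH; congr (rcons (dn _ _) _); lia.
elim: k p => //= k IH p; rewrite map_cat -/(brow (p + c) k.+1 (p + c)) -/(brow p k.+1 p).
rewrite -IH; congr (_ ++ ST _ _); last by lia.
by rewrite /brow dns -!map_comp.
Qed.

Lemma EB_shift (A : comNzRingType) (b : int -> A) (k : nat) (p : int) j w :
  EB (fun i : int => b (i - k%:Z)) (ST (p + k%:Z) j) (iter k gamma w) = EB b (ST p j) w.
Proof.
have iI : injective (iter k gamma) by elim: (k) => //= i IH u v /(can_inj gammaK)/IH.
rewrite ST_shift -(EB_theta b _ _ iI (iter_gamma_hword k)).
rewrite (EB_map _ (fun a => a + k%:Z) (fun a => a + k%:Z)) (EB_map _ (fun a => a + k%:Z) id).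
by congr (EE _ _); apply: eq_map => q; rewrite addrK.
Qed.

(** The shift by k > N moves w, which is supported in [-N, N], into S_(N+k), with its N + k - 1
    generators. Shifting the variables back makes the staircase start at 1 - k. *)
Lemma bsgroth_approxE (w : SZ) (N k : nat) : (forall i, (N < `|i|)%N -> w i = i) -> (N < k)%N ->
  bsgroth_approx w k = (-1) ^+ len w * EX (ST (1 - k%:Z) (N + k).-1) w.
Proof.
move=> wN Nk; have wn : Sn (N + k) (iter k gamma w).
  by move=> i h; rewrite iter_gammaE wN ?subrK //; lia.
have shI : injective (fun i : int => i - k%:Z) by move=> i j; lia.
rewrite /bsgroth_approx (grothPE wn) /gpoly (ren_sign shI) len_iter_gamma; congr (_ * _).
rewrite subst_EX (_ : ST 1 _ = ST (1 - k%:Z + k%:Z) (N + k).-1); last by rewrite subrK.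
exact: (EB_shift (fun i : int => X i)).
Qed.

Lemma bsgroth_coef (w : SZ) m (p : int) k :
  (forall q : int * int, letter w q.1 -> q.2 \in m -> (p <= q.2) && (q.1 < p + k%:Z)) ->
  Bhat w m = EX (ST p k) w m.
Proof.
move=> hp; have [N wN] := SZ_bound w; have [M mM] := mset_bound m.
rewrite /Bhat ser_sign.
suff E j : (maxn N.+1 M.+1 <= j)%N -> bsgroth_approx w j m = (-1) ^+ len w * EX (ST p k) w m.
  have -> : bsgroth w m = (-1) ^+ len w * EX (ST p k) w m.
    apply: xget_unique; first by exists (maxn N.+1 M.+1).
    move=> c [n0 h]; rewrite -(h (maxn n0 (maxn N.+1 M.+1))) ?E //; lia.
  by rewrite mulrA -expr2 sqrr_sign mul1r.
move=> jN; rewrite (bsgroth_approxE wN) ?ser_sign; last by lia.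
congr (_ * _); apply: EX_eq; [exact: ST_sorted|exact: ST_sorted|].
move=> [a i] /= wa im; rewrite !mem_ST /=.
have [i' ia ai] := wa; have := SZ_bound_stable wN (i := i'); have := wN i'.
by have := hp (a, i) wa im; have := mM _ im; rewrite /=; lia.
Qed.

(** Extension by zero outside the subgroup, where the polynomials only take default values. For
    [Nhat] the zeros encode the restriction of the second formula to v in [Sne0]. *)
Definition Mhat : halg (series int) :=
  fun u => if `[< Sminus u >] then (-1) ^+ len u * grothM u else 0.
Definition Phat : halg (series int) :=
  fun u => if `[< Splus u >] then (-1) ^+ len u * grothP u else 0.
Definition Nhat : halg (series int) :=
  fun u => if `[< Sne0 u >] then (-1) ^+ len u * groth u else 0.

Lemma sign_cancel (R : comNzRingType) n (x : R) : (-1) ^+ n * ((-1) ^+ n * x) = x.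
Proof. by rewrite mulrA -expr2 sqrr_sign mul1r. Qed.

Lemma Splus_Sn w : Splus w -> exists n, Sn n w.
Proof.
move=> wp; have [N wN] := SZ_bound w; exists N => i h.
by have [i0|i0] := leP i 0; [exact: Splus_fix|apply: wN; lia].
Qed.

Lemma Phat_conv : hconv (fun n => EX (ST 1 n)) Phat.
Proof.
move=> w m; rewrite /Phat; case: asboolP => wp.
  have [k wk] := Splus_Sn wp; exists k => n nk.
  rewrite (grothPE wk) (@gpoly_stable _ n) /gpoly ?sign_cancel // => a /(Sn_letter wk); lia.
have [a wa a0] : exists2 a, letter w a & a <= 0.
  apply: contrapT => h; apply: wp; apply/SplusP => a wa; rewrite ltNge.
  by apply/negP => a0; apply: h; exists a.
exists 0%N => n _; have -> // : EX (ST 1 n) w = 0.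
apply: (EB_notletter _ wa).
by apply/mapP => -[[c i]]; rewrite mem_ST /= => h e; lia.
Qed.

(** This holds for every f, although [subst] is not additive in general: a sign does not change
    which terms vanish. *)
Lemma subst_sign (K L : choiceType) (b : K -> series L) n f :
  subst b ((-1) ^+ n * f) = (-1) ^+ n * subst b f.
Proof.
apply/funext => m; rewrite ser_sign !substE mulr_fsumr.
by apply: eq_fsbigr => m' _; rewrite ser_sign mulrCA.
Qed.

Definition om (i : int) : series int := ominus (X i).

Definition om' (i : int) : series int := om (1 - i).

Lemma omega_Splus u : Sminus u -> Splus (omega u).
Proof.
move=> um; apply: fix_Splus => i i0; rewrite -[LHS]/(1 - u (1 - i)) (Sminus_fix um); lia.
Qed.

Lemma EE_omega k u : EE [seq (- p.1, om' p.2) | p <- ST 1 k] u =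
  EB om' (ST 1 k) (omega u).
Proof.
have E : ST 1 k = [seq (- q.1, q.2) | q <- [seq (- q.1, q.2) | q <- ST 1 k]].
  by rewrite -map_comp map_id_in // => -[a i] _ /=; rewrite opprK.
by rewrite {2}E (EB_theta _ _ _ (can_inj omegaK) omega_hword) (EB_map om' -%R id).
Qed.

Lemma grothME u n : Sn n (omega u) ->
  grothM u = (-1) ^+ len u * EB om' (ST 1 n.-1) (omega u).
Proof.
move=> un; rewrite /grothM (grothPE un) /gpoly subst_sign.
by rewrite subst_EX len_omega.
Qed.

Lemma Mhat_conv : hconv (fun n => EE [seq (- p.1, om' p.2) | p <- ST 1 n]) Mhat.
Proof.
move=> u m; rewrite /Mhat; case: asboolP => um.
  have [k uk] := Splus_Sn (omega_Splus um); exists k => n nk.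
  rewrite (grothME uk) sign_cancel EE_omega.
  have -> // : EB om' (ST 1 n) (omega u) = EB om' (ST 1 k.-1) (omega u).
  apply: EB_eq; [exact: ST_sorted|exact: ST_sorted|].
  by move=> [a i] /= /(Sn_letter uk) ua; rewrite !mem_ST /=; lia.
have [a ua a0] : exists2 a, letter u a & 0 <= a.
  apply: contrapT => h; apply: um; apply/SminusP => a wa; rewrite ltNge.
  by apply/negP => a0; apply: h; exists a.
exists 0%N => n _; rewrite -(EB_map om' -%R id).
have -> // : EB om' [seq (- p.1, p.2) | p <- ST 1 n] u = 0.
apply: (EB_notletter _ ua).
by apply/mapP => -[_ /mapP[[c i] + ->]]; rewrite mem_ST /= => h e; lia.
Qed.

Lemma groth_mul u v : Sminus u -> Splus v -> groth (u * v)%g = grothM u * grothP v.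
Proof.
move=> um vp; rewrite /groth; set P := [set _ | _].
have -> // : xget (1, 1)%g P = (u, v).
apply: xget_unique => // -[u1 v1] /= [um1 vp1 e1].
by have [-> ->] := Sne0_unique um vp um1 vp1 e1.
Qed.

(** For u in S_- and v in S_+ the Hecke product is the group product, and the factorization is
    unique, so at most one pair contributes to each coefficient. *)
Lemma Nhat_factor : Mhat * Phat = Nhat.
Proof.
apply/funext => v; rewrite /Nhat; case: asboolP => vs.
  have [u0 [v0 [um vp e]]] := vs.
  rewrite [LHS](hmul_single (p := (u0, v0))) /=.
  - by rewrite /Mhat /Phat !asboolT // e groth_mul // sgn_mul mulrACA.
  - by rewrite hecke_Sne0.
  move=> a b ab ne; rewrite /Mhat /Phat.
  case: asboolP => am; last by rewrite mul0r.
  case: asboolP => bp; last by rewrite mulr0.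
  case: ne; rewrite hecke_Sne0 // in ab.
  by have [-> ->] := Sne0_unique am bp um vp (etrans ab e).
rewrite halgME big_seq big1 // => -[a b]; rewrite mem_hdec /= => /eqP ab.
rewrite /Mhat /Phat.
case: asboolP => am; last by rewrite mul0r.
case: asboolP => bp; last by rewrite mulr0.
by case: vs; exists a, b; split; rewrite // -ab hecke_Sne0.
Qed.

Lemma zint_sorted a k : sorted (fun i j : int => i < j) (zint a k).
Proof.
rewrite /zint sorted_map; apply: sub_sorted (iota_ltn_sorted 0 k) => i j /=; lia.
Qed.

(** The number [g n] of variables is kept independent of the range -n, ..., n of letters: the
    coproduct needs 2n variables, to be split into n for each alphabet. *)
Lemma Fhat_conv (g : nat -> nat) : (forall n, (n <= g n)%N) ->
  hconv (fun n => EX (RT (- n%:Z) (n + n.+1) (zint (1 - (g n)%:Z) (g n)))) Fhat.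
Proof.
move=> gn w m; have [N wN] := letters_bound w; have [M mM] := mset_bound m.
exists (maxn N.+1 M.+1) => n nn; apply/esym/kstanley_coef.
  exact/RT_sorted/zint_sorted.
move=> [a i] /= wa im; rewrite mem_RT /= mem_zint.
by have := wN _ wa; have := mM _ im; have := gn n; lia.
Qed.

Lemma Bhat_conv : hconv (fun n => EX (ST (1 - n%:Z) (n + n))) Bhat.
Proof.
move=> w m; have [N wN] := letters_bound w; have [M mM] := mset_bound m.
exists (maxn N.+1 M.+1) => n nn; apply/esym/bsgroth_coef => -[a i] /= wa im.
by have := wN _ wa; have := mM _ im; lia.
Qed.

Lemma Bhat_factor : Bhat = Fhat * Nhat.
Proof.
rewrite -Nhat_factor mulrA.
apply: (hconv_unique _ Bhat_conv (hconv_mul (hconv_mul (Fhat_conv leqnn) Mhat_conv) Phat_conv)).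
move=> n; rewrite /EX (finite_factor (b' := om) (j := n)) //.
  have -> // : MM om n n = EE [seq (- p.1, om' p.2) | p <- ST 1 n].
  rewrite -[RHS](MM_ST om (leqnn n)) subnn.
  by rewrite (_ : [seq _ | p <- ST _ 0] = [::]) // EE_nil mulr1.
by move=> i; exact: qplus_ominus.
Qed.

Lemma sign_shuffle (R : comNzRingType) (e a b k g : R) :
  e * (a * k * (b * g)) = a * b * e * (k * g).
Proof. by rewrite (mulrACA a) [LHS]mulrA (mulrC e). Qed.

Lemma bsgroth_factor w : bsgroth w =
  \sum_(uv \in [set uv : SZ * SZ | hecke uv.1 uv.2 = w /\ Sne0 uv.2])
      (-1) ^+ (len uv.1 + len uv.2 - len w) * (kstanley uv.1 * groth uv.2).
Proof.
have fin : finite_set [set uv : SZ * SZ | hecke uv.1 uv.2 = w /\ Sne0 uv.2].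
  by apply: (sub_finite_set _ (hdec_finite w)) => p [].
have E : bsgroth w = (-1) ^+ len w * (Fhat * Nhat) w.
  by rewrite -Bhat_factor /Bhat sign_cancel.
transitivity (\sum_(p \in hdec w) (-1) ^+ len w * (Fhat p.1 * Nhat p.2)).
  by rewrite E halgME mulr_sumr fsbig_finite //; exact: hdec_finite.
rewrite -(@fsbig_widen _ _ _ _ [set uv : SZ * SZ | hecke uv.1 uv.2 = w /\ Sne0 uv.2]).
- apply: eq_fsbigr => -[u v]; rewrite inE /= => -[uw vs].
  rewrite /Fhat /Nhat asboolT // -uw sgn_sub.
  exact: sign_shuffle.
- by move=> p [].
move=> [u v] /= [uw nv]; rewrite /Nhat asboolF ?mulr0 // => vs.
by apply: nv.
Qed.

(** * The coproduct *)

Local Notation zz := (int + int)%type.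

(** * Symmetry of the K-Stanley functions *)

Lemma Fhat_supp w : suppin (fun i : int => i <= 0) (Fhat w).
Proof.
move=> m; have [n0 h] := Fhat_conv leqnn w m; rewrite -(h n0) // => nz i im.
have /mapP[[a c] + ->] := EX_supp nz im.
by rewrite mem_RT mem_zint /=; lia.
Qed.

Lemma Sminus_perm (w : SZ) (N n : nat) : Sminus w -> (forall i, (N < `|i|)%N -> w i = i) ->
  (N < n)%N -> perm_eq (map w (zint (1 - n%:Z) n)) (zint (1 - n%:Z) n).
Proof.
move=> wm wN Nn.
have uz : uniq (zint (1 - n%:Z) n) by rewrite map_inj_uniq ?iota_uniq // => i j; lia.
have um : uniq (map w (zint (1 - n%:Z) n)) by rewrite map_inj_uniq //; exact: SZ_inj.
suff sub : {subset map w (zint (1 - n%:Z) n) <= zint (1 - n%:Z) n}.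
  have [|_ e] := uniq_min_size um sub; first by rewrite !size_map.
  by apply: uniq_perm.
move=> _ /mapP[i + ->]; rewrite !mem_zint => iz.
have := Sminus_nonpos i wm; have := wN i; have := SZ_bound_stable wN (i := i).
lia.
Qed.

Lemma prod_AA_map (A : comNzRingType) (K : eqType) (b : K -> A) a k (r r' : seq K) :
  (forall i, exists x', qplus (b i) x' = 0) -> perm_eq r r' ->
  \prod_(i <- r) AA a k (b i) = \prod_(i <- r') AA a k (b i).
Proof.
move=> bb rr; apply: prod_comm_perm rr _ => i j _.
by have [x' h] := bb i; exact: AA_comm h.
Qed.

Lemma EB_RT_perm (A : comNzRingType) (b : int -> A) (w : SZ) a k vs :
  (forall i, exists x', qplus (b i) x' = 0) -> perm_eq (map w vs) vs ->
  EB (fun i : int => b (w i)) (RT a k vs) = EB b (RT a k vs).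
Proof.
move=> bb pw; rewrite !EB_RT -(prod_AA_map _ _ bb pw) big_map //.
Qed.

Lemma pm_comp (K L M : choiceType) (f : K -> L) (g : L -> M) m :
  pm g (pm f m) = pm (g \o f) m.
Proof.
rewrite {1 3}/pm map_comp; apply/eq_seq_msetP; apply: perm_map.
exact: perm_eq_seq_mset.
Qed.

Lemma pm_id (K : choiceType) (f : K -> K) m : (forall i, i \in m -> f i = i) -> pm f m = m.
Proof. by move=> h; rewrite /pm map_id_in // seq_mset_id. Qed.

Lemma eq_in_pm (K L : choiceType) (f g : K -> L) m :
  (forall i, i \in m -> f i = g i) -> pm f m = pm g m.
Proof. by move=> h; rewrite /pm; congr seq_mset; apply/eq_in_map. Qed.

(** Renaming by w permutes the factors C(x_i) of a truncation, and these commute. *)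
Lemma Fhat_sym w u : Sminus w -> subst (fun i => X (w i)) (Fhat u) = Fhat u.
Proof.
move=> wm; have wI : injective w := @SZ_inj w.
apply/funext => m; have em : m = pm w (pm (w^-1)%g m).
  by rewrite pm_comp pm_id // => i _ /=; exact: SZKV.
move: (pm _ m) em => m0 ->; rewrite (ren_pmT wI).
have [N wN] := SZ_bound w.
have [n1 h1] := Fhat_conv leqnn u m0; have [n2 h2] := Fhat_conv leqnn u (pm w m0).
(* Beyond [N], so that [w] permutes the variables of the truncation, and late enough for the
   coefficients at both [m0] and [pm w m0] to be stable. *)
pose n := maxn N.+1 (maxn n1 n2).
rewrite -(h1 n) -?(h2 n); try by rewrite /n; lia.
rewrite -(ren_pmT wI (EX _ _)) subst_EX.
have qb (i : int) : exists x', qplus (X i) x' = 0 by exists (ominus (X i)); exact: qplus_ominus.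
have pw : perm_eq (map w (zint (1 - n%:Z) n)) (zint (1 - n%:Z) n).
  by apply: Sminus_perm wN _ => //; rewrite /n; lia.
by rewrite (EB_RT_perm _ _ qb pw).
Qed.

Lemma kstanleyE u : kstanley u = (-1) ^+ len u * Fhat u.
Proof. by rewrite /Fhat sign_cancel. Qed.

Lemma kstanley_hatLambda u : hatLambda (kstanley u).
Proof.
split=> [m|w wm]; last by rewrite kstanleyE subst_sign Fhat_sym.
rewrite kstanleyE ser_sign => nz i im; apply: (Fhat_supp (w := u) (m := m)) im.
by apply: contra nz => /eqP->; rewrite mulr0.
Qed.

Lemma Rring0 : Rring 0.
Proof. by rewrite -(subrr 1); apply: Rring_sub; exact: Rring_1. Qed.

Lemma Rring_opp f : Rring f -> Rring (- f).
Proof. by move=> h; rewrite -(sub0r f); apply: Rring_sub => //; exact: Rring0. Qed.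

Lemma Rring_add f g : Rring f -> Rring g -> Rring (f + g).
Proof. by move=> hf hg; rewrite -(opprK g); apply: Rring_sub => //; exact: Rring_opp. Qed.

Lemma Rring_X i : Rring (X i).
Proof.
have -> : X i = 1 - (1 - X i) by rewrite subKr.
by apply: Rring_sub; [exact: Rring_1|exact: Rring_gen].
Qed.

Lemma Rring_sign n f : Rring f -> Rring ((-1) ^+ n * f).
Proof.
move=> h; rewrite -signr_odd; case: (odd n); rewrite ?expr0 ?expr1 ?mul1r // mulN1r.
exact: Rring_opp.
Qed.

Lemma Rring_EB (b : int -> series int) l w : (forall i, Rring (b i)) -> Rring (EB b l w).
Proof.
move=> bR; rewrite EB_expand; apply: (big_ind Rring); [exact: Rring0|exact: Rring_add|].
move=> t _; apply: Rring_sign; apply: (big_ind Rring) => //; [exact: Rring_1|exact: Rring_mul].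
Qed.

Lemma Rring_om i : Rring (om i).
Proof.
rewrite /om /ominus; apply: Rring_mul; last exact: Rring_geninv.
by apply: Rring_opp; exact: Rring_X.
Qed.

Lemma groth_Rring v : Sne0 v -> Rring (groth v).
Proof.
move=> [u0 [v0 [um vp ->]]]; rewrite groth_mul //; apply: Rring_mul.
  have [k uk] := Splus_Sn (omega_Splus um); rewrite (grothME uk); apply: Rring_sign.
  by apply: Rring_EB => i; exact: Rring_om.
have [k vk] := Splus_Sn vp; rewrite (grothPE vk); apply: Rring_sign.
by apply: Rring_EB => i; exact: Rring_X.
Qed.

Lemma smul_neq0 (K : choiceType) (f g : series K) m : (f * g) m != 0 ->
  exists a b, [/\ (a `+` b)%mset = m, f a != 0 & g b != 0].
Proof.
move=> nz; apply: contrapT => h; case/eqP: nz; apply: smul_zero => a b ab.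
have [->|fa] := eqVneq (f a) 0; first by rewrite mul0r.
have [->|gb] := eqVneq (g b) 0; first by rewrite mulr0.
by case: h; exists a, b.
Qed.

(** Since only finitely many variables occur in r, a large shift moves the first alphabet out of its
    reach. *)
Lemma Rring_supp r : Rring r ->
  exists B : nat, forall m, r m != 0 -> forall i, i \in m -> (`|i| <= B)%N.
Proof.
have one m (i : int) : (1 : series int) m != 0 -> i \in m -> false.
  by rewrite ser1E; case: (eqVneq m mset0) => [-> _|_]; rewrite ?in_mset0 ?eqxx.
elim=> {r} [|i|i|f g _ [B hB] _ [C hC]|f g _ [B hB] _ [C hC]].
- by exists 0%N => m nz i /(one _ _ nz).
- exists `|i|%N => m nz j jm.
  have [e|ne] := eqVneq m [mset i]%mset; first by move: jm; rewrite e in_mset1 => /eqP->.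
  exfalso; apply: negP (one m j _ jm); first by [].
  by move: nz; rewrite serDE serNE /X (negbTE ne) subr0.
- exists `|i|%N => m; rewrite geomE; case: (eqVneq m (msetn (m i) i)) => [e _ j|_]; last by rewrite eqxx.
  by rewrite e in_msetn => /andP[_ /eqP->].
- exists (maxn B C) => m; rewrite serDE serNE => nz i im.
  have [f0|fn] := eqVneq (f m) 0; last by have := hB m fn i im; lia.
  have [g0|gn] := eqVneq (g m) 0; last by have := hC m gn i im; lia.
  by move: nz; rewrite f0 g0 subr0 eqxx.
exists (maxn B C) => m /smul_neq0[a [b [<- fa gb]]] i.
rewrite in_msetD => /orP[ia|ib]; first by have := hB a fa i ia; lia.
by have := hC b gb i ib; lia.
Qed.

Definition transp_fun (p q i : int) : int := if i == p then q else if i == q then p else i.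

Lemma transp_funK p q : involutive (transp_fun p q).
Proof.
move=> i; rewrite /transp_fun; case: (eqVneq i p) => [->|ip].
  by case: eqVneq => [->//|_]; rewrite eqxx.
case: (eqVneq i q) => [->|iq]; first by rewrite eqxx.
by rewrite (negbTE ip) (negbTE iq).
Qed.

Definition transp (p q : int) : SZ.
Proof.
apply: (@MkSZ (transp_fun p q)); first by exists (transp_fun p q); exact: transp_funK.
apply: (sub_finite_set _ (finite_seq [:: p; q])) => i /=; rewrite !inE /transp_fun.
by repeat (case: eqP => // ?).
Defined.

(** Points are added one at a time by composing with the transposition of w j and phi j. It leaves
    the earlier values alone: they differ from w j by injectivity of w and from phi j by injectivity
    of phi. *)
Lemma Sminus_extend (phi : int -> int) (r : seq int) : uniq r ->
  (forall i, i \in r -> i <= 0) -> (forall i, i \in r -> phi i <= 0) ->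
  {in r &, injective phi} -> exists2 w, Sminus w & {in r, forall i, w i = phi i}.
Proof.
elim: r => [|j r IH] /=.
  by exists 1%g => //; apply: fix_Sminus => i _; rewrite SZ1E.
move=> /andP[jr ur] r0 p0 pI.
have rs i : i \in r -> i \in j :: r by rewrite inE orbC => ->.
have [//| | | |w wm wr] := IH.
- by move=> i /rs /r0.
- by move=> i /rs /p0.
- by move=> i i' /rs hi /rs hi'; exact: pI.
have wj : w j <= 0 by rewrite (Sminus_nonpos _ wm) r0 ?mem_head.
have pj : phi j <= 0 by rewrite p0 ?mem_head.
exists (transp (w j) (phi j) * w)%g.
  apply: fix_Sminus => i i0; rewrite SZmulE (Sminus_fix wm i0) /= /transp_fun.
  by repeat (case: eqP => ?); lia.
move=> i; rewrite inE SZmulE /= /transp_fun => /orP[/eqP->|ir]; first by rewrite eqxx.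
case: eqP => [/SZ_inj ij|_]; first by move: jr; rewrite -ij ir.
case: eqP => [e|_]; last exact: wr.
have ij : i = j by apply: pI; rewrite ?mem_head ?rs // -wr.
by move: jr; rewrite -ij ir.
Qed.

(** Invariance is given under S_- only; [Sminus_extend] supplies an element that agrees with [phi]
    on the finitely many variables of [m]. *)
Lemma hatLambda_sym f (phi : int -> int) (m : {mset int}%mset) : hatLambda f ->
  (forall i, i \in m -> i <= 0) -> (forall i, i \in m -> phi i <= 0) ->
  {in m &, injective phi} -> f (pm phi m) = f m.
Proof.
move=> [_ fS] m0 p0 pI.
have um i : (i \in undup (m : seq int)) = (i \in m) by rewrite mem_undup.
have [| | | |w wm wr] := @Sminus_extend phi (undup m).
- exact: undup_uniq.
- by move=> i; rewrite um => /m0.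
- by move=> i; rewrite um => /p0.
- by move=> i j; rewrite !um; exact: pI.
rewrite (eq_in_pm (g := w)); last by move=> i im; rewrite wr // um.
by rewrite -{1}(fS w wm) (ren_pmT (@SZ_inj w)).
Qed.

(** * Two alphabets and the well-definedness of [Delta] *)

Definition sumv (j : zz) : int := match j with inl i => i | inr i => i end.

Lemma interleave_inj : {in (fun i : int => i <= 0) &, injective interleave}.
Proof.
move=> i j; rewrite !unfold_in => i0 j0; rewrite /interleave.
by case: ifP => oi; case: ifP => oj // [] h; lia.
Qed.

Lemma interleave_nonpos i : sumv (interleave i) <= 0.
Proof. by rewrite /interleave; case: ifP => _ /=; lia. Qed.

Lemma interleave_onto (j : zz) : sumv j <= 0 -> exists2 i : int, i <= 0 & j = interleave i.
Proof.
case: j => c /= c0.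
  exists (2 * c); first by lia.
  by rewrite /interleave ifF; [congr inl; lia|lia].
exists (2 * c - 1); first by lia.
by rewrite /interleave ifT; [congr inr; lia|lia].
Qed.

(* Moves the first alphabet far to the left of the second one. *)
Definition glue (M : nat) (j : zz) : int :=
  match j with inl i => i - M%:Z | inr i => i end.

Lemma coprodL_pos f (n : {mset zz}%mset) (j : zz) : hatLambda f -> j \in n -> 0 < sumv j -> coprodL f n = 0.
Proof.
move=> [fs _] jn j0; apply: (ren_notpm (D := fun i : int => i <= 0)) => [m nz i im|m mD e].
  exact: fs nz _ im.
move: jn; rewrite e mem_pm => /mapP[i _ ei]; move: j0; rewrite ei.
by rewrite ltNge interleave_nonpos.
Qed.

Lemma inr_inj : injective (@inr int int). Proof. by move=> i j []. Qed.
Lemma inl_inj : injective (@inl int int). Proof. by move=> i j []. Qed.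

Lemma ren_inr_inl (r : series int) (n : {mset zz}%mset) (i : int) :
  (inl i : zz) \in n -> subst (fun i : int => X (inr i : zz)) r n = 0.
Proof.
move=> h; apply: ren_notpmT => m e; move: h; rewrite e mem_pm.
by case/mapP.
Qed.

Lemma tens1 (r : series int) : tens 1 r = subst (fun i : int => X (inr i : zz)) r.
Proof.
have e : subst (fun i : int => X (inl i : zz)) 1 = 1 by exact: ren1.
rewrite -[RHS]mul1r /tens.
exact: (congr1 (fun g => g * subst (fun i : int => X (inr i : zz)) r) e).
Qed.

Lemma smset_bound (n : {mset zz}%mset) :
  exists M : nat, forall j, j \in n -> (`|sumv j| <= M)%N.
Proof.
exists (\max_(j <- n) `|sumv j|%N) => i im.
by rewrite (big_rem i im) /= leq_maxl.
Qed.

Lemma tensor_coef (f r : series int) (n : {mset zz}%mset) : hatLambda f -> Rring r ->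
  exists M0 : nat, forall M, (M0 <= M)%N ->
    (coprodL f * tens 1 r) n =
    if `[< forall i : int, (inl i : zz) \in n -> i <= 0 >] then (f * r) (pm (glue M) n) else 0.
Proof.
move=> fL rR; have [B hB] := Rring_supp rR; have [C hC] := smset_bound n.
(* The indices i - M then avoid [-B, B], which holds the variables of r, and [-C, C], which holds
   those of the second alphabet. *)
exists (B + C + C + 1)%N => M MM; rewrite tens1; case: asboolP => n0; last first.
  have [i [ni i0]] : exists i : int, (inl i : zz) \in n /\ 0 < i.
    apply: contrapT => h; apply: n0 => i ni; rewrite leNgt; apply/negP => i0.
    by apply: h; exists i.
  apply: smul_zero => a b ab; move: ni; rewrite -ab in_msetD => /orP[ia|ib].
    by rewrite (coprodL_pos fL ia) ?mul0r.
  by rewrite (ren_inr_inl _ ib) mulr0.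
pose Dn : pred zz := fun j => j \in n.
have gI : {in Dn &, injective (glue M)}.
  move=> j j' /hC hj /hC hj'; case: j j' hj hj' => [i|i] [i'|i'] /= hi hi' e.
  - by congr inl; lia.
  - by lia.
  - by lia.
  by congr inr.
rewrite -[LHS]/(series_mul _ _ n) -[RHS]/(series_mul _ _ (pm (glue M) n)) /series_mul.
pose h (p : {mset zz}%mset * {mset zz}%mset) := (pm (glue M) p.1, pm (glue M) p.2).
rewrite (reindex_fsbig h (decomp n)); last first.
  split.
  - by move=> [p q] /=; rewrite /decomp /= -pmD => ->.
  - move=> [p q] [p' q']; rewrite !inE /decomp /= => pq pq' [e1 e2].
    have sub (a b : {mset zz}%mset) : (a `+` b)%mset = n ->
        (forall j, j \in a -> Dn j) /\ (forall j, j \in b -> Dn j).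
      by move=> abn; split => j ja; rewrite /Dn -abn in_msetD ja ?orbT.
    have [s1 s2] := sub _ _ pq; have [s1' s2'] := sub _ _ pq'.
    by rewrite (pm_inj gI s1 s1' e1) (pm_inj gI s2 s2' e2).
  move=> [a b] /= ab; have [//|p [q [pq /= pa qb]]] := pm_split gI _ ab.
  by exists (p, q) => //; rewrite /h /= -pa -qb.
suff key (p q : {mset zz}%mset) : (p `+` q)%mset = n ->
    coprodL f p * subst (fun i : int => X (inr i : zz)) r q =
    f (pm (glue M) p) * r (pm (glue M) q).
  by apply: eq_fsbigr => -[p q]; rewrite inE; exact: key.
move=> pq; have pn j : j \in p -> j \in n by rewrite -pq in_msetD => ->.
have qn j : j \in q -> j \in n by rewrite -pq in_msetD orbC => ->.
congr (_ * _); last first.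
  have [[i iq]|nq] := pselect (exists i : int, (inl i : zz) \in q).
    rewrite (ren_inr_inl _ iq); apply/esym/eqP; apply: contraT => /hB.
    move=> /(_ (i - M%:Z)); rewrite mem_pm (map_f (glue M) iq) => /(_ isT).
    by have := hC _ (qn _ iq); rewrite /=; lia.
  have [|m2 -> _] := @pm_lift _ _ (@inr int int) (fun=> True) q.
    by case=> i iq; [case: nq; exists i|exists i].
  by rewrite (ren_pmT inr_inj) pm_comp pm_id.
(* A positive index in [p] kills both sides: by the case assumption it belongs to the second
   alphabet, where [glue] leaves it positive. *)
have [[j jp j0]|np] := pselect (exists2 j, j \in p & 0 < sumv j).
  rewrite (coprodL_pos fL jp j0); apply/esym/eqP; apply: contraT => nz.
  case: j jp j0 => i jp /= i0; first by have := n0 i (pn _ jp); lia.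
  have := (fL.1 _ nz i); rewrite mem_pm (map_f (glue M) jp) => /(_ isT).
  by lia.
have p0 j : j \in p -> sumv j <= 0.
  by move=> jp; rewrite leNgt; apply/negP => j0; apply: np; exists j.
have [|m1 e1 m10] := @pm_lift _ _ interleave (fun i : int => i <= 0) p.
  by move=> j /p0 /interleave_onto.
have i1 i : i \in m1 -> interleave i \in p by move=> im; rewrite e1 mem_pm map_f.
rewrite {1}e1 /coprodL (ren_pm interleave_inj) //; last by move=> m nz i im; exact: fL.1 nz _ im.
rewrite e1 pm_comp hatLambda_sym // => [i im|i i' im im' e] /=.
  by have := p0 _ (i1 _ im); case: (interleave i) => c /=; lia.
apply: interleave_inj; [exact: m10|exact: m10|].
by apply: gI e; apply: pn; exact: i1.
Qed.

Lemma tensor_sum_coef t (n : {mset zz}%mset) : is_tensor t ->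
  exists M0 : nat, forall M, (M0 <= M)%N ->
    (\sum_(fr <- t) coprodL fr.1 * tens 1 fr.2) n =
    if `[< forall i : int, (inl i : zz) \in n -> i <= 0 >]
    then (\sum_(fr <- t) fr.1 * fr.2) (pm (glue M) n) else 0.
Proof.
move=> ht; have [M0 h] : exists M0 : nat, forall M, (M0 <= M)%N -> forall fr, fr \in t ->
    (coprodL fr.1 * tens 1 fr.2) n =
    if `[< forall i : int, (inl i : zz) \in n -> i <= 0 >] then (fr.1 * fr.2) (pm (glue M) n) else 0.
  by apply: eventually_all => fr /ht[fL rR]; exact: tensor_coef.
exists M0 => M MM; rewrite !ser_sumE (eq_big_seq _ (h M MM)).
by case: asboolP => // _; rewrite big1.
Qed.

(** By [tensor_sum_coef] each coefficient of the right-hand side can be read off from the series on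
    the left, so all decompositions give the same value. *)
Lemma Delta_tensor t : is_tensor t ->
  Delta (\sum_(fr <- t) fr.1 * fr.2) = \sum_(fr <- t) coprodL fr.1 * tens 1 fr.2.
Proof.
move=> ht; apply: xget_unique; first by exists t.
move=> H [t' [ht' e ->]]; apply/funext => n.
have [M1 h1] := tensor_sum_coef n ht; have [M2 h2] := tensor_sum_coef n ht'.
by rewrite (h1 (maxn M1 M2)) ?(h2 (maxn M1 M2)) ?e //; lia.
Qed.

Definition hren (K : choiceType) (phi : int -> K) (F : halg (series int)) : halg (series K) :=
  fun w => subst (fun i => X (phi i)) (F w).

Lemma hconv_ren (K : choiceType) (phi : int -> K) (D : pred int) F f :
  {in D &, injective phi} -> (forall n w, suppin D (F n w)) -> (forall w, suppin D (f w)) ->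
  hconv F f -> hconv (fun n => hren phi (F n)) (hren phi f).
Proof.
move=> pI FD fD Ff w m; rewrite /hren.
have [[m0 m0D ->]|h] := pselect (exists2 m0, (forall j, j \in m0 -> D j) & m = pm phi m0).
  have [n0 h0] := Ff w m0; exists n0 => n nn.
  by rewrite !(ren_pm pI) ?h0.
by exists 0%N => n _; rewrite !(ren_notpm (D := D)) // => m0 m0D e; apply: h; exists m0.
Qed.

Lemma hren_EX (K : choiceType) (phi : int -> K) l : hren phi (EX l) = EB (fun i => X (phi i)) l.
Proof. by apply/funext => w; rewrite /hren subst_EX. Qed.

Lemma hren_mul (K : choiceType) (phi : int -> K) F G : injective phi ->
  hren phi (F * G) = hren phi F * hren phi G.
Proof.
move=> pI; apply/funext => w; rewrite /hren !halgME (ren_sum pI).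
by apply: eq_bigr => p _; rewrite (ren_mul pI).
Qed.

Lemma interleave_perm n : perm_eq (map interleave (zint (1 - (n + n)%:Z) (n + n)))
  (map (@inl int int) (zint (1 - n%:Z) n) ++ map (@inr int int) (zint (1 - n%:Z) n)).
Proof.
have uz (a : int) k : uniq (zint a k) by rewrite map_inj_uniq ?iota_uniq // => i j; lia.
have u1 : uniq (map interleave (zint (1 - (n + n)%:Z) (n + n))).
  rewrite map_inj_in_uniq // => i j; rewrite !mem_zint => hi hj.
  by apply: interleave_inj; rewrite unfold_in; lia.
have u2 : uniq (map (@inl int int) (zint (1 - n%:Z) n) ++ map (@inr int int) (zint (1 - n%:Z) n)).
  rewrite cat_uniq (map_inj_uniq inl_inj) (map_inj_uniq inr_inj) !uz /= andbT.
  by apply/hasPn => _ /mapP[i _ ->]; apply/mapP => -[].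
have [| |_ e] := uniq_min_size (s2 := map (@inl int int) (zint (1 - n%:Z) n)
    ++ map (@inr int int) (zint (1 - n%:Z) n)) u1; last exact: uniq_perm.
  move=> _ /mapP[i + ->]; rewrite mem_zint mem_cat /interleave => hi.
  by case: ifP => oi; apply/orP; [right|left]; rewrite map_f // mem_zint; lia.
by rewrite size_cat !size_map !size_iota.
Qed.

Lemma EX_RT_supp a k n w : suppin (fun i : int => i <= 0) (EX (RT a k (zint (1 - n%:Z) n)) w).
Proof.
move=> m nz i im; have /mapP[[c j] + ->] := EX_supp nz im.
by rewrite mem_RT mem_zint /=; lia.
Qed.

Lemma EB_RT_cat (A : comNzRingType) (K : eqType) (b : K -> A) (f : int -> K) (g h : int -> K)
    a k vs vs' : (forall i, exists x', qplus (b i) x' = 0) ->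
  perm_eq (map f vs') (map g vs ++ map h vs) ->
  EB (fun i => b (f i)) (RT a k vs') =
  EB (fun i => b (g i)) (RT a k vs) * EB (fun i => b (h i)) (RT a k vs).
Proof.
move=> bb pe; have := prod_AA_map a k bb pe; rewrite big_cat !big_map => e.
by rewrite !EB_RT.
Qed.

(** The truncation in 2n interleaved variables is, up to the order of its commuting factors, the
    product of the truncations in n variables of each alphabet, for the same range of letters. *)
Lemma coprodL_Fhat : hren interleave Fhat = hren (fun i : int => inl i : zz) Fhat * hren (fun i : int => inr i : zz) Fhat.
Proof.
have c1 := hconv_ren interleave_inj (fun n w => @EX_RT_supp _ _ _ w) Fhat_supp
  (Fhat_conv (fun n => leq_addr n n)).
have injl : {in predT &, injective (@inl int int)} by move=> i j _ _; exact: inl_inj.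
have injr : {in predT &, injective (@inr int int)} by move=> i j _ _; exact: inr_inj.
have c2 := hconv_ren injl (fun _ _ => @suppinT _ _) (fun _ => @suppinT _ _) (Fhat_conv leqnn).
have c3 := hconv_ren injr (fun _ _ => @suppinT _ _) (fun _ => @suppinT _ _) (Fhat_conv leqnn).
apply: (hconv_unique _ c1 (hconv_mul c2 c3)) => n; rewrite !hren_EX.
apply: (EB_RT_cat (b := fun j => X j)); last exact: interleave_perm.
by move=> j; exists (ominus (X j)); exact: qplus_ominus.
Qed.

Lemma sign_shuffle_r (R : comNzRingType) (e a b k g : R) :
  k * (a * b * e * g) = e * (a * k * (b * g)).
Proof. by rewrite sign_shuffle mulrCA. Qed.

Lemma hren_Fhat (K : choiceType) (phi : int -> K) u :
  hren phi Fhat u = (-1) ^+ len u * subst (fun i => X (phi i)) (kstanley u).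
Proof. exact: subst_sign. Qed.

Lemma hren_Bhat (K : choiceType) (phi : int -> K) v :
  hren phi Bhat v = (-1) ^+ len v * subst (fun i => X (phi i)) (bsgroth v).
Proof. exact: subst_sign. Qed.

Lemma hren_Nhat (K : choiceType) (phi : int -> K) v : Sne0 v ->
  hren phi Nhat v = (-1) ^+ len v * subst (fun i => X (phi i)) (groth v).
Proof. by move=> vs; rewrite -subst_sign /hren /Nhat asboolT. Qed.

Lemma hren_Nhat0 (K : choiceType) (phi : int -> K) v : ~ Sne0 v -> hren phi Nhat v = 0.
Proof.
move=> vs; rewrite /hren /Nhat asboolF //; apply/funext => m.
by rewrite substE fsbig1 // => m' _; rewrite mulr0.
Qed.

Lemma tens1_sign n g :
  tens 1 ((-1) ^+ n * g) = (-1) ^+ n * subst (fun i : int => X (inr i : int + int)) g.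
Proof. by rewrite -subst_sign; exact: tens1. Qed.

Lemma coproduct_factor :
  hren interleave Fhat * hren (fun i : int => inr i : int + int) Nhat =
  hren (fun i : int => inl i : int + int) Fhat * hren (fun i : int => inr i : int + int) Bhat.
Proof.
have e : hren (fun i : int => inr i : int + int) Bhat =
    hren (fun i : int => inr i : int + int) Fhat * hren (fun i : int => inr i : int + int) Nhat.
  rewrite [in LHS]Bhat_factor; apply: hren_mul; exact: inr_inj.
by rewrite coprodL_Fhat e mulrA.
Qed.

Lemma Delta_bsgroth w : Delta (bsgroth w) =
  \sum_(uv \in [set uv : SZ * SZ | hecke uv.1 uv.2 = w])
      (-1) ^+ (len uv.1 + len uv.2 - len w) * tens (kstanley uv.1) (bsgroth uv.2).
Proof.
pose S := [set uv : SZ * SZ | hecke uv.1 uv.2 = w /\ Sne0 uv.2].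
have fS : finite_set S by apply: (sub_finite_set _ (hdec_finite w)) => p [].
pose r (uv : SZ * SZ) : series int := (-1) ^+ (len uv.1 + len uv.2 - len w) * groth uv.2.
(* The second formula supplies the decomposition on which [Delta] is evaluated; the signs go into
   the R factor. *)
pose t := [seq (kstanley uv.1, r uv) | uv <- fset_set S].
have ht : is_tensor t.
  move=> _ /mapP[uv + ->]; rewrite in_fset_set // inE => -[_ vs] /=; split.
    exact: kstanley_hatLambda.
  by apply: Rring_sign; exact: groth_Rring.
have et : bsgroth w = \sum_(fr <- t) fr.1 * fr.2.
  rewrite bsgroth_factor -/S fsbig_finite // big_map; apply: eq_bigr => uv _.
  exact: mulrCA.
rewrite {1}et (Delta_tensor ht) big_map.
transitivity ((-1) ^+ len w * (hren interleave Fhat * hren (fun i : int => inr i : int + int) Nhat) w).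
  rewrite halgME mulr_sumr -(fsbig_finite _ _ (hdec_finite w)) -(fsbig_finite _ _ fS).
  (* Pairs with v outside [Sne0] contribute 0 to the product, so the sum over all factorizations
     reduces to the decomposition. *)
  rewrite -[RHS](@fsbig_widen _ _ _ _ S).
  - apply: eq_fsbigr => -[u v]; rewrite inE /S /= => -[uw vs].
    transitivity (coprodL (kstanley u) * ((-1) ^+ len u * (-1) ^+ len v * (-1) ^+ len w *
        subst (fun i : int => X (inr i : int + int)) (groth v))).
      apply: (congr1 (fun g => coprodL (kstanley u) * g)).
      by rewrite /r tens1_sign /= -uw sgn_sub.
    rewrite hren_Fhat (hren_Nhat _ vs); exact: sign_shuffle_r.
  - by move=> p [].
  move=> [u v] /= [uw nv]; rewrite hren_Nhat0 ?mulr0 // => vs.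
  by apply: nv.
rewrite coproduct_factor halgME mulr_sumr.
rewrite -(fsbig_finite _ _ (hdec_finite w)); apply: eq_fsbigr => -[u v]; rewrite inE /hdec /= => uw.
rewrite hren_Fhat hren_Bhat -uw sgn_sub.
exact: sign_shuffle.
Qed.

Theorem theorem4p15 (w : SZ) :
  Delta (bsgroth w) =
    \sum_(uv \in [set uv : SZ * SZ | hecke uv.1 uv.2 = w])
      (-1) ^+ (len uv.1 + len uv.2 - len w) * tens (kstanley uv.1) (bsgroth uv.2)
  /\
  bsgroth w =
    \sum_(uv \in [set uv : SZ * SZ | hecke uv.1 uv.2 = w /\ Sne0 uv.2])
      (-1) ^+ (len uv.1 + len uv.2 - len w) * (kstanley uv.1 * groth uv.2).
Proof.
split; [exact: Delta_bsgroth|exact: bsgroth_factor].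
Qed.
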